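(* The FO model checking problem of unlabelled polygon visibility graphs, where the input is the representing polygon $W$ (together with its visibility graph) and an FO sentence $\phi$, parameterized by $|\phi|$, is $AW[*]$-complete, even when restricted to polygons $W$ that are simultaneously a terrain and a convex fan.
   Context: For a polygon $W$, two vertices $p_i,p_j$ are mutually visible if the segment $p_ip_j$ does not intersect the exterior of $W$; the visibility graph of $W$ has the vertices of $W$ as vertices and edges between mutually visible pairs. A vertex is reflex if its interior angle exceeds $\pi$, convex otherwise. $W$ is a terrain if its boundary consists of an x-monotone polygonal arc touching the x-axis at its two extreme points together with the segment of the x-axis joining these points. $W$ is a fan if all points of $W$ are visible from a single vertex $v$, and a convex fan if moreover $v$ is a convex vertex. FO logic of unlabelled graphs uses vertex quantification, equality and adjacency. $AW[*]$ is the parameterized complexity class of Downey and Fellows. *)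

(* Defs.v *)
From HB Require Import structures.
From Corelib Require Import BinNums.
From mathcomp Require Import all_boot all_order all_algebra.
From mathcomp Require Import all_classical all_reals all_analysis.

Set Implicit Arguments.
Unset Strict Implicit.
Unset Printing Implicit Defensive.

Import Order.TTheory GRing.Theory Num.Theory.
Import numFieldNormedType.Exports.

Local Open Scope classical_set_scope.

(** * Machine model

    Structured programs over finitely many stacks of bits, every push, pop and
    test costing one step.  A Turing tape is a pair of stacks, and conversely a
    stack is a tape used on one side of its head only, so this is the
    deterministic multitape Turing machine up to a constant factor in time. *)

Definition word := seq bool.
Definition store := nat -> word.

Definition upd T (s : nat -> T) (r : nat) (v : T) : nat -> T :=
  fun q => if q == r then v else s q.

Inductive test :=
| NonEmpty of nat
| TopIs1 of nat.

Definition test_holds (b : test) (s : store) : bool :=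
  match b with
  | NonEmpty r => s r != [::]
  | TopIs1 r => head false (s r)
  end.

Inductive prog :=
| Push of nat & bool
| Pop of nat
| Comp of prog & prog
| Ite of test & prog & prog
| While of test & prog.

(** [run p s n s']: from [s], [p] halts in [s'] after exactly [n] steps. *)
Inductive run : prog -> store -> nat -> store -> Prop :=
| RunPush r b s : run (Push r b) s 1 (upd s r (b :: s r))
| RunPop r s : run (Pop r) s 1 (upd s r (behead (s r)))
| RunComp p q s1 s2 s3 n m :
    run p s1 n s2 -> run q s2 m s3 -> run (Comp p q) s1 (n + m) s3
| RunIteT b p q s s' n :
    test_holds b s -> run p s n s' -> run (Ite b p q) s n.+1 s'
| RunIteF b p q s s' n :
    ~~ test_holds b s -> run q s n s' -> run (Ite b p q) s n.+1 s'
| RunWhileT b p s1 s2 s3 n m :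
    test_holds b s1 -> run p s1 n s2 -> run (While b p) s2 m s3 ->
    run (While b p) s1 (n + m).+1 s3
| RunWhileF b p s : ~~ test_holds b s -> run (While b p) s 1 s.

Definition load (w : word) (k : nat) : store :=
  fun r => if r == 0 then w else if r == 1 then nseq k true else [::].

(** [maps_in p w k w' k' n]: on input [(w, k)] the program outputs [(w', k')]
    within [n] steps; numbers in this interface are written in unary, and the
    stacks other than 0 and 1 may hold anything at the end. *)
Definition maps_in (p : prog) (w : word) (k : nat) (w' : word) (k' n : nat) :=
  exists s m, [/\ run p (load w k) m s, m <= n, s 0 = w' & s 1 = nseq k' true].

Definition computable (f : nat -> nat) : Prop :=
  exists p, forall k, exists w n, maps_in p [::] k w (f k) n.

(** * Parameterized problems and fpt reductions *)

(** A parameterized problem is a set of instances ([valid]) together with the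
    subset of yes-instances; a machine is given the code of an instance and
    its parameter, and is only ever run on valid instances. *)
Record pproblem := PProblem {
  inst : Type;
  valid : inst -> Prop;
  yes : inst -> Prop;
  code : inst -> word;
  param : inst -> nat;
  code_inj : injective (fun x => (code x, param x))
}.

Definition fpt_reduces (P Q : pproblem) : Prop :=
  exists (p : prog) (f g : nat -> nat) (c : nat),
    [/\ computable f, computable g &
    forall x : inst P, valid x -> exists y : inst Q,
      [/\ valid y,
          maps_in p (code x) (param x) (code y) (param y)
            (f (param x) * (size (code x)).+1 ^ c)%N,
          param y <= g (param x) &
          yes x <-> yes y]].

(** * Codes of finite objects *)

Definition prefix_code T (e : T -> word) : Prop :=
  forall x y s t, e x ++ s = e y ++ t -> x = y /\ s = t.

Definition enc_bool (b : bool) : word := [:: b].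

Definition enc_pair A B (ea : A -> word) (eb : B -> word) (x : A * B) : word :=
  ea x.1 ++ eb x.2.

Definition enc_seq T (e : T -> word) (s : seq T) : word :=
  foldr (fun x w => true :: e x ++ w) [:: false] s.

Fixpoint pos_bits (p : positive) : word :=
  match p with
  | xH => [:: true]
  | xO q => false :: pos_bits q
  | xI q => true :: pos_bits q
  end.

(** Binary expansion, least significant bit first. *)
Definition nat_bits (n : nat) : word :=
  match bin_of_nat n with N0 => [::] | Npos p => pos_bits p end.

Definition enc_nat (n : nat) : word := enc_seq enc_bool (nat_bits n).

Definition enc_int (z : int) : word :=
  match z with Posz n => false :: enc_nat n | Negz n => true :: enc_nat n end.

Definition enc_rat (q : rat) : word := enc_int (numq q) ++ enc_int (denq q).

Lemma prefix_code_inj T (e : T -> word) : prefix_code e -> injective e.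
Proof. by move=> eP x y exy; have [] := eP x y [::] [::] (congr1 (cat^~ _) exy). Qed.

Lemma prefix_bool : prefix_code enc_bool.
Proof. by move=> x y s t [-> ->]. Qed.

Lemma prefix_pair A B (ea : A -> word) (eb : B -> word) :
  prefix_code ea -> prefix_code eb -> prefix_code (enc_pair ea eb).
Proof.
move=> aP bP [a b] [a' b'] s t; rewrite /enc_pair /= -!catA.
by move=> /aP[-> /bP[-> ->]].
Qed.

Lemma prefix_seq T (e : T -> word) : prefix_code e -> prefix_code (enc_seq e).
Proof.
move=> eP; elim=> [|x l IH] [|y l'] s t //=; first by move=> [->].
by rewrite -!catA => -[/eP[-> /IH[-> ->]]].
Qed.

Lemma pos_bits_nil p : pos_bits p <> [::]. Proof. by case: p. Qed.

Lemma pos_bits_inj : injective pos_bits.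
Proof.
elim=> [p IH|p IH|] [q|q|] //=; try by move=> [/IH ->].
- by move=> [/pos_bits_nil].
- by move=> [/esym/pos_bits_nil].
Qed.

Lemma nat_bits_inj : injective nat_bits.
Proof.
move=> m n; rewrite /nat_bits => E; apply: (can_inj bin_of_natK).
case: (bin_of_nat m) (bin_of_nat n) E => [|p] [|q] //.
- by move=> /esym/pos_bits_nil.
- by move=> /pos_bits_nil.
- by move=> /pos_bits_inj ->.
Qed.

Lemma prefix_nat : prefix_code enc_nat.
Proof.
by move=> m n s t /(prefix_seq prefix_bool)[/nat_bits_inj -> ->].
Qed.

Lemma prefix_int : prefix_code enc_int.
Proof. by case=> m [n|n] s t //= [/prefix_nat[-> ->]]. Qed.

Lemma prefix_rat : prefix_code enc_rat.
Proof.
move=> x y s t; rewrite /enc_rat -!catA => /prefix_int[nE /prefix_int[dE ->]].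
by split=> //; rewrite -(divq_num_den x) -(divq_num_den y) nE dE.
Qed.

(** * The class AW[*]

    [AW t] is the closure under fpt reductions of parameterized QBFSAT_t. *)

(** [(b, x)] stands for the variable [x] if [b], and for its negation if not. *)
Definition literal : Type := bool * nat.

(** t-normalized formulas: [t] alternating layers of conjunctions and
    disjunctions of literals, the outermost layer being a conjunction. *)
Fixpoint tnorm (t : nat) : Type :=
  if t is t'.+1 then seq (tnorm t') else literal.

Fixpoint tnorm_eval (conj : bool) (t : nat) (T : pred nat) : tnorm t -> bool :=
  match t with
  | 0 => fun l => if l.1 then T l.2 else ~~ T l.2
  | t'.+1 => fun F => if conj then all (tnorm_eval (~~ conj) T) F
                      else has (tnorm_eval (~~ conj) T) F
  end.

Fixpoint tnorm_vars (t : nat) : tnorm t -> seq nat :=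
  match t with
  | 0 => fun l => [:: l.2]
  | t'.+1 => fun F => flatten (map (@tnorm_vars t') F)
  end.

Fixpoint enc_tnorm (t : nat) : tnorm t -> word :=
  match t with
  | 0 => enc_pair enc_bool enc_nat
  | t'.+1 => enc_seq (@enc_tnorm t')
  end.

(** The quantifier prefix: blocks [(s_i, k_i)] of variables with the number of
    those to be made true.  [T] collects the variables made true so far; as the
    [s_i] are duplicate-free, their subsets are their subsequences. *)
Fixpoint qbf_true (ex : bool) (blocks : seq (seq nat * nat)) (T : seq nat)
    (t : nat) (F : tnorm t) : Prop :=
  match blocks with
  | [::] => tnorm_eval true (mem T) F
  | (s, k) :: bl =>
      if ex then exists U, [/\ subseq U s, size U = k & qbf_true false bl (T ++ U) F]
      else forall U, subseq U s -> size U = k -> qbf_true true bl (T ++ U) F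
  end.

Definition qbf_inst (t : nat) : Type := seq (seq nat * nat) * tnorm t.

Definition qbf_valid (t : nat) (I : qbf_inst t) : Prop :=
  let vars := flatten (map fst I.1) in
  uniq vars /\ {subset tnorm_vars I.2 <= vars}.

Definition qbf_code (t : nat) : qbf_inst t -> word :=
  enc_pair (enc_seq (enc_pair (enc_seq enc_nat) enc_nat)) (@enc_tnorm t).

(** The parameter is the tuple (r, k_1, ..., k_r), measured by its sum. *)
Definition qbf_param (t : nat) (I : qbf_inst t) : nat :=
  size I.1 + sumn (map snd I.1).

Lemma prefix_tnorm t : prefix_code (@enc_tnorm t).
Proof.
elim: t => [|t IH] /=; last exact: prefix_seq.
exact: prefix_pair prefix_bool prefix_nat.
Qed.

Lemma qbf_code_inj t : injective (fun I => (@qbf_code t I, qbf_param I)).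
Proof.
move=> x y [E _]; apply: prefix_code_inj E; apply: prefix_pair (@prefix_tnorm t).
exact: prefix_seq (prefix_pair (prefix_seq prefix_nat) prefix_nat).
Qed.

Definition QBFSAT (t : nat) : pproblem :=
  {| inst := qbf_inst t;
     valid := @qbf_valid t;
     yes := fun I => qbf_true true I.1 [::] I.2;
     code := @qbf_code t;
     param := @qbf_param t;
     code_inj := @qbf_code_inj t |}.

Definition AW (t : nat) (P : pproblem) : Prop := fpt_reduces P (QBFSAT t).

Definition AWstar (P : pproblem) : Prop := exists2 t, 0 < t & AW t P.

Definition AWstar_hard (Q : pproblem) : Prop :=
  forall P, AWstar P -> fpt_reduces P Q.

Definition AWstar_complete (Q : pproblem) : Prop := AWstar Q /\ AWstar_hard Q.

(** * First-order logic of graphs *)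

Inductive fo :=
| FOEq of nat & nat
| FOAdj of nat & nat
| FONot of fo
| FOAnd of fo & fo
| FOOr of fo & fo
| FOEx of nat & fo
| FOAll of nat & fo.

Fixpoint fo_free (phi : fo) : seq nat :=
  match phi with
  | FOEq i j | FOAdj i j => [:: i; j]
  | FONot f => fo_free f
  | FOAnd f g | FOOr f g => fo_free f ++ fo_free g
  | FOEx i f | FOAll i f => [seq j <- fo_free f | j != i]
  end.

Definition sentence (phi : fo) : Prop := fo_free phi = [::].

Fixpoint fo_holds (V : finType) (e : rel V) (s : nat -> V) (phi : fo) : bool :=
  match phi with
  | FOEq i j => s i == s j
  | FOAdj i j => e (s i) (s j)
  | FONot f => ~~ fo_holds e s f
  | FOAnd f g => fo_holds e s f && fo_holds e s g
  | FOOr f g => fo_holds e s f || fo_holds e s g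
  | FOEx i f => [exists v, fo_holds e (upd s i v) f]
  | FOAll i f => [forall v, fo_holds e (upd s i v) f]
  end.

(** For a sentence and a nonempty graph the assignment is irrelevant. *)
Definition fo_models (V : finType) (e : rel V) (phi : fo) : Prop :=
  forall s, fo_holds e s phi.

Fixpoint enc_fo (phi : fo) : word :=
  match phi with
  | FOEq i j => [:: false; false; false] ++ enc_nat i ++ enc_nat j
  | FOAdj i j => [:: false; false; true] ++ enc_nat i ++ enc_nat j
  | FONot f => [:: false; true; false] ++ enc_fo f
  | FOAnd f g => [:: false; true; true] ++ enc_fo f ++ enc_fo g
  | FOOr f g => [:: true; false; false] ++ enc_fo f ++ enc_fo g
  | FOEx i f => [:: true; false; true] ++ enc_nat i ++ enc_fo f
  | FOAll i f => [:: true; true; false] ++ enc_nat i ++ enc_fo f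
  end.

Definition fo_size (phi : fo) : nat := size (enc_fo phi).

Lemma prefix_fo : prefix_code enc_fo.
Proof.
elim=> [i j|i j|f IHf|f IHf g IHg|f IHf g IHg|i f IHf|i f IHf]
  [i' j'|i' j'|f'|f' g'|f' g'|i' f'|i' f'] s t //=; rewrite -?catA => -[].
- by move=> /prefix_nat[-> /prefix_nat[-> ->]].
- by move=> /prefix_nat[-> /prefix_nat[-> ->]].
- by move=> /IHf[-> ->].
- by move=> /IHf[-> /IHg[-> ->]].
- by move=> /IHf[-> /IHg[-> ->]].
- by move=> /prefix_nat[-> /IHf[-> ->]].
- by move=> /prefix_nat[-> /IHf[-> ->]].
Qed.

(** * Polygons *)

(** A polygon is the cyclic sequence of its vertices, which are rational so as
    to have finite codes; the geometry takes place in the real plane. *)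
Definition polygon : Type := seq (rat * rat).

Section Polygons.
Local Open Scope ring_scope.
Variable R : realType.
Notation plane := (R * R)%type.

Definition segment (p q : plane) : set plane :=
  [set p + t *: (q - p) | t in [set t : R | 0 <= t <= 1]].

Variable W : polygon.

Definition vertex (i : nat) : plane :=
  let v := nth (0, 0) W (i %% size W) in (ratr v.1, ratr v.2).

Definition edge (i : nat) : set plane := segment (vertex i) (vertex i.+1).

Definition boundary : set plane := \bigcup_(i < size W) edge i.

(** Two distinct edges only meet in a common endpoint.  Vertices with a flat
    angle are allowed. *)
Definition simple_polygon : Prop :=
  [/\ (3 <= size W)%N, uniq W &
   forall i j, (i < size W)%N -> (j < size W)%N -> i != j ->
     edge i `&` edge j `<=`
       [set vertex i; vertex i.+1] `&` [set vertex j; vertex j.+1]].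

Definition exterior : set plane :=
  [set z | ~ boundary z /\
           ~ bounded_set (connected_component (~` boundary) z)].

Definition region : set plane := ~` exterior.

Definition inside : set plane := region `\` boundary.

Definition visible (p q : plane) : Prop := segment p q `&` exterior = set0.

Definition visibility_graph : rel 'I_(size W) :=
  fun i j => (i != j) && `[< visible (vertex i) (vertex j) >].

Definition adjacency_bits : word :=
  [seq visibility_graph i j | i <- enum 'I_(size W), j <- enum 'I_(size W)].

(** The measure of the set of directions pointing from [z] into the polygon. *)
Definition interior_angle (z : plane) : \bar R :=
  lebesgue_measure [set a : R | 0 <= a < 2 * pi /\
    \forall t \near 0^'+, inside (z + t *: (cos a, sin a))].

Definition reflex (i : nat) : Prop := (pi%:E < interior_angle (vertex i))%E.

Definition convex_fan : Prop :=
  exists i, [/\ (i < size W)%N, ~ reflex i &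
             region `<=` [set z | visible (vertex i) z]].

Definition polyline (a : seq plane) : set plane :=
  \bigcup_(i < (size a).-1) segment (nth 0 a i) (nth 0 a i.+1).

(** x-monotone is taken strictly: no vertical line meets the arc twice. *)
Definition terrain : Prop :=
  exists a : seq plane,
    let l := head 0 a in let r := last 0 a in
    [/\ sorted (fun p q : plane => p.1 < q.1) a,
        polyline a `&` [set z | z.2 = 0] = [set l; r] &
        boundary = polyline a `|` segment l r].

End Polygons.

(** * FO model checking of polygon visibility graphs *)

Section ModelChecking.
Variables (R : realType) (C : polygon -> Prop).

Definition vis_valid (I : polygon * fo) : Prop :=
  [/\ simple_polygon R I.1, C I.1 & sentence I.2].

Definition vis_yes (I : polygon * fo) : Prop :=
  fo_models (@visibility_graph R I.1) I.2.

Definition vis_code (I : polygon * fo) : word :=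
  enc_seq (enc_pair enc_rat enc_rat) I.1 ++
  enc_seq enc_bool (adjacency_bits R I.1) ++ enc_fo I.2.

Definition vis_param (I : polygon * fo) : nat := fo_size I.2.

Lemma vis_code_inj : injective (fun I => (vis_code I, vis_param I)).
Proof.
move=> [W f] [W' f'] [E _]; move: E; rewrite /vis_code /=.
move=> /(prefix_seq (prefix_pair prefix_rat prefix_rat))[-> E].
have [_ {}E] := prefix_seq prefix_bool E.
by rewrite (prefix_code_inj prefix_fo E).
Qed.

(** The input is a simple polygon in the class [C], its visibility graph and a
    sentence; the parameter is the size of the sentence. *)
Definition visibility_FOMC : pproblem :=
  {| inst := polygon * fo;
     valid := vis_valid;
     yes := vis_yes;
     code := vis_code;
     param := vis_param;
     code_inj := vis_code_inj |}.

End ModelChecking.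

(* Main.v *)
(** Hardness.  A word [w] of numbers below [n] is drawn as a hill: the upper
    boundary follows a concave parabola whose vertices, after the first [n],
    alternate with pits, one for each letter.  Two parabola vertices always see
    each other and two pits never do, while the pit of letter [m] sees the
    parabola vertices on its left up to column [nth 0 w m], and all those on its
    right.  The hill is a terrain, seen as a whole from its leftmost vertex.
    First-order formulas recover from adjacency the order of the pits and the
    order of their letters, so the graph carries an arbitrary data word; an
    instance of QBFSAT_t is such a word, the quantifier prefix and the [t]
    layers of the matrix being read off by a sentence whose size depends on [t]
    and the parameter only.

    Membership.  Evaluating a sentence is a game with one move per node of the
    syntax tree: a vertex at a quantifier, a side at a connective.  A move is a
    choice of one among [n] variables, and the winning condition is in
    conjunctive normal form: every pair of moves making an atom fail gives a
    clause, completed by literals that hold when the play misses the atom.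

    Both reductions run in polynomial time; programs are built from closure
    properties of [ptime] on words, with numbers in unary. *)

From Corelib Require Import BinNums.
Require Import Defs.
From mathcomp Require Import all_boot all_order all_algebra.
From mathcomp Require Import all_classical all_reals all_analysis.
From mathcomp Require Import zify ring lra.

Set Implicit Arguments.
Unset Strict Implicit.
Unset Printing Implicit Defensive.

(** * Machine programs *)

(** The exterior is defined through unbounded components of the complement of the boundary, which
    would call for the Jordan curve theorem. For the region under a positive piecewise linear
    function, the sign of one continuous function, [depth], takes its place. The depth of a pit
    comes from slopes. On y = -x^2 the chord through abscissas c and q has slope -(c + q), and
    stretching both axes by D = M + 1 keeps it, so one unit past column q that chord has dropped by
    q + c. A pit sunk by q + t is thus hidden from a column c < q by column q exactly when t < c.
    Coordinates are natural numbers polynomial in the input, hence computable in unary. In the game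
    a move is made at every node, including those the play does not reach. The quantifier prefix
    then depends only on the sentence and the number of vertices, its length is linear in the
    sentence, and moves in abandoned branches do not affect the outcome. The matrix always has two
    layers, so [QBFSAT 2] suffices for membership. Variables of a QBFSAT instance may be
    exponentially large numbers; they are compared as binary words and never decoded. *)

Definition sto (l : seq word) : store := fun r => nth [::] l r.

Lemma sto_eq l l' : (forall r, nth [::] l r = nth [::] l' r) -> sto l = sto l'.
Proof. by move=> H; apply/funext. Qed.

Lemma upd_sto l r v : upd (sto l) r v = sto (set_nth [::] l r v).
Proof. by apply/funext => q; rewrite /sto nth_set_nth. Qed.

Definition runs (p : prog) (s : store) (T : nat) (s' : store) :=
  exists2 n, n <= T & run p s n s'.

Lemma runs_le p s T T' s' : T <= T' -> runs p s T s' -> runs p s T' s'.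
Proof. by move=> le [n nT rn]; exists n => //; apply: leq_trans le. Qed.

Lemma runs_comp p q s1 s2 s3 T1 T2 :
  runs p s1 T1 s2 -> runs q s2 T2 s3 -> runs (Comp p q) s1 (T1 + T2) s3.
Proof.
by move=> [n nT rn] [m mT rm]; exists (n + m); [exact: leq_add|exact: RunComp rn rm].
Qed.

Lemma runs_push r b s : runs (Push r b) s 1 (upd s r (b :: s r)).
Proof. by exists 1 => //; apply: RunPush. Qed.

Lemma runs_pop r s : runs (Pop r) s 1 (upd s r (behead (s r))).
Proof. by exists 1 => //; apply: RunPop. Qed.

Lemma runs_ite (c : bool) b p q s s' T :
  test_holds b s = c -> (if c then runs p s T s' else runs q s T s') ->
  runs (Ite b p q) s T.+1 s'.
Proof.
case: c => h [n nT rn]; exists n.+1 => //.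
  exact: RunIteT.
by apply: RunIteF => //; rewrite h.
Qed.

(** Shifting a program past the first [K] stacks lets it run as a subroutine while those stacks keep
    the data of its caller. *)
Fixpoint reloc K (p : prog) : prog :=
  let sh b := match b with NonEmpty r => NonEmpty (K + r) | TopIs1 r => TopIs1 (K + r) end in
  match p with
  | Push r b => Push (K + r) b
  | Pop r => Pop (K + r)
  | Comp p q => Comp (reloc K p) (reloc K q)
  | Ite b p q => Ite (sh b) (reloc K p) (reloc K q)
  | While b p => While (sh b) (reloc K p)
  end.

Definition above K (F s : store) : store := fun r => if r < K then F r else s (r - K).

Lemma above_upd K F s r v : above K F (upd s r v) = upd (above K F s) (K + r) v.
Proof.
apply/funext => q; rewrite /above /upd.
have [qK|Kq] := ltnP q K.
  by case: eqP => // e; move: qK; rewrite e ltnNge leq_addr.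
by rewrite -(eqn_add2l K) subnKC.
Qed.

Lemma above_at K F s r : above K F s (K + r) = s r.
Proof. by rewrite /above ltnNge leq_addr /= addKn. Qed.

Lemma run_reloc K F p s n s' :
  run p s n s' -> run (reloc K p) (above K F s) n (above K F s').
Proof.
have tst b s0 : test_holds match b with NonEmpty r => NonEmpty (K + r) | TopIs1 r => TopIs1 (K + r) end
    (above K F s0) = test_holds b s0 by case: b => r /=; rewrite above_at.
elim=> {p s n s'}.
- by move=> r b s; rewrite above_upd -[X in b :: X](above_at K F s r); apply: RunPush.
- by move=> r s; rewrite above_upd -[X in behead X](above_at K F s r); apply: RunPop.
- by move=> p q s1 s2 s3 n m _ H1 _ H2; apply: RunComp H1 H2.
- by move=> b p q s s' n h _ H; apply: RunIteT; rewrite ?tst.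
- by move=> b p q s s' n h _ H; apply: RunIteF; rewrite ?tst.
- by move=> b p s1 s2 s3 n m h _ H1 _ H2; apply: RunWhileT H1 H2; rewrite tst.
- by move=> b p s h; apply: RunWhileF; rewrite tst.
Qed.

Lemma runs_reloc p l1 l T l' :
  runs p (sto l) T (sto l') ->
  runs (reloc (size l1) p) (sto (l1 ++ l)) T (sto (l1 ++ l')).
Proof.
have E k : sto (l1 ++ k) = above (size l1) (sto l1) (sto k).
  by apply/funext => r; rewrite /above /sto nth_cat.
by move=> [n nT rn]; exists n => //; rewrite !E; apply: run_reloc.
Qed.

(** [pour a body] empties stack [a], performing [body b] for each bit [b]. *)
Definition pour a (body : bool -> prog) : prog :=
  While (NonEmpty a)
    (Ite (TopIs1 a) (Comp (Pop a) (body true)) (Comp (Pop a) (body false))).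

(** The store is described by [G v w], with [v] the bits already poured, last one first, and [w]
    those left, so that a loop is specified by one family of stores. Each bit costs [t] for the body
    and 3 for the loop test, the branching and the pop. *)
Lemma runs_pour a body t (G : word -> word -> store) :
  (forall v w, G v w a = w) ->
  (forall v b w, runs (body b) (upd (G v (b :: w)) a w) t (G (b :: v) w)) ->
  forall w, runs (pour a body) (G [::] w) ((t + 3) * (size w)).+1 (G (rev w) [::]).
Proof.
move=> Ga Gb w; suff H v : runs (pour a body) (G v w) ((t + 3) * (size w)).+1 (G (catrev w v) [::]).
  exact: H.
elim: w v => [|b w IH] v.
  by rewrite muln0; exists 1 => //; apply: RunWhileF; rewrite /= Ga.
have [n nT rn] := IH (b :: v).
have: runs (Ite (TopIs1 a) (Comp (Pop a) (body true)) (Comp (Pop a) (body false)))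
    (G v (b :: w)) (1 + t).+1 (G (b :: v) w).
  apply: (@runs_ite b); first by rewrite /= Ga.
  have pop : runs (Pop a) (G v (b :: w)) 1 (upd (G v (b :: w)) a w).
    by have := runs_pop a (G v (b :: w)); rewrite Ga.
  by move: pop (Gb v b w); case: b {IH rn} => pop H; apply: runs_comp pop H.
move=> [m mT rm]; exists (m + n).+1; first by rewrite /=; lia.
by apply: RunWhileT rm rn; rewrite /= Ga.
Qed.

Lemma upd_same T (s : nat -> T) r v : upd s r v r = v.
Proof. by rewrite /upd eqxx. Qed.

Lemma upd_id T (s : nat -> T) r : upd s r (s r) = s.
Proof. by apply/funext => q; rewrite /upd; case: eqP => [->|]. Qed.

Lemma upd_upd T (s : nat -> T) r v w : upd (upd s r v) r w = upd s r w.
Proof. by apply/funext => q; rewrite /upd; case: eqP. Qed.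

Lemma upd_diff T (s : nat -> T) r r' v : r != r' -> upd s r v r' = s r'.
Proof. by rewrite /upd eq_sym => /negPf ->. Qed.

Lemma updC T (s : nat -> T) r r' v v' : r != r' ->
  upd (upd s r v) r' v' = upd (upd s r' v') r v.
Proof.
move=> rr'; apply/funext => q; rewrite /upd.
by case: (q =P r') => [->|//]; rewrite eq_sym (negPf rr').
Qed.

Definition mv a b := pour a (Push b).
(** copies [a] on top of [b], through the empty stack [t] *)
Definition cp a b t := Comp (mv a t) (pour t (fun x => Comp (Push a x) (Push b x))).
(** The terminating [false] of [dl] lies deepest, hence is pushed before the bits; each bit then
    receives its marker [true] on top. *)
Definition cpdl a b t :=
  Comp (mv a t) (Comp (Push b false)
    (pour t (fun x => Comp (Push a x) (Comp (Push b x) (Push b true))))).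
Definition cl a := pour a (fun x => Comp (Push a x) (Pop a)).

Definition dl (w : word) : word := enc_seq enc_bool w.

Lemma size_dl w : size (dl w) = (2 * size w).+1.
Proof. by elim: w => //= b w ->; lia. Qed.

Lemma runs_mv a b s : a != b ->
  runs (mv a b) s (4 * size (s a)).+1 (upd (upd s a [::]) b (catrev (s a) (s b))).
Proof.
move=> ab; pose G v w := upd (upd s a w) b (v ++ s b).
have := @runs_pour a (Push b) 1 G _ _ (s a).
rewrite /G upd_id upd_id catrevE; apply=> [v w|v x w].
  by rewrite upd_diff 1?eq_sym // upd_same.
set s1 := upd _ a w.
suff -> : upd (upd s a w) b ((x :: v) ++ s b) = upd s1 b (x :: s1 b) by exact: runs_push.
by rewrite /s1 upd_diff // upd_same (updC _ _ _ (_ : b != a)) ?upd_upd // eq_sym.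
Qed.

Lemma runs_cl a s : runs (cl a) s (5 * size (s a)).+1 (upd s a [::]).
Proof.
have := @runs_pour a _ 2 (fun v w => upd s a w) _ _ (s a).
rewrite upd_id; apply=> [v w|v x w]; first exact: upd_same.
apply: runs_comp (runs_push _ _ _) _.
set s1 := upd _ _ (x :: _); suff -> : upd s a w = upd s1 a (behead (s1 a)) by exact: runs_pop.
by rewrite /s1 !upd_same !upd_upd.
Qed.

Lemma runs_cp a b t s : a != b -> a != t -> b != t -> s t = [::] ->
  runs (cp a b t) s (9 * size (s a) + 2) (upd s b (s a ++ s b)).
Proof.
move=> ab at_ bt st0.
have ba : b != a by rewrite eq_sym.
have ta : t != a by rewrite eq_sym.
have tb : t != b by rewrite eq_sym.
apply: (@runs_le _ _ ((4 * size (s a)).+1 + ((5 * size (s a)).+1))); first lia.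
apply: runs_comp (runs_mv _ at_) _.
pose G v w := upd (upd (upd s a v) b (v ++ s b)) t w.
have := @runs_pour t _ 2 G _ _ (rev (s a)).
rewrite size_rev revK st0 catrevE cats0.
have -> : G (s a) [::] = upd s b (s a ++ s b).
  by rewrite /G upd_id -st0 -[s t](@upd_diff _ s b _ (s a ++ s b)) // upd_id.
suff -> : G [::] (rev (s a)) = upd (upd s a [::]) t (rev (s a)).
  apply=> [v w|v x w]; first exact: upd_same.
  apply: runs_comp (runs_push _ _ _) _.
  set s1 := upd _ a (x :: _); suff -> : G (x :: v) w = upd s1 b (x :: s1 b) by exact: runs_push.
  rewrite /s1 /G; apply/funext => q.
  rewrite /upd !eqxx ?(negPf ab) ?(negPf ba) ?(negPf ta) ?(negPf at_) ?(negPf tb) ?(negPf bt).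
  case: (q =P t) => [->|_]; first by rewrite ?(negPf ta) ?(negPf tb).
  by case: (q == b) => //; case: (q == a).
by rewrite /G -[X in upd (upd s a [::]) b X](@upd_diff _ s a b [::]) // upd_id.
Qed.

Lemma dl_cons x w : dl (x :: w) = true :: x :: dl w. Proof. by []. Qed.

Lemma runs_cpdl a b t s : a != b -> a != t -> b != t -> s t = [::] ->
  runs (cpdl a b t) s (10 * size (s a) + 3) (upd s b (dl (s a) ++ s b)).
Proof.
move=> ab at_ bt st0.
have ba : b != a by rewrite eq_sym.
have ta : t != a by rewrite eq_sym.
have tb : t != b by rewrite eq_sym.
apply: (@runs_le _ _ ((4 * size (s a)).+1 + (1 + (6 * size (s a)).+1))); first lia.
apply: runs_comp (runs_mv _ at_) (runs_comp (runs_push _ _ _) _).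
pose G v w := upd (upd (upd s a v) b (dl v ++ s b)) t w.
rewrite (upd_diff _ _ tb) (upd_diff _ _ ab) st0 catrevE cats0.
have E0 : G [::] (rev (s a)) = upd (upd (upd s a [::]) t (rev (s a))) b (false :: s b).
  by rewrite /G updC.
have E1 : G (s a) [::] = upd s b (dl (s a) ++ s b).
  by rewrite /G upd_id -st0 -[s t](@upd_diff _ s b _ (dl (s a) ++ s b)) // upd_id.
rewrite -E0 -E1 -[size (s a)]size_rev -[X in G X [::]]revK.
apply: (@runs_pour _ _ 3 G) => [v w|v x w]; first exact: upd_same.
apply: runs_comp (runs_push _ _ _) (runs_comp (runs_push _ _ _) _).
set s1 := upd _ b (x :: _); suff -> : G (x :: v) w = upd s1 b (true :: s1 b) by exact: runs_push.
rewrite /s1 /G; apply/funext => q.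
rewrite /upd !eqxx ?(negPf ab) ?(negPf ba) ?(negPf ta) ?(negPf at_) ?(negPf tb) ?(negPf bt).
case: (q =P t) => [->|_]; first by rewrite ?(negPf ta) ?(negPf tb).
by case: (q == b) => //; case: (q == a).
Qed.

(** On [dl u ++ v] in [a]: leaves [v] in [a] and puts [rev u] on top of [b]. *)
Definition undl a b :=
  Comp (While (TopIs1 a) (Comp (Pop a)
     (Ite (TopIs1 a) (Comp (Pop a) (Push b true)) (Comp (Pop a) (Push b false))))) (Pop a).

Lemma runs_undl a b s u v : a != b -> s a = dl u ++ v ->
  runs (undl a b) s (5 * size u + 2) (upd (upd s a v) b (catrev u (s b))).
Proof.
move=> ab sa.
have ba : b != a by rewrite eq_sym.
apply: (@runs_le _ _ ((5 * size u).+1 + 1)); first lia.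
suff H : forall x, runs (While (TopIs1 a) (Comp (Pop a)
     (Ite (TopIs1 a) (Comp (Pop a) (Push b true)) (Comp (Pop a) (Push b false)))))
     (upd (upd s a (dl u ++ v)) b x) (5 * size u).+1
     (upd (upd s a (false :: v)) b (catrev u x)).
  have := H (s b).
  rewrite -sa !upd_id => {}H; apply: runs_comp H _.
  set s1 := upd _ _ _; suff -> : upd (upd s a v) b (catrev u (s b)) = upd s1 a (behead (s1 a)) by exact: runs_pop.
  by rewrite /s1 upd_diff // upd_same /= [RHS]updC // upd_upd.
elim: u {sa} => [|c u IH] x.
  by rewrite muln0; exists 1 => //; apply: RunWhileF; rewrite /= upd_diff // upd_same.
have [n nT rn] := IH (c :: x).
suff [m mT rm] : runs (Comp (Pop a)
     (Ite (TopIs1 a) (Comp (Pop a) (Push b true)) (Comp (Pop a) (Push b false))))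
    (upd (upd s a (dl (c :: u) ++ v)) b x) (1 + 3) (upd (upd s a (dl u ++ v)) b (c :: x)).
  exists (m + n).+1; first by rewrite /=; lia.
  by apply: RunWhileT rm rn; rewrite /= upd_diff // upd_same.
rewrite dl_cons !cat_cons.
apply: runs_comp (runs_pop _ _) _.
rewrite upd_diff // upd_same /= (updC _ _ _ ba) upd_upd.
apply: (@runs_ite c); first by rewrite /= upd_diff // upd_same.
have P : runs (Comp (Pop a) (Push b c)) (upd (upd s a (c :: dl u ++ v)) b x) (1 + 1)
   (upd (upd s a (dl u ++ v)) b (c :: x)).
  apply: runs_comp (runs_pop _ _) _.
  rewrite upd_diff // upd_same /= (updC _ _ _ ba) upd_upd.
  have := runs_push b c (upd (upd s a (dl u ++ v)) b x).
  by rewrite upd_upd upd_same.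
by case: c P {rn IH}.
Qed.

(** A step writes at most one bit, so a time bound also bounds the output. [ptime_size] rests on
    this when programs are chained. *)
Lemma run_size p s n s' : run p s n s' -> forall r, size (s' r) <= size (s r) + n.
Proof.
elim=> {p s n s'}.
- by move=> r b s q; rewrite /upd; case: eqP => [->|] /=; lia.
- by move=> r s q; rewrite /upd; case: eqP => [->|] /=; rewrite ?size_behead; lia.
- by move=> p q s1 s2 s3 n m _ H1 _ H2 r; have := H1 r; have := H2 r; lia.
- by move=> b p q s s' n _ _ H r; have := H r; lia.
- by move=> b p q s s' n _ _ H r; have := H r; lia.
- by move=> b p s1 s2 s3 n m _ _ H1 _ H2 r; have := H1 r; have := H2 r; lia.
- by move=> *; lia.
Qed.

Lemma runs_size p s T s' r : runs p s T s' -> size (s' r) <= size (s r) + T.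
Proof. by move=> [n nT /run_size/(_ r)]; lia. Qed.

Definition polyb (h : nat -> nat) := exists c d, forall n, h n <= c * n.+1 ^ d.

Lemma polyb_le (h h' : nat -> nat) : (forall n, h n <= h' n) -> polyb h' -> polyb h.
Proof. by move=> le [c [d H]]; exists c, d => n; apply: leq_trans (H n). Qed.

Lemma polyb_cst k : polyb (fun _ => k).
Proof. by exists k, 0 => n; rewrite expn0 muln1. Qed.

Lemma polyb_id : polyb (fun n => n).
Proof. by exists 1, 1 => n; rewrite expn1 mul1n. Qed.

Lemma polyb_mul h h' : polyb h -> polyb h' -> polyb (fun n => h n * h' n).
Proof.
move=> [c [d H]] [c' [d' H']]; exists (c * c'), (d + d') => n.
by rewrite expnD mulnACA leq_mul.
Qed.

Lemma polyb_add h h' : polyb h -> polyb h' -> polyb (fun n => h n + h' n).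
Proof.
move=> [c [d H]] [c' [d' H']]; exists (c + c'), (d + d') => n.
rewrite mulnDl leq_add //; [apply: leq_trans (H n) _|apply: leq_trans (H' n) _];
  by apply: leq_mul => //; apply: leq_pexp2l; lia.
Qed.

Lemma polyb_exp h d : polyb h -> polyb (fun n => h n ^ d).
Proof.
move=> H; elim: d => [|d IH]; first exact: polyb_cst.
by apply: polyb_le (polyb_mul H IH) => n; rewrite expnS.
Qed.

Lemma polyb_bound c d h : polyb h -> polyb (fun n => c * (h n).+1 ^ d).
Proof.
move=> H; apply: polyb_mul (polyb_cst c) (polyb_exp _ _).
by apply: polyb_le (polyb_add (polyb_cst 1) H) => n; lia.
Qed.

Lemma polyb_comp g h : polyb g -> polyb h -> polyb (fun n => g (h n)).
Proof. by move=> [c [d G]] H; apply: polyb_le (polyb_bound c d H). Qed.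

(** The running time of a second program is given at the length of an intermediate word, of which
    only an upper bound is known; a monotone majorant allows that bound to be substituted. *)
Lemma polyb_mono h : polyb h -> exists2 h', polyb h' &
  (forall n, h n <= h' n) /\ (forall m n, m <= n -> h' m <= h' n).
Proof.
move=> [c [d H]]; exists (fun n => c * n.+1 ^ d); first by exists c, d.
split=> // m n mn; rewrite leq_mul //.
by case: d {H} => // d; rewrite leq_exp2r.
Qed.

Ltac polyb_tac := repeat first [ assumption | apply: polyb_add | apply: polyb_mul
  | exact: polyb_cst | exact: polyb_id ].

(** * Polynomial time *)

Definition pr (u v : word) : word := dl u ++ v.
Definition un (n : nat) : word := nseq n true.

(** [ptime D f g]: a program turns [f a] into [g a] for all [a] in [D], in time
    polynomial in the length of [f a], using and leaving no other stack. *)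
Definition ptime A (D : A -> Prop) (f g : A -> word) :=
  exists p h, polyb h /\ forall a, D a -> runs p (sto [:: f a]) (h (size (f a))) (sto [:: g a]).

Section Ptime.
Variables (A : Type) (D : A -> Prop).
Implicit Types f g : A -> word.

Lemma ptimeI f g p (T : A -> nat) t :
  polyb t -> (forall a, D a -> T a <= t (size (f a))) ->
  (forall a, D a -> runs p (sto [:: f a]) (T a) (sto [:: g a])) -> ptime D f g.
Proof.
move=> pt Tt H; exists p, t; split=> // a Da.
by apply: runs_le (H a Da); apply: Tt.
Qed.

Lemma ptime_mono f g : ptime D f g -> exists p h, [/\ polyb h,
  (forall m n, m <= n -> h m <= h n) & forall a, D a -> runs p (sto [:: f a]) (h (size (f a))) (sto [:: g a])].
Proof.
move=> [p [h [ph H]]]; have [h' ph' [le mo]] := polyb_mono ph.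
by exists p, h'; split=> // a Da; apply: runs_le (H a Da).
Qed.

Lemma ptime_size f g : ptime D f g -> exists2 h, polyb h & forall a, D a -> size (g a) <= h (size (f a)).
Proof.
move=> [p [h [ph H]]]; exists (fun n => n + h n); first by polyb_tac.
by move=> a Da; have := @runs_size _ _ _ _ 0 (H a Da).
Qed.

Lemma eq_ptime f f' g g' : (forall a, D a -> f a = f' a) -> (forall a, D a -> g a = g' a) ->
  ptime D f g -> ptime D f' g'.
Proof.
move=> ff gg [p [h [ph H]]]; exists p, h; split=> // a Da.
by rewrite -ff // -gg //; apply: H.
Qed.

Lemma ptime_comp f g h : ptime D f g -> ptime D g h -> ptime D f h.
Proof.
move=> /[dup] /ptime_size[s ps S] [p [t [pt P]]] /ptime_mono[q [t' [pt' mo Q]]].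
apply: (@ptimeI _ _ (Comp p q) (fun a => t (size (f a)) + t' (size (g a))) (fun n => t n + t' (s n))).
- by polyb_tac; apply: polyb_comp.
- by move=> a Da; rewrite leq_add2l mo // S.
- by move=> a Da; apply: runs_comp (P a Da) (Q a Da).
Qed.
End Ptime.

Lemma ptime_sub A B (D : A -> Prop) (E : B -> Prop) (i : A -> B) f g :
  (forall a, D a -> E (i a)) -> ptime E f g -> ptime D (f \o i) (g \o i).
Proof. by move=> DE [p [h [ph H]]]; exists p, h; split=> // a Da; apply: H; apply: DE. Qed.

Lemma ptime_weak A (D E : A -> Prop) f g :
  (forall a, D a -> E a) -> ptime E f g -> ptime D f g.
Proof. exact: (@ptime_sub _ _ D E id). Qed.

Lemma sto_reloc p (l1 l l' : seq word) T (k : nat) : size l1 = k ->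
  runs p (sto l) T (sto l') -> runs (reloc k p) (sto (l1 ++ l)) T (sto (l1 ++ l')).
Proof. by move=> <-; apply: runs_reloc. Qed.

Lemma sto_mv a b l : a != b -> runs (mv a b) (sto l) (4 * size (nth [::] l a)).+1
   (sto (set_nth [::] (set_nth [::] l a [::]) b (catrev (nth [::] l a) (nth [::] l b)))).
Proof. by move=> ab; have := runs_mv (sto l) ab; rewrite !upd_sto. Qed.

Lemma sto_cl a l : runs (cl a) (sto l) (5 * size (nth [::] l a)).+1 (sto (set_nth [::] l a [::])).
Proof. by have := runs_cl a (sto l); rewrite !upd_sto. Qed.

Lemma sto_cp a b t l : a != b -> a != t -> b != t -> nth [::] l t = [::] ->
  runs (cp a b t) (sto l) (9 * size (nth [::] l a) + 2) (sto (set_nth [::] l b (nth [::] l a ++ nth [::] l b))).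
Proof. by move=> ab at_ bt e; have := @runs_cp _ _ _ (sto l) ab at_ bt e; rewrite !upd_sto. Qed.

Lemma sto_cpdl a b t l : a != b -> a != t -> b != t -> nth [::] l t = [::] ->
  runs (cpdl a b t) (sto l) (10 * size (nth [::] l a) + 3) (sto (set_nth [::] l b (dl (nth [::] l a) ++ nth [::] l b))).
Proof. by move=> ab at_ bt e; have := @runs_cpdl _ _ _ (sto l) ab at_ bt e; rewrite !upd_sto. Qed.

Lemma sto_undl a b l u v : a != b -> nth [::] l a = dl u ++ v ->
  runs (undl a b) (sto l) (5 * size u + 2) (sto (set_nth [::] (set_nth [::] l a v) b (catrev u (nth [::] l b)))).
Proof. by move=> ab e; have := @runs_undl _ _ (sto l) _ _ ab e; rewrite !upd_sto. Qed.

Lemma sto_push r b l : runs (Push r b) (sto l) 1 (sto (set_nth [::] l r (b :: nth [::] l r))).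
Proof. by have := runs_push r b (sto l); rewrite upd_sto. Qed.

Lemma sto_pop r l : runs (Pop r) (sto l) 1 (sto (set_nth [::] l r (behead (nth [::] l r)))).
Proof. by have := runs_pop r (sto l); rewrite upd_sto. Qed.

Lemma runs_eq p s T s1 s2 : s1 = s2 -> runs p s T s1 -> runs p s T s2.
Proof. by move=> ->. Qed.

Ltac sto_tac := apply: sto_eq; do 12?[case=> [|//=] /=] => //.

Lemma catrev_rev (w : word) : catrev (catrev w [::]) [::] = w.
Proof. by rewrite !catrevE !cats0 revK. Qed.

Section Ptime2.
Variables (A : Type) (D : A -> Prop).
Implicit Types f g : A -> word.

(** Programs consume their input, so each runs on its own copy, made through the scratch stack 1:
    [p] works from stack 2 on and leaves [g a] there, [q] works from stack 3 on and leaves [h a], on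
    top of which the delimited [g a] is copied. *)
Lemma ptime_pair f g h : ptime D f g -> ptime D f h -> ptime D f (fun a => pr (g a) (h a)).
Proof.
move=> /[dup] /ptime_size[s ps S] [p [t [pt P]]] /[dup] /ptime_size[s' ps' S'] [q [t' [pt' Q]]].
pose prog := Comp (cp 0 2 1) (Comp (reloc 2 p) (Comp (cp 0 3 1) (Comp (reloc 3 q)
  (Comp (cpdl 2 3 1) (Comp (cl 0) (Comp (cl 2) (Comp (mv 3 1) (mv 1 0)))))))).
pose T n := 100 * (n + s n + t n + t' n + s' n + 1).
apply: (@ptimeI _ _ _ _ prog (fun a => T (size (f a))) T) => //; first by rewrite /T; polyb_tac.
move=> a Da.
apply: (@runs_le _ _ ((9 * size (f a) + 2) + (t (size (f a)) + ((9 * size (f a) + 2) +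
  (t' (size (f a)) + ((10 * size (g a) + 3) + ((5 * size (f a)).+1 + ((5 * size (g a)).+1 +
  ((4 * size (pr (g a) (h a))).+1 + (4 * size (pr (g a) (h a))).+1))))))))).
  by have := S a Da; have := S' a Da; rewrite /T /pr size_cat size_dl; lia.
eapply runs_comp; first by apply: sto_cp.
rewrite /= cats0.
eapply runs_comp; first exact: (sto_reloc (l1 := [:: f a; [::]]) erefl (P a Da)).
eapply runs_comp; first by apply: (@sto_cp 0 3 1).
rewrite /= cats0.
eapply runs_comp; first exact: (sto_reloc (l1 := [:: f a; [::]; g a]) erefl (Q a Da)).
eapply runs_comp; first by apply: (@sto_cpdl 2 3 1).
eapply runs_comp; first by apply: (@sto_cl 0).
eapply runs_comp; first by apply: (@sto_cl 2).
rewrite /=.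
eapply runs_comp; first by apply: (@sto_mv 3 1).
rewrite /=.
have := @sto_mv 1 0 [:: [::]; catrev (dl (g a) ++ h a) [::]; [::]; [::]] isT.
rewrite /= catrev_rev {1}catrevE cats0 size_rev; apply: runs_eq; sto_tac.
Qed.

Lemma ptime_id f : ptime D f f.
Proof.
apply: (@ptimeI _ _ _ _ (Comp (Push 0 true) (Pop 0)) (fun=> 2) (fun=> 2)) => //; first exact: polyb_cst.
by move=> a _; apply: runs_comp (sto_push _ _ _) (sto_pop _ _).
Qed.

Lemma ptime_nil f : ptime D f (fun _ => [::]).
Proof.
apply: (@ptimeI _ _ _ _ (cl 0) (fun a => (5 * size (f a)).+1) (fun n => 1 + 5 * n)) => //.
  by polyb_tac.
by move=> a _; apply: runs_eq (sto_cl _ _); sto_tac.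
Qed.

Lemma ptime_cons b f g : ptime D f g -> ptime D f (fun a => b :: g a).
Proof.
move=> /ptime_comp; apply.
apply: (@ptimeI _ _ _ _ (Push 0 b) (fun=> 1) (fun=> 1)) => //; first exact: polyb_cst.
by move=> a _; apply: sto_push.
Qed.

Lemma ptime_cst f w : ptime D f (fun _ => w).
Proof. by elim: w => [|b w IH]; [exact: ptime_nil|exact: ptime_cons]. Qed.

Lemma ptime_behead f g : ptime D f g -> ptime D f (fun a => behead (g a)).
Proof.
move=> /ptime_comp; apply.
apply: (@ptimeI _ _ _ _ (Pop 0) (fun=> 1) (fun=> 1)) => //; first exact: polyb_cst.
by move=> a _; apply: sto_pop.
Qed.

Lemma ptime_fst f g h : ptime D f (fun a => pr (g a) (h a)) -> ptime D f g.
Proof.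
move=> /ptime_comp; apply.
apply: (@ptimeI _ _ _ _ (Comp (undl 0 1) (Comp (cl 0) (mv 1 0)))
   (fun a => (5 * size (g a) + 2) + ((5 * size (h a)).+1 + (4 * size (g a)).+1)) (fun n => 15 * n + 4)); first by polyb_tac.
  by move=> a _; rewrite /pr size_cat size_dl; lia.
move=> a _; apply: runs_comp (@sto_undl 0 1 [:: pr (g a) (h a)] (g a) (h a) isT erefl) _.
rewrite /=; apply: runs_comp (@sto_cl 0 _) _.
have := @sto_mv 1 0 [:: [::]; catrev (g a) [::]] isT.
by rewrite /= catrev_rev catrevE cats0 size_rev; apply: runs_eq; sto_tac.
Qed.

Lemma ptime_snd f g h : ptime D f (fun a => pr (g a) (h a)) -> ptime D f h.
Proof.
move=> /ptime_comp; apply.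
apply: (@ptimeI _ _ _ _ (Comp (undl 0 1) (cl 1))
   (fun a => (5 * size (g a) + 2) + (5 * size (g a)).+1) (fun n => 15 * n + 4)); first by polyb_tac.
  by move=> a _; rewrite /pr size_cat size_dl; lia.
move=> a _; apply: runs_comp (@sto_undl 0 1 [:: pr (g a) (h a)] (g a) (h a) isT erefl) _.
have := @sto_cl 1 [:: h a; catrev (g a) [::]].
by rewrite /= {1}catrevE cats0 size_rev; apply: runs_eq; sto_tac.
Qed.

Lemma ptime_cat f g h : ptime D f g -> ptime D f h -> ptime D f (fun a => g a ++ h a).
Proof.
move=> pg ph; apply: ptime_comp (ptime_pair pg ph) _.
apply: (@ptimeI _ _ _ _ (Comp (undl 0 1) (mv 1 0))
   (fun a => (5 * size (g a) + 2) + (4 * size (g a)).+1) (fun n => 15 * n + 4)); first by polyb_tac.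
  by move=> a _; rewrite /pr size_cat size_dl; lia.
move=> a _; apply: runs_comp (@sto_undl 0 1 [:: pr (g a) (h a)] (g a) (h a) isT erefl) _.
have := @sto_mv 1 0 [:: h a; catrev (g a) [::]] isT.
rewrite /= {1}catrevE cats0 size_rev; apply: runs_eq.
by rewrite !catrevE cats0 revK; sto_tac.
Qed.

Lemma ptime_if f g h (b : A -> bool) : ptime D f (fun a => [:: b a]) ->
  ptime (fun a => D a /\ b a) f g -> ptime (fun a => D a /\ ~~ b a) f h ->
  ptime D f (fun a => if b a then g a else h a).
Proof.
move=> pb [p [t [pt P]]] [q [t' [pt' Q]]].
apply: ptime_comp (ptime_pair pb (ptime_id f)) _.
pose T n := t n + t' n + 10.
(* The pair is [true :: b a :: false :: f a]: one pop exposes the bit to be tested, two more remove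
   it and the delimiter. These three extra bits account for [n - 3]. *)
apply: (@ptimeI _ _ _ _ (Comp (Pop 0) (Ite (TopIs1 0) (Comp (Pop 0) (Comp (Pop 0) p)) (Comp (Pop 0) (Comp (Pop 0) q))))
   (fun a => T (size (f a))) (fun n => T (n - 3))).
- have [u pu [uT um]] : exists2 T', polyb T' & (forall n, T n <= T' n) /\ (forall m n, m <= n -> T' m <= T' n).
    by apply: polyb_mono; rewrite /T; polyb_tac.
  by apply: polyb_le pu => n; apply: leq_trans (uT _) _; apply: um; lia.
- by move=> a Da; rewrite /pr size_cat size_dl /= addKn.
move=> a Da; apply: (@runs_le _ _ (1 + (1 + (1 + (t (size (f a)) + t' (size (f a))))).+1)); first by rewrite /T; lia.
apply: runs_comp (@sto_pop 0 _) _.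
apply: (@runs_ite (b a)); first by [].
rewrite /=; case ba : (b a) => /=.
  apply: runs_comp (@sto_pop 0 _) _; apply: runs_comp (@sto_pop 0 _) _ => /=.
  by apply: runs_le (P a _); [lia|rewrite ba].
apply: runs_comp (@sto_pop 0 _) _; apply: runs_comp (@sto_pop 0 _) _ => /=.
by apply: runs_le (Q a _); [lia|rewrite ba].
Qed.

(** Stack 0 holds the input, 1 the rest of the counter [c a], 2 the index in unary, 3 the state; 4
    is scratch and the body works from 5 on. The bound [t0] on all intermediate states has to be
    supplied: a polynomial-time body could square the size of the state at each turn. *)
Lemma ptime_iter f c (st : A -> nat -> word) t0 : ptime D f c -> ptime D f (st^~ 0) ->
  polyb t0 -> (forall a k, D a -> k <= size (c a) -> size (st a k) <= t0 (size (f a))) ->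
  ptime (fun ak => D ak.1 /\ ak.2 < size (c ak.1))
    (fun ak => pr (un ak.2) (pr (st ak.1 ak.2) (f ak.1))) (fun ak => st ak.1 ak.2.+1) ->
  ptime D f (fun a => st a (size (c a))).
Proof.
move=> /[dup] /ptime_size[s ps S] [pc [tc [ptc Pc]]] [p0 [ti [pti P0]]] pt0 St.
move=> /ptime_mono[q [tq [ptq mq Q]]].
pose body := Comp (Pop 1) (Comp (cp 0 5 4) (Comp (cpdl 3 5 4) (Comp (cpdl 2 5 4) (Comp (cl 3)
  (Comp (reloc 5 q) (Comp (mv 5 4) (Comp (mv 4 3) (Push 2 true)))))))).
pose prog := Comp (cp 0 5 4) (Comp (reloc 5 pc) (Comp (mv 5 4) (Comp (mv 4 1)
  (Comp (cp 0 5 4) (Comp (reloc 5 p0) (Comp (mv 5 4) (Comp (mv 4 3)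
  (Comp (While (NonEmpty 1) body) (Comp (cl 0) (Comp (cl 2) (Comp (mv 3 4) (mv 4 0)))))))))))).
pose W n := 100 * (n + s n + t0 n + 1) + tq (2 * s n + (2 * t0 n) + n + 2).
pose T n := 100 * (n + s n + t0 n + tc n + ti n + 1) + s n * W n + W n.
apply: (@ptimeI _ _ _ _ prog (fun a => T (size (f a))) T) => //.
  by rewrite /T /W; polyb_tac; apply: polyb_comp => //; polyb_tac.
move=> a Da; set n := size (f a); have Sc := S a Da.
have loop w k : size (c a) = k + size w ->
  runs (While (NonEmpty 1) body) (sto [:: f a; w; un k; st a k]) (W n * size w + 1)
    (sto [:: f a; [::]; un (size (c a)); st a (size (c a))]).
  elim: w k => [|b w IH] k /= e.
    rewrite muln0 e addn0; exists 1 => //.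
    by apply: RunWhileF.
  have /IH[u uT ru] : size (c a) = k.+1 + size w by lia.
  suff [v vT rv] : runs body (sto [:: f a; b :: w; un k; st a k]) (W n - 1)
     (sto [:: f a; w; un k.+1; st a k.+1]).
    exists (v + u).+1; first by rewrite /W in vT uT *; lia.
    by apply: RunWhileT rv ru.
  have Sk : size (st a k) <= t0 n by apply: St => //; lia.
  have Sk1 : size (st a k.+1) <= t0 n by apply: St => //; lia.
  have Sz : size (pr (un k) (pr (st a k) (f a))) <= 2 * s n + (2 * t0 n) + n + 2.
    by rewrite /pr !size_cat !size_dl size_nseq; move: Sc; rewrite -/n; lia.
  apply: (@runs_le _ _ (1 + ((9 * n + 2) + ((10 * size (st a k) + 3) + ((10 * size (un k) + 3) + ((5 * size (st a k)).+1 +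
     (tq (2 * s n + (2 * t0 n) + n + 2) + ((4 * size (st a k.+1)).+1 + ((4 * size (st a k.+1)).+1 + 1))))))))).
    by rewrite /W size_nseq; move: Sc; rewrite -/n; lia.
  apply: runs_comp (@sto_pop 1 _) _ => /=.
  eapply runs_comp; first (by apply: (@sto_cp 0 5 4)); rewrite /=.
  eapply runs_comp; first (by apply: (@sto_cpdl 3 5 4)); rewrite /=.
  eapply runs_comp; first (by apply: (@sto_cpdl 2 5 4)); rewrite /=.
  apply: runs_comp (@sto_cl 3 _) _ => /=.
  rewrite cats0.
  eapply runs_comp.
    apply: (@sto_reloc q [:: f a; w; un k; [::]; [::]] _ [:: st a k.+1] _ 5) => //.
    by apply: runs_le (mq _ _ Sz) (Q (a, k) _); split=> //=; lia.
  apply: runs_comp (@sto_mv 5 4 _ isT) _ => /=.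
  have := @sto_mv 4 3 [:: f a; w; un k; [::]; catrev (st a k.+1) [::]; [::]] isT.
  rewrite /= catrev_rev {1}catrevE cats0 size_rev => H.
  apply: runs_comp H _.
  by apply: runs_eq (@sto_push 2 true _); sto_tac.
have S0 : size (st a 0) <= t0 n by apply: St.
have Se : size (st a (size (c a))) <= t0 n by apply: St.
apply: (@runs_le _ _ ((9 * n + 2) + (tc n + ((4 * size (c a)).+1 + ((4 * size (c a)).+1 +
   ((9 * n + 2) + (ti n + ((4 * size (st a 0)).+1 + ((4 * size (st a 0)).+1 +
   ((W n * size (c a) + 1) + ((5 * n).+1 + ((5 * size (c a)).+1 + ((4 * size (st a (size (c a)))).+1 + (4 * size (st a (size (c a)))).+1))))))))))))).
  rewrite /T -/n; have : W n * size (c a) <= s n * W n by rewrite mulnC leq_mul.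
  by move: Sc; rewrite -/n; lia.
eapply runs_comp; first (by apply: (@sto_cp 0 5 4)); rewrite /=.
rewrite cats0.
eapply runs_comp.
  by apply: (@sto_reloc pc [:: f a; [::]; [::]; [::]; [::]] _ [:: c a] _ 5) (Pc a Da).
eapply runs_comp; first (by apply: (@sto_mv 5 4)); rewrite /=.
eapply runs_comp.
  have := @sto_mv 4 1 [:: f a; [::]; [::]; [::]; catrev (c a) [::]; [::]] isT.
  by rewrite /= catrev_rev {1}catrevE cats0 size_rev; apply.
eapply runs_comp; first (by apply: (@sto_cp 0 5 4)); rewrite /= cats0.
eapply runs_comp.
  by apply: (@sto_reloc p0 [:: f a; c a; [::]; [::]; [::]] _ [:: st a 0] _ 5) (P0 a Da).
eapply runs_comp; first (by apply: (@sto_mv 5 4)); rewrite /=.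
eapply runs_comp.
  have := @sto_mv 4 3 [:: f a; c a; [::]; [::]; catrev (st a 0) [::]; [::]] isT.
  by rewrite /= catrev_rev {1}catrevE cats0 size_rev; apply.
rewrite [X in runs _ X](_ : _ = sto [:: f a; c a; un 0; st a 0]); last by sto_tac.
eapply runs_comp; first exact: loop.
eapply runs_comp; first by apply: (@sto_cl 0).
eapply runs_comp; first by apply: runs_le (@sto_cl 2 _); rewrite /= size_nseq.
eapply runs_comp; first by apply: (@sto_mv 3 4).
have := @sto_mv 4 0 [:: [::]; [::]; [::]; [::]; catrev (st a (size (c a))) [::]] isT.
by rewrite /= catrev_rev {1}catrevE cats0 size_rev; apply: runs_eq; sto_tac.
Qed.

Lemma ptime_test f g t (b : A -> bool) : (forall a, D a -> test_holds t (sto [:: g a]) = b a) ->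
  ptime D f g -> ptime D f (fun a => [:: b a]).
Proof.
move=> tb /ptime_comp; apply.
apply: (@ptimeI _ _ _ _ (Ite t (Comp (cl 0) (Push 0 true)) (Comp (cl 0) (Push 0 false)))
  (fun a => ((5 * size (g a)).+1 + 1).+1) (fun n => 5 * n + 3)); first by polyb_tac.
  by move=> a _; lia.
move=> a Da; apply: runs_ite (tb a Da) _.
by case: (b a); apply: runs_comp (sto_cl _ _) (sto_push _ _ _).
Qed.

Lemma ptime_head f g : ptime D f g -> ptime D f (fun a => [:: head false (g a)]).
Proof. exact: (@ptime_test _ _ (TopIs1 0)). Qed.

Lemma ptime_nonempty f g : ptime D f g -> ptime D f (fun a => [:: g a != [::]]).
Proof. exact: (@ptime_test _ _ (NonEmpty 0)). Qed.

End Ptime2.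

Lemma eq_ptimer A (D : A -> Prop) f g g' : (forall a, D a -> g a = g' a) ->
  ptime D f g -> ptime D f g'.
Proof. exact: eq_ptime. Qed.

Lemma ptime_arg A (D : A -> Prop) g h : ptime D (fun a => pr (g a) (h a)) g.
Proof. exact: ptime_fst (ptime_id _ _). Qed.

Lemma ptime_skip A (D : A -> Prop) g h r : ptime D h r -> ptime D (fun a => pr (g a) (h a)) r.
Proof. exact: ptime_comp (ptime_snd (ptime_id _ _)). Qed.

Section Closure.
Variables (A : Type) (D : A -> Prop) (f : A -> word).

(** The argument seen by the body of a loop: the outer argument and an index, coded with the index
    in unary in front. Nested loops nest [below] and [withk]. *)
Definition below (c : A -> word) (ak : A * nat) := D ak.1 /\ ak.2 < size (c ak.1).
Definition withk (ak : A * nat) := pr (un ak.2) (f ak.1).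

Lemma ptime_up c g : ptime D f g -> ptime (below c) withk (fun ak => g ak.1).
Proof.
move=> pg; apply: (@ptime_comp _ _ _ (fun ak => f ak.1)).
  exact: ptime_snd (ptime_id _ _).
by apply: (@ptime_sub _ _ (below c) D fst) pg => a [].
Qed.

Lemma ptime_k c : ptime (below c) withk (fun ak => un ak.2).
Proof. exact: ptime_fst (ptime_id _ _). Qed.

Lemma size_un n : size (un n) = n. Proof. exact: size_nseq. Qed.

Lemma size_flatten_le (g : nat -> word) (l : seq nat) m :
  (forall x, x \in l -> size (g x) <= m) -> size (flatten (map g l)) <= size l * m.
Proof.
elim: l => //= x l IH H; rewrite size_cat mulSn leq_add ?H ?mem_head //.
by apply: IH => y yl; apply: H; rewrite inE yl orbT.
Qed.

(** A loop whose turns only append to the output. The state is at most the number of turns times the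
    longest piece, so the size bound required by [ptime_iter] comes for free. *)
Lemma ptime_bigcat c (g : A -> nat -> word) : ptime D f c ->
  ptime (below c) withk (fun ak => g ak.1 ak.2) ->
  ptime D f (fun a => flatten [seq g a k | k <- iota 0 (size (c a))]).
Proof.
move=> pc pg; have [s ps S] := ptime_size pc.
have [s1 ps1 S1] := ptime_size pg; have [s' ps' [S' mo]] := polyb_mono ps1.
apply: (@ptime_iter _ _ _ _ (fun a k => flatten [seq g a k | k <- iota 0 k]) (fun n => s n * s' (2 * s n + n + 1))) => //.
- exact: ptime_nil.
- by polyb_tac; apply: polyb_comp => //; polyb_tac.
- move=> a k Da kc; apply: leq_trans (size_flatten_le (m := s' (2 * s (size (f a)) + size (f a) + 1)) _) _.
    move=> j; rewrite mem_iota add0n => /andP[_ jk].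
    have jc : j < size (c a) by apply: leq_trans kc.
    apply: leq_trans (S1 (a, j) (conj Da jc)) _; apply: leq_trans (S' _) (mo _ _ _).
    by rewrite /withk /pr /= size_cat size_dl size_un; have := S a Da; lia.
  by rewrite size_iota leq_mul //; apply: leq_trans kc (S a Da).
- apply: (@eq_ptimer _ _ _ (fun ak => flatten [seq g ak.1 k | k <- iota 0 ak.2] ++ g ak.1 ak.2)) => [ak _|].
    by rewrite -addn1 iotaD map_cat flatten_cat /= cats0.
  apply: ptime_cat; first by apply: ptime_skip; exact: ptime_arg.
  apply: (@ptime_comp _ _ _ withk); last exact: pg.
  apply: ptime_pair; first exact: ptime_arg.
  by apply/ptime_skip/ptime_skip/ptime_id.
Qed.

Lemma ptime_size_un g : ptime D f g -> ptime D f (fun a => un (size (g a))).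
Proof.
move=> pg; apply: (@eq_ptimer _ _ _ (fun a => flatten [seq [:: true] | k <- iota 0 (size (g a))])) => [a _|].
  by elim: (size _) (0) => //= n IH m; rewrite IH.
by apply: ptime_bigcat => //; exact: ptime_cst.
Qed.

Lemma ptime_un_add m n : ptime D f (fun a => un (m a)) -> ptime D f (fun a => un (n a)) ->
  ptime D f (fun a => un (m a + n a)).
Proof.
move=> pm pn; apply: (eq_ptimer _ (ptime_cat pm pn)) => a _.
by rewrite /un -nseqD.
Qed.

Lemma ptime_un_mul m n : ptime D f (fun a => un (m a)) -> ptime D f (fun a => un (n a)) ->
  ptime D f (fun a => un (m a * n a)).
Proof.
move=> pm pn; have := @ptime_bigcat _ (fun a _ => un (n a)) pm (ptime_up _ pn).
apply: eq_ptimer => a _.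
rewrite size_un; elim: (m a) (0) => //= k IH i; rewrite IH mulSn.
by rewrite /un -nseqD.
Qed.

Lemma ptime_drop g n : ptime D f g -> ptime D f (fun a => un (n a)) ->
  ptime D f (fun a => drop (n a) (g a)).
Proof.
move=> pg pn; have [s ps S] := ptime_size pg.
apply: (eq_ptimer _ (@ptime_iter _ _ f _ (fun a k => drop k (g a)) s pn _ ps _ _)).
- by move=> a _; rewrite size_un.
- by apply: (eq_ptimer _ pg) => a _; rewrite drop0.
- by move=> a k Da _; rewrite size_drop; apply: leq_trans (S a Da); apply: leq_subr.
- apply: (@eq_ptimer _ _ _ (fun ak => behead (drop ak.2 (g ak.1)))) => [ak _|].
    by rewrite -drop1 drop_drop add1n.
  by apply: ptime_behead; apply: ptime_skip; exact: ptime_arg.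
Qed.

Lemma ptime_un_sub m n : ptime D f (fun a => un (m a)) -> ptime D f (fun a => un (n a)) ->
  ptime D f (fun a => un (m a - n a)).
Proof.
move=> pm pn; apply: (eq_ptimer _ (ptime_drop pm pn)) => a _.
by rewrite /un drop_nseq.
Qed.

Lemma ptime_un_cst n : ptime D f (fun _ => un n).
Proof. exact: ptime_cst. Qed.

Lemma ptime_negb b : ptime D f (fun a => [:: b a]) -> ptime D f (fun a => [:: ~~ b a]).
Proof.
move=> pb; apply: (@eq_ptimer _ _ _ (fun a => if b a then [:: false] else [:: true])) => [a _|].
  by case: (b a).
by apply: ptime_if => //; exact: ptime_cst.
Qed.

Lemma ptime_andb b c : ptime D f (fun a => [:: b a]) -> ptime D f (fun a => [:: c a]) ->
  ptime D f (fun a => [:: b a && c a]).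
Proof.
move=> pb pc; apply: (@eq_ptimer _ _ _ (fun a => if b a then [:: c a] else [:: false])) => [a _|].
  by case: (b a).
apply: ptime_if => //; last exact: ptime_cst.
by apply: ptime_weak pc => a [].
Qed.

Lemma ptime_orb b c : ptime D f (fun a => [:: b a]) -> ptime D f (fun a => [:: c a]) ->
  ptime D f (fun a => [:: b a || c a]).
Proof.
move=> pb pc; apply: (eq_ptimer _ (ptime_negb (ptime_andb (ptime_negb pb) (ptime_negb pc)))) => a _.
by rewrite negb_and !negbK.
Qed.

Lemma ptime_leq m n : ptime D f (fun a => un (m a)) -> ptime D f (fun a => un (n a)) ->
  ptime D f (fun a => [:: m a <= n a]).
Proof.
move=> pm pn; apply: (eq_ptimer _ (ptime_negb (ptime_nonempty (ptime_un_sub pm pn)))) => a _.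
by rewrite negbK -subn_eq0 -size_eq0 size_un.
Qed.

Lemma ptime_eqn m n : ptime D f (fun a => un (m a)) -> ptime D f (fun a => un (n a)) ->
  ptime D f (fun a => [:: m a == n a]).
Proof.
move=> pm pn; apply: (eq_ptimer _ (ptime_andb (ptime_leq pm pn) (ptime_leq pn pm))) => a _.
by rewrite eqn_leq.
Qed.

Lemma ptime_nth g n : ptime D f g -> ptime D f (fun a => un (n a)) ->
  ptime D f (fun a => [:: nth false (g a) (n a)]).
Proof.
move=> pg pn; apply: (eq_ptimer _ (ptime_head (ptime_drop pg pn))) => a _.
by rewrite -nth0 nth_drop addn0.
Qed.

Lemma ptime_eqb b c : ptime D f (fun a => [:: b a]) -> ptime D f (fun a => [:: c a]) ->
  ptime D f (fun a => [:: b a == c a]).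
Proof.
move=> pb pc; apply: (@eq_ptimer _ _ _ (fun a => if b a then [:: c a] else [:: ~~ c a])) => [a _|].
  by case: (b a); case: (c a).
by apply: ptime_if => //; [apply: ptime_weak pc|apply: ptime_weak (ptime_negb pc)] => a [].
Qed.

End Closure.

Lemma nat_bits_rec n : 0 < n -> nat_bits n = odd n :: nat_bits n./2.
Proof.
rewrite /nat_bits; have := bin_of_natK n; case: (bin_of_nat n) => [|p] /= <- //= _.
case: p => [q|q|] //=.
- by rewrite NatTrec.doubleE /= uphalf_double odd_double -[nat_of_pos q]/(nat_of_bin (Npos q)) nat_of_binK.
- by rewrite NatTrec.doubleE doubleK odd_double -[nat_of_pos q]/(nat_of_bin (Npos q)) nat_of_binK.
Qed.

Lemma flatten_nil (T : Type) (l : seq nat) : flatten [seq ([::] : seq T) | _ <- l] = [::].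
Proof. by elim: l. Qed.

(** Binary digits are the parities of the iterated halves, so [ptime_bigcat] can write them; after
    [n] turns the halves have reached 0 and contribute nothing. *)
Lemma nat_bits_flatten n K : n <= K ->
  nat_bits n = flatten [seq (if iter k half n == 0 then [::] else [:: odd (iter k half n)]) | k <- iota 0 K].
Proof.
elim: K n => [|K IH] n nK; first by case: n nK.
case: n nK => [|n] nK.
  by rewrite (eq_map (g := fun=> [::])) ?flatten_nil // => k; rewrite (_ : iter k half 0 = 0) //; elim: k => //= k ->.
rewrite nat_bits_rec // (IH n.+1./2); last by lia.
rewrite /= -[1]addn0 iotaDl -map_comp; congr (_ :: flatten _).
by apply: eq_map => k; rewrite /comp add1n iterSr.
Qed.

Section Closure.
Variables (A : Type) (D : A -> Prop) (f : A -> word).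

Lemma eq_flatten_iota (g : nat -> word) (h : nat -> word) n :
  (forall k, k < n -> g k = h k) -> flatten [seq g k | k <- iota 0 n] = flatten [seq h k | k <- iota 0 n].
Proof.
move=> H; congr flatten; apply/eq_in_map => k; rewrite mem_iota add0n => /andP[_]; exact: H.
Qed.

Lemma ptime_eqw g h : ptime D f g -> ptime D f h -> ptime D f (fun a => [:: g a == h a]).
Proof.
move=> pg ph.
(* [r a] receives a mark at each position of disagreement; [nth] pads the second word with [false],
   hence the separate test on lengths. *)
pose r a := flatten [seq (if nth false (g a) k == nth false (h a) k then [::] else [:: true]) | k <- iota 0 (size (g a))].
apply: (@eq_ptimer _ _ _ (fun a => [:: (size (g a) == size (h a)) && ~~ (r a != [::])])) => [a _|].
  congr [:: _]; rewrite negbK; apply/andP/eqP => [[/eqP sz /eqP E]|gh]; last first.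
    by split; rewrite ?gh //; apply/eqP; rewrite /r gh (eq_map (g := fun=> [::])) ?flatten_nil // => k /=; rewrite eqxx.
  apply: (@eq_from_nth _ false) => // i ig; apply/eqP/negPn/negP => ne.
  move: E; rewrite /r -(subnKC (ltnW ig)) iotaD map_cat flatten_cat add0n.
  case: (size (g a) - i) (subn_gt0 i (size (g a))) => [|k]; rewrite ?ig //= (negPf ne).
  by move=> _ /(congr1 size); rewrite size_cat /=; lia.
apply: ptime_andb; first by apply: ptime_eqn; apply: ptime_size_un.
apply/ptime_negb/ptime_nonempty/ptime_bigcat => //.
have E x : ptime D f x -> ptime (below D g) (withk f) (fun ak => [:: nth false (x ak.1) ak.2]).
  by move=> px; apply: ptime_nth; [exact: ptime_up|exact: ptime_k].
by apply: ptime_if; [apply: ptime_eqb; apply: E|exact: ptime_cst|exact: ptime_cst].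
Qed.

Lemma ptime_odd n : ptime D f (fun a => un (n a)) -> ptime D f (fun a => [:: odd (n a)]).
Proof.
move=> pn; apply: eq_ptimer (@ptime_iter _ _ f _ (fun _ k => [:: odd k]) (fun=> 1) pn _ _ _ _).
- by move=> a _; rewrite size_un.
- exact: ptime_cst.
- exact: polyb_cst.
- by [].
- apply: (@ptime_negb _ _ _ (fun ak => odd ak.2)).
  by apply: ptime_skip; apply: ptime_arg.
Qed.
End Closure.

Section Closure2.
Variables (A : Type) (D : A -> Prop) (f : A -> word).

(** There are [(n a)./2] odd numbers below [n a]: one mark is written at each odd index. *)
Lemma ptime_half n : ptime D f (fun a => un (n a)) -> ptime D f (fun a => un (n a)./2).
Proof.
move=> pn; have := @ptime_bigcat _ _ _ _ (fun a k => if odd k then [:: true] else [::]) pn.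
move=> H; apply: eq_ptimer (H _) => [a _|].
  rewrite size_un; elim: (n a) => // m IH.
  rewrite -addn1 iotaD map_cat flatten_cat IH /= add0n cats0 addn1 /= uphalf_half addnC.
  by case: (odd m); rewrite ?addn0 ?cats0 // /un nseqD.
by apply: ptime_if; [apply/ptime_odd/ptime_k|exact: ptime_cst|exact: ptime_cst].
Qed.
End Closure2.

Section Closure3.
Variables (A : Type) (D : A -> Prop) (f : A -> word).

Lemma ptime_iter_half n k : ptime D f (fun a => un (n a)) -> ptime D f (fun a => un (k a)) ->
  ptime D f (fun a => un (iter (k a) half (n a))).
Proof.
move=> pn pk; have [s ps S] := ptime_size pn.
apply: eq_ptimer (@ptime_iter _ _ f _ (fun a k => un (iter k half (n a))) s pk _ _ _ _) => //.
- by move=> a _; rewrite size_un.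
- move=> a j Da _; apply: leq_trans (S a Da); rewrite !size_un.
  by elim: j => //= j IH; lia.
- by apply: ptime_half; apply: ptime_skip; exact: ptime_arg.
Qed.

End Closure3.

Section Closure4.
Variables (A : Type) (D : A -> Prop) (f : A -> word).

Lemma ptime_nat_bits n : ptime D f (fun a => un (n a)) -> ptime D f (fun a => nat_bits (n a)).
Proof.
move=> pn; apply: (eq_ptimer _ (@ptime_bigcat _ _ _ _
  (fun a k => if iter k half (n a) == 0 then [::] else [:: odd (iter k half (n a))]) pn _)).
  by move=> a _; rewrite size_un -nat_bits_flatten.
have pi : ptime (below D (fun a => un (n a))) (withk f) (fun ak => un (iter ak.2 half (n ak.1))).
  by apply: ptime_iter_half; [exact: ptime_up pn|exact: ptime_k].
apply: ptime_if; [|exact: ptime_cst|].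
  by apply: ptime_eqn => //; exact: ptime_un_cst.
by apply: ptime_weak (ptime_odd pi) => a [].
Qed.

Lemma ptime_dl g : ptime D f g -> ptime D f (fun a => dl (g a)).
Proof.
by move=> pg; apply: eq_ptimer (ptime_pair pg (ptime_nil _ _)) => a _; rewrite /pr cats0.
Qed.

Lemma ptime_enc_nat n : ptime D f (fun a => un (n a)) -> ptime D f (fun a => enc_nat (n a)).
Proof. by move=> /ptime_nat_bits/ptime_dl. Qed.

End Closure4.

(** * Polynomial reductions *)

(** A program given by [fpt_reduces] or [computable] may leave anything outside the stacks of its
    interface, while [ptime] programs start from clean ones. Stacks from [regs p] on are never
    touched, so only finitely many have to be cleared. *)
Fixpoint regs (p : prog) : nat :=
  let tr b := match b with NonEmpty r => r | TopIs1 r => r end in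
  match p with
  | Push r _ => r.+1
  | Pop r => r.+1
  | Comp p q => maxn (regs p) (regs q)
  | Ite b p q => maxn (regs p) (regs q)
  | While b p => regs p
  end.

Lemma run_regs p s n s' : run p s n s' -> forall r, regs p <= r -> s' r = s r.
Proof.
elim=> {p s n s'} //=.
- by move=> r b s q; rewrite /upd; case: eqP => // ->; rewrite ltnn.
- by move=> r s q; rewrite /upd; case: eqP => // ->; rewrite ltnn.
- by move=> p q s1 s2 s3 n m _ H1 _ H2 r; rewrite geq_max => /andP[/H1 <- /H2 <-].
- by move=> b p q s s' n _ _ H r; rewrite geq_max => /andP[/H <-].
- by move=> b p q s s' n _ _ H r; rewrite geq_max => /andP[_ /H <-].
- by move=> b p s1 s2 s3 n m _ _ H1 _ H2 r le; rewrite H2 // H1.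
Qed.

Definition skip := Comp (Push 0 true) (Pop 0).

Lemma runs_skip s : runs skip s 2 s.
Proof.
apply: runs_comp (runs_push _ _ _) _.
have := runs_pop 0 (upd s 0 (true :: s 0)).
by rewrite upd_same upd_upd /= upd_id.
Qed.

Definition clr (rs : seq nat) := foldr (fun r p => Comp (cl r) p) skip rs.

Lemma runs_clr rs s B : (forall r, r \in rs -> size (s r) <= B) ->
  runs (clr rs) s (size rs * (5 * B + 1) + 2) (fun r => if r \in rs then [::] else s r).
Proof.
elim: rs s => [|r rs IH] s H.
  by apply: runs_skip.
rewrite /= mulSn -addnA; apply: runs_comp.
  by apply: runs_le (runs_cl _ _); rewrite addn1 ltnS leq_mul2l H ?mem_head.
have {}IH : runs (clr rs) (upd s r [::]) (size rs * (5 * B + 1) + 2)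
    (fun q => if q \in rs then [::] else upd s r [::] q).
  apply: IH => q qr; rewrite /upd; case: eqP => // _; apply: H; by rewrite inE qr orbT.
apply: runs_eq IH; apply/funext => q; rewrite inE /upd.
by case: eqP => //= _; case: ifP.
Qed.

Lemma runs_tidy p s n s' (l l' : seq word) (keep : pred nat) B : run p s n s' ->
  (forall r, regs p <= r -> s r = nth [::] l r) -> size l' <= regs p ->
  (forall r, r < regs p -> nth [::] l' r = if keep r then s' r else [::]) ->
  (forall r, size (s' r) <= B) ->
  (forall r, regs p <= r -> nth [::] l r = [::]) ->
  runs (Comp p (clr [seq r <- iota 0 (regs p) | ~~ keep r])) s
     (n + (regs p * (5 * B + 1) + 2)) (sto l').
Proof.
move=> rn sl sz keepl' sB l0; apply: runs_comp; first by exists n; [|exact: rn].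
apply: (@runs_le _ _ (size [seq r <- iota 0 (regs p) | ~~ keep r] * (5 * B + 1) + 2)).
  by rewrite leq_add2r leq_mul2r (leq_trans (size_subseq (filter_subseq _ _))) ?orbT // size_iota.
apply: runs_eq (runs_clr (B := B) _) => //.
apply/funext => r; rewrite mem_filter mem_iota /= add0n /sto.
have [rp|pr_] := ltnP r (regs p); first by rewrite andbT keepl' //; case: (keep r).
by rewrite andbF (run_regs rn) // sl // l0 // nth_default // (leq_trans sz).
Qed.

Lemma load_sto w k : load w k = sto [:: w; un k].
Proof. by apply/funext => -[|[|r]] //; rewrite /load /sto /= nth_nil. Qed.

(** Polynomial-time postprocessing of a computable value. It yields the computability of the bounds
    attached to a composed reduction. *)
Lemma computable_ptime f h : computable f ->
  ptime (fun _ : nat => True) (fun k => pr (un k) (un (f k))) (fun k => un (h k)) -> computable h.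
Proof.
move=> [p pf] [q [t [_ Q]]].
pose p' := Comp p skip; pose p1 := Comp p (Comp (Pop 2) skip).
exists (Comp (cp 1 4 2) (Comp (reloc 3 (Comp p1 (clr [seq r <- iota 0 (regs p1) | r != 1])))
  (Comp (mv 4 0) (Comp (cpdl 1 0 2) (Comp (cl 1) (Comp q (mv 0 1))))))).
move=> k; have [w [n [s [m [rp _ _ s1]]]]] := pf k; rewrite load_sto in rp.
set c := clr _; set p2 := reloc 3 _.
have [T [_ [N _ rn]]] : exists T, True /\ runs (Comp (cp 1 4 2) (Comp p2
  (Comp (mv 4 0) (Comp (cpdl 1 0 2) (Comp (cl 1) (Comp q (mv 0 1)))))))
   (load [::] k) T (sto [:: [::]; un (h k)]).
  rewrite load_sto; eexists; split => //.
  eapply runs_comp; first by apply: (@sto_cp 1 4 2).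
  rewrite /= cats0; eapply runs_comp.
    apply: (@sto_reloc _ [:: [::]; un k; [::]] [:: [::]; un k] [:: [::]; un (f k)] _ 3) => //.
    have rp1 : run p1 (sto [:: [::]; un k]) (m + (1 + (1 + 1))) (upd s 2 (behead (s 2))).
      apply: RunComp rp _; apply: RunComp (RunPop _ _) _.
      set s2 := upd s 2 _; have := RunComp (RunPush 0 true s2) (RunPop 0 (upd s2 0 (true :: s2 0))).
      by rewrite upd_same upd_upd /= upd_id.
    apply: (@runs_tidy _ _ _ _ [:: [::]; un k] [:: [::]; un (f k)] (fun r => r == 1)
       (size (un k) + (m + (1 + (1 + 1)))) rp1) => //.
    - by rewrite /= !leq_max /= !orbT.
    - by move=> [|[|r]] // _; rewrite /= nth_nil.
    - move=> r; apply: leq_trans (run_size rp1 r) _; rewrite leq_add2r.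
      by case: r => [|[|r]] //; rewrite /sto /= nth_nil.
    - by move=> [|[|r]] //=; rewrite ?nth_nil // !geq_max //= => /andP[_].
  rewrite /=; eapply runs_comp; first by apply: (@sto_mv 4 0).
  rewrite /=; eapply runs_comp; first by apply: (@sto_cpdl 1 0 2).
  rewrite /=; eapply runs_comp; first by apply: (@sto_cl 1).
  eapply runs_comp.
    rewrite [X in runs _ X](_ : _ = sto [:: pr (un k) (un (f k))]); first exact: (Q k I).
    rewrite /= catrevE cats0 {3}/un rev_nseq; sto_tac.
  have := @sto_mv 0 1 [:: un (h k)] isT.
  rewrite /= catrevE cats0 {4}/un rev_nseq; exact.
by exists [::], N, (sto [:: [::]; un (h k)]), N; split.
Qed.

(** Both reductions of this development have this form: a map on instances, computed in time
    polynomial in the code and the unary parameter together, with a polynomial bound on the new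
    parameter. [fpt_poly] returns to bounds that depend arbitrarily on the parameter. *)
Definition poly_reduces (P Q : pproblem) : Prop :=
  exists (y : inst P -> inst Q) (b : nat -> nat),
    [/\ forall x, valid x -> valid (y x),
        ptime (@valid P) (fun x => pr (un (param x)) (Defs.code x)) (fun x => pr (un (param (y x))) (Defs.code (y x))),
        polyb b,
        forall x, valid x -> param (y x) <= b (param x) &
        forall x, valid x -> (yes x <-> yes (y x))].

Lemma ptime_un_exp A (D : A -> Prop) f m d : ptime D f (fun a => un (m a)) ->
  ptime D f (fun a => un (m a ^ d)).
Proof.
move=> pm; elim: d => [|d IH]; first exact: ptime_cst.
by apply: eq_ptimer (ptime_un_mul pm IH) => a _; rewrite expnS.
Qed.

Lemma computable_bound f C e d : computable f ->
  computable (fun k => C * (k + f k + e) ^ d).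
Proof.
move=> /computable_ptime; apply.
apply: ptime_un_mul; first exact: ptime_un_cst.
apply: ptime_un_exp; apply: ptime_un_add; last exact: ptime_un_cst.
by apply: ptime_un_add; [exact: ptime_arg|apply: ptime_skip; exact: ptime_id].
Qed.

Lemma fpt_poly P Q R : fpt_reduces P Q -> poly_reduces Q R -> fpt_reduces P R.
Proof.
move=> [p [f1 [g1 [c1 [cf cg pP]]]]] [y [b [yv [q [t [pt Qt]]] [cb [db pb]] yb yy]]].
have [tq ptq [ttq mtq]] := polyb_mono pt.
pose p1 := Comp p (Comp (Pop 2) skip).
pose H B := (B + (regs p1 * (5 * B + 1) + 2)) + ((10 * B + 3) + ((5 * B).+1 + (tq (3 * B + 1) + (5 * (3 * B + 1 + tq (3 * B + 1)) + 2)))).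
have pq : polyb (fun B => tq (3 * B + 1)) by apply: (polyb_comp ptq); polyb_tac.
have [C [d HC]] : polyb H.
  apply: (@polyb_le _ (fun B => (B + (regs p1 * (5 * B + 1) + 2)) + ((10 * B + 3) + ((1 + 5 * B) + (tq (3 * B + 1) + (5 * (3 * B + 1 + tq (3 * B + 1)) + 2)))))).
    by move=> B; rewrite /H add1n.
  by polyb_tac.
set c := clr [seq r <- iota 0 (regs p1) | ~~ (r <= 1)].
exists (Comp (Comp p1 c) (Comp (cpdl 1 0 2) (Comp (cl 1) (Comp q (undl 0 1))))),
  (fun k => C * (k + f1 k + 4) ^ d), (fun k => cb * (k + g1 k + 1) ^ db), (c1.+1 * d).
split; [exact: computable_bound|exact: computable_bound|] => x vx.
have [x' [vx' [s [m [rp mT s0 s1]] pg yx]]] := pP x vx.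
exists (y x'); split; [exact: yv| | |by rewrite yx; exact: yy]; last first.
  apply: leq_trans (yb _ vx') _; apply: leq_trans (pb _) _.
  by rewrite leq_mul2l; apply/orP; right; case: db {pb} => // db; rewrite leq_exp2r //; lia.
set k := param x in mT pg rp *; set n := size (Defs.code x) in mT *.
set B := n + k + (m + 3).
(* [B] bounds the running time of [p1] and the lengths on its stacks. With this product form, a
   polynomial in [B] splits into a factor depending on the parameter alone and a power of the code
   length. *)
have BH : B.+1 <= (k + f1 k + 4) * n.+1 ^ c1.+1.
  have e1 : n.+1 ^ c1 <= n.+1 ^ c1.+1 by rewrite leq_pexp2l.
  have e2 : n.+1 <= n.+1 ^ c1.+1 by rewrite -{1}[n.+1]expn1 leq_pexp2l.
  have e3 : m <= f1 k * n.+1 ^ c1.+1 by apply: leq_trans mT _; rewrite leq_mul2l e1 orbT.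
  have e4 : k <= k * n.+1 ^ c1.+1 by rewrite leq_pmulr // (leq_trans _ e2).
  by rewrite /B !mulnDl; lia.
suff [N NH rN] : runs (Comp (Comp p1 c) (Comp (cpdl 1 0 2) (Comp (cl 1) (Comp q (undl 0 1)))))
    (load (Defs.code x) k) (H B) (sto [:: Defs.code (y x'); un (param (y x'))]).
  exists (sto [:: Defs.code (y x'); un (param (y x'))]), N; split=> //.
  apply: leq_trans NH _; apply: leq_trans (HC B) _.
  rewrite -mulnA leq_mul2l; apply/orP; right.
  rewrite expnM -expnMn; case: (d) => // d'; by rewrite leq_exp2r.
rewrite load_sto in rp *.
have rp1 : run p1 (sto [:: Defs.code x; un k]) (m + (1 + (1 + 1))) (upd s 2 (behead (s 2))).
  apply: RunComp rp _; apply: RunComp (RunPop _ _) _.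
  set s2 := upd s 2 _; have := RunComp (RunPush 0 true s2) (RunPop 0 (upd s2 0 (true :: s2 0))).
  by rewrite upd_same upd_upd /= upd_id.
have szB r : size (upd s 2 (behead (s 2)) r) <= B.
  apply: leq_trans (run_size rp1 r) _; rewrite /B leq_add2r.
  case: r => [|[|r]]; rewrite /sto /=; [exact: leq_addr|by rewrite size_un leq_addl|by rewrite nth_nil].
have R1 := @runs_tidy _ _ _ _ [:: Defs.code x; un k] [:: Defs.code x'; un (param x')] (fun r => r <= 1) B rp1.
have k'B : param x' <= B by have := szB 1; rewrite /upd /= s1 size_nseq.
have w'B : size (Defs.code x') <= B by have := szB 0; rewrite /upd /= s0.
have zB : size (pr (un (param x')) (Defs.code x')) <= 3 * B + 1 by rewrite /pr size_cat size_dl size_un; lia.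
have R2 := Qt x' vx'.
have k''B : param (y x') <= 3 * B + 1 + tq (3 * B + 1).
  have := runs_size 0 R2; rewrite -[sto _ 0]/(pr (un (param (y x'))) (Defs.code (y x'))).
  rewrite -[sto _ 0]/(pr (un (param x')) (Defs.code x')) {1}/pr size_cat size_dl size_un.
  by have := ttq (size (pr (un (param x')) (Defs.code x'))); have := mtq _ _ zB; lia.
apply: (@runs_le _ _ ((m + (1 + (1 + 1)) + (regs p1 * (5 * B + 1) + 2)) + ((10 * param x' + 3) + ((5 * param x').+1 + (tq (3 * B + 1) + (5 * param (y x') + 2)))))).
  by rewrite /H; apply: leq_add; [rewrite /B; lia|lia].
apply: runs_comp.
  apply: R1 => //.
  - by rewrite /= !leq_max /= !orbT.
  - by move=> [|[|r]] // _; rewrite /= nth_nil.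
  - by move=> [|[|r]] //=; rewrite ?nth_nil // !geq_max //= => /andP[_].
have R3 := @sto_cpdl 1 0 2 [:: Defs.code x'; un (param x')] isT isT isT erefl.
rewrite [nth _ _ 1]/(un (param x')) size_un in R3; apply: runs_comp R3 _.
have R4 := @sto_cl 1 [:: pr (un (param x')) (Defs.code x'); un (param x')].
rewrite [nth _ _ 1]/(un (param x')) size_un in R4; apply: runs_comp R4 _.
eapply runs_comp.
  rewrite [X in runs _ X](_ : _ = sto [:: pr (un (param x')) (Defs.code x')]); last by sto_tac.
  by apply: runs_le R2; apply: leq_trans (ttq _) (mtq _ _ zB).
have := @sto_undl 0 1 [:: pr (un (param (y x'))) (Defs.code (y x'))] _ _ isT erefl.
by rewrite size_un /= catrevE cats0 {3}/un rev_nseq.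
Qed.

Lemma computable_cst c : computable (fun _ => c).
Proof.
have idc : computable id.
  exists skip => k; have [n _ rn] := runs_skip (load [::] k).
  by exists [::], n, (load [::] k), n; split.
by apply: (computable_ptime idc); exact: ptime_cst.
Qed.

Lemma fpt_refl P : fpt_reduces P P.
Proof.
exists skip, (fun=> 2), id, 0; split; first exact: computable_cst.
  exists skip => k; have [n _ rn] := runs_skip (load [::] k).
  by exists [::], n, (load [::] k), n; split.
move=> x vx; exists x; split => //.
have [n n2 rn] := runs_skip (load (Defs.code x) (param x)).
by exists (load (Defs.code x) (param x)), n; split.
Qed.

Section HillGeometry.
Import Order.TTheory GRing.Theory Num.Theory.
Import numFieldNormedType.Exports.
Local Open Scope classical_set_scope.
Local Open Scope ring_scope.

(** * Polygons under a positive piecewise linear function *)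

Section Continuity.
Variables (R : realType) (T : topologicalType).
Implicit Types f g : T -> R.

Lemma continuous_maxr f g : continuous f -> continuous g -> continuous (fun x => Num.max (f x) (g x)).
Proof. by move=> cf cg x; apply: (@continuous_max R T f g x); [exact: cf|exact: cg]. Qed.

Lemma continuous_minr f g : continuous f -> continuous g -> continuous (fun x => Num.min (f x) (g x)).
Proof. by move=> cf cg x; apply: (@continuous_min R T f g x); [exact: cf|exact: cg]. Qed.
End Continuity.

Section Hill.
Variables (R : realType) (n : nat) (X Y : nat -> R).
Hypothesis Xlt : forall i, (i < n)%N -> X i < X i.+1.
Hypothesis Y0 : Y 0%N = 0.

(** The interpolation is a sum of clipped ramps, one per edge, instead of a definition by cases:
    continuity on the whole line then follows termwise. *)
Definition slope i := (Y i.+1 - Y i) / (X i.+1 - X i).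
Definition ramp i (x : R) : R := Num.max 0 (Num.min (x - X i) (X i.+1 - X i)).
Definition hgt (x : R) : R := \sum_(0 <= i < n) slope i * ramp i x.

Lemma X_mono i j : (i <= j)%N -> (j <= n)%N -> X i <= X j.
Proof.
elim: j => [|j IH]; first by rewrite leqn0 => /eqP ->.
rewrite leq_eqVlt => /orP[/eqP -> //|]; rewrite ltnS => ij jn.
exact: le_trans (IH ij (ltnW jn)) (ltW (Xlt jn)).
Qed.

Lemma X_smono i j : (i < j)%N -> (j <= n)%N -> X i < X j.
Proof. by move=> ij jn; apply: lt_le_trans (Xlt _) (X_mono ij jn); apply: leq_trans jn. Qed.

(** Ramps left of the [k]-th piece are saturated and telescope to [Y k]; those on its right
    vanish. *)
Lemma hgtE k x : (k < n)%N -> X k <= x <= X k.+1 -> hgt x = Y k + slope k * (x - X k).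
Proof.
move=> kn /andP[kx xk].
rewrite /hgt (@big_cat_nat _ _ _ k) //=; last exact: ltnW.
rewrite [X in _ + X]big_ltn //.
rewrite [X in _ + (_ + X)]big_nat_cond [X in _ + (_ + X)]big1 ?addr0; last first.
  move=> i; rewrite andbT => /andP[ki i_n].
  rewrite /ramp (_ : Num.max _ _ = 0) ?mulr0 //; apply/max_idPl.
  by rewrite ge_min; apply/orP; left; rewrite subr_le0 (le_trans xk) // X_mono // ltnW.
congr (_ + _).
  rewrite -[RHS]subr0 -[X in _ - X]Y0 -(telescope_sumr _ (leq0n k)).
  apply: eq_big_nat => i /andP[_ ik].
  have i_n : (i < n)%N by apply: ltn_trans kn.
  have Xi := Xlt i_n.
  have -> : ramp i x = X i.+1 - X i.
    rewrite /ramp (_ : Num.min _ _ = X i.+1 - X i).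
      by apply/max_idPr; rewrite subr_ge0 ltW.
    by apply/min_idPr; rewrite lerD2r (le_trans _ kx) // X_mono // ltnW.
  by rewrite /slope divfK // subr_eq0 gt_eqF.
congr (_ * _); rewrite /ramp (_ : Num.min _ _ = x - X k).
  by apply/max_idPr; rewrite subr_ge0.
by apply/min_idPl; rewrite lerD2r.
Qed.

Lemma locate x : (0 < n)%N -> X 0%N <= x <= X n -> exists2 k, (k < n)%N & X k <= x <= X k.+1.
Proof.
move=> n0 /andP[x0 xn].
have : forall m, (m < n)%N -> x <= X m.+1 -> exists2 k, (k < n)%N & X k <= x <= X k.+1.
  elim=> [|m IH] mn xm; first by exists 0%N => //; rewrite x0.
  have [xm1|/ltW mx] := leP x (X m.+1); first by apply: IH => //; apply: ltnW.
  by exists m.+1 => //; rewrite mx.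
by case: n n0 xn => // m _ xm /(_ m); apply.
Qed.

Lemma hgt_at k : (k <= n)%N -> (0 < n)%N -> hgt (X k) = Y k.
Proof.
move=> kn n0; have [kn'|] := ltnP k n.
  by rewrite (@hgtE k) ?lexx ?ltW ?Xlt // subrr mulr0 addr0.
move=> nk; have {kn nk} -> : k = n by apply/eqP; rewrite eqn_leq kn.
case: n n0 Xlt hgtE => // m _ XltS H.
rewrite (H m) //; last by rewrite lexx andbT ltW // XltS.
rewrite /slope divfK; first by rewrite addrC subrK.
by rewrite subr_eq0 gt_eqF // XltS.
Qed.

Lemma continuous_hgt : continuous hgt.
Proof.
rewrite /hgt; elim: n => [|m IH] x.
  under eq_fun do rewrite big_geq //; exact: cvg_cst.
under eq_fun do rewrite big_nat_recr //=.
apply: cvgD; first exact: IH.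
apply: (@cvgM _ _ _ _ (fun=> slope m)); first exact: cvg_cst.
apply: (@continuous_maxr R R (fun=> 0) (fun x => Num.min (x - X m) (X m.+1 - X m))).
  by move=> y; exact: cvg_cst.
apply: continuous_minr => y; last exact: cvg_cst.
by apply: cvgB; [exact: cvg_id|exact: cvg_cst].
Qed.
End Hill.

Lemma segmentP (R : realType) (p q z : R * R) : p.1 < q.1 ->
  segment p q z <-> p.1 <= z.1 <= q.1 /\ z.2 = p.2 + (q.2 - p.2) / (q.1 - p.1) * (z.1 - p.1).
Proof.
move=> pq; have d0 : 0 < q.1 - p.1 by rewrite subr_gt0.
split=> [[t /= /andP[t0 t1] <- /=]|[/andP[z1 z2] zE]].
  split.
    rewrite lerDl mulr_ge0 ?(ltW d0) //= -lerBrDl.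
    by rewrite ler_piMl // ltW.
  have -> : p.1 + t *: (q.1 - p.1) - p.1 = t * (q.1 - p.1) by rewrite addrC addKr.
  by congr (_ + _); rewrite mulrCA divfK ?gt_eqF // mulrC.
exists ((z.1 - p.1) / (q.1 - p.1)).
  apply/andP; split; first by rewrite divr_ge0 // ?subr_ge0 // ltW.
  by rewrite ler_pdivrMr // mul1r lerD2r.
case: z zE z1 z2 => z1 z2 /= -> _ _; congr (_, _).
  by rewrite /= /GRing.scale /= divfK ?gt_eqF // addrC subrK.
rewrite /= /GRing.scale /=; field.
by rewrite gt_eqF.
Qed.

Lemma segmentC (R : realType) (p q : R * R) : segment p q = segment q p.
Proof.
suff H : forall a b : R * R, segment a b `<=` segment b a by apply/seteqP; split; apply: H.
move=> a b z [t /= /andP[t0 t1] <-]; exists (1 - t).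
  by rewrite /= subr_ge0 t1 lerBlDl lerDr.
by rewrite scalerBl scale1r -scalerN opprB addrA [b + (a - b)]addrC subrK.
Qed.

Section Polygon.
Variables (R : realType) (n : nat) (X Y : nat -> R) (W : polygon).
Hypothesis Xlt : forall i, (i < n)%N -> X i < X i.+1.
Hypothesis Y0 : Y 0%N = 0.
Hypothesis Yn : Y n = 0.
Hypothesis Ypos : forall i, (0 < i < n)%N -> 0 < Y i.
Hypothesis n2 : (1 < n)%N.
Hypothesis sizeW : size W = n.+1.
Hypothesis vertexW : forall i, (i <= n)%N -> vertex R W i = (X i, Y i).

Let n0 : (0 < n)%N. Proof. exact: ltnW. Qed.
Let h := hgt n X Y.

Lemma vertex_last : vertex R W n.+1 = (X 0%N, Y 0%N).
Proof. by rewrite -vertexW // /vertex sizeW modnn mod0n. Qed.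

Lemma edgeP i z : (i < n)%N -> edge W i z <-> X i <= z.1 <= X i.+1 /\ z.2 = h z.1.
Proof.
move=> i_n; rewrite /edge !vertexW //; last exact: ltnW.
rewrite segmentP /=; last exact: Xlt.
split=> [[zx ->]|[zx ->]]; split=> //; rewrite /h (hgtE Xlt Y0 i_n) //.
Qed.

Lemma base_edgeP z : edge W n z <-> X 0%N <= z.1 <= X n /\ z.2 = 0.
Proof.
rewrite /edge vertex_last vertexW // segmentC segmentP /=; last exact: (X_smono Xlt).
by rewrite Y0 Yn subrr mul0r mul0r addr0.
Qed.

(** Interpolation with the denominator cleared. On the edge both weights are nonnegative, which
    gives signs and comparisons without division. *)
Lemma h_conv k x : (k < n)%N -> X k <= x <= X k.+1 ->
  h x * (X k.+1 - X k) = Y k * (X k.+1 - x) + Y k.+1 * (x - X k).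
Proof.
move=> kn xk; rewrite /h (hgtE Xlt Y0 kn xk) /slope.
by field; rewrite gt_eqF // subr_gt0 Xlt.
Qed.

Lemma Y_ge0 i : (i <= n)%N -> 0 <= Y i.
Proof.
move=> i_n; have [->|i0] := posnP i; first by rewrite Y0.
move: i_n; rewrite leq_eqVlt => /orP[/eqP ->|i_n]; first by rewrite Yn.
by apply/ltW/Ypos; rewrite i0.
Qed.

Lemma h_ge0 x : X 0%N <= x <= X n -> 0 <= h x.
Proof.
move=> xn; have [k kn xk] := locate n0 xn.
have d0 : 0 < X k.+1 - X k by rewrite subr_gt0 Xlt.
rewrite -(pmulr_lge0 _ d0) h_conv //; case/andP: xk => k1 k2.
by rewrite addr_ge0 // mulr_ge0 ?subr_ge0 ?Y_ge0 // ltnW.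
Qed.

Lemma h_gt0 x : X 0%N < x < X n -> 0 < h x.
Proof.
move=> /andP[x0 xn]; have [|k kn xk] := @locate R n X x n0; first by rewrite !ltW.
have d0 : 0 < X k.+1 - X k by rewrite subr_gt0 Xlt.
rewrite -(pmulr_lgt0 _ d0) h_conv //; case/andP: xk => k1 k2.
have nn1 : 0 <= Y k * (X k.+1 - x) by rewrite mulr_ge0 ?subr_ge0 ?Y_ge0 // ltnW.
have nn2 : 0 <= Y k.+1 * (x - X k) by rewrite mulr_ge0 ?subr_ge0 ?Y_ge0 // ltnW.
have [xk|] := eqVneq x (X k.+1).
  have kn1 : (k.+1 < n)%N.
    by rewrite ltn_neqAle kn andbT; apply/eqP => e; move: xn; rewrite xk e ltxx.
  apply: ltr_wpDl => //; rewrite xk mulr_gt0 //.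
  by apply: Ypos; rewrite ltnS leq0n kn1.
move=> ne; have xlt : x < X k.+1 by rewrite lt_neqAle ne.
have [k0|k0] := posnP k.
  apply: ltr_wpDl => //; rewrite mulr_gt0 ?subr_gt0 // k0 //.
  by apply: Ypos.
by apply: ltr_wpDr => //; rewrite mulr_gt0 ?subr_gt0 //; apply: Ypos; rewrite k0.
Qed.

(** The boundary, the exterior and the interior are where [depth] is zero,
    negative and positive. *)
Definition depth (z : R * R) : R :=
  Num.min (Num.min (z.1 - X 0%N) (X n - z.1)) (Num.min (h z.1 - z.2) z.2).

Lemma depth_ge0 z : (0 <= depth z) = [&& X 0%N <= z.1, z.1 <= X n, z.2 <= h z.1 & 0 <= z.2].
Proof. by rewrite /depth !le_min !subr_ge0 -andbA. Qed.

Lemma depth_gt0 z : (0 < depth z) = [&& X 0%N < z.1, z.1 < X n, z.2 < h z.1 & 0 < z.2].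
Proof. by rewrite /depth !lt_min !subr_gt0 -andbA. Qed.

Lemma boundaryE : boundary W = [set z | depth z = 0].
Proof.
apply/seteqP; split=> z.
  move=> [i /=]; rewrite sizeW ltnS leq_eqVlt => /orP[/eqP ->|i_n] E.
    have {E}[zx z2] := (base_edgeP z).1 E.
    apply/eqP; rewrite eq_le depth_ge0 leNgt depth_gt0 z2 ltxx !andbF /=.
    by rewrite lexx h_ge0 // andbT; case/andP: zx => -> ->.
  have {E}[/andP[z1 z1'] z2] := (edgeP z i_n).1 E.
  have zx0 : X 0%N <= z.1 by apply: le_trans z1; apply: (X_mono Xlt) => //; exact: ltnW.
  have zxn : z.1 <= X n by apply: le_trans z1' _; apply: (X_mono Xlt).
  apply/eqP; rewrite eq_le depth_ge0 leNgt depth_gt0 z2 ltxx !andbF /=.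
  by rewrite lexx h_ge0 // ?zx0 zxn.
move=> /= d0.
have : 0 <= depth z by rewrite d0.
rewrite depth_ge0 => /and4P[z1 z1' zh z2].
have zx : X 0%N <= z.1 <= X n by rewrite z1.
have [z20|z20] := eqVneq z.2 0.
  by exists n; [rewrite /= sizeW|apply/base_edgeP].
have [k kn zk] := locate n0 zx; exists k; first by rewrite /= sizeW; apply: leq_trans kn _.
apply/edgeP => //; split=> //; apply/eqP; rewrite eq_le zh leNgt; apply/negP => zh'.
have zpos : 0 < z.2 by rewrite lt_neqAle eq_sym z20.
(* A point strictly between base and graph can have depth 0 only above an end of the base, and there
   [h] vanishes. *)
have hpos := lt_trans zpos zh'.
have : ~~ (0 < depth z) by rewrite d0 ltxx.
rewrite depth_gt0 zh' zpos !andbT !lt_neqAle z1 z1' !andbT.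
have X0 : X 0%N != z.1.
  by apply/eqP => e; move: hpos; rewrite /h -e hgt_at // Y0 ltxx.
have X1 : z.1 != X n.
  by apply/eqP => e; move: hpos; rewrite /h e hgt_at // Yn ltxx.
by rewrite X0 X1.
Qed.

Lemma continuous_depth : continuous depth.
Proof.
have cst (c : R) : continuous (fun _ : R * R => c) by move=> y; exact: cvg_cst.
have c1 : continuous (fun z : R * R => z.1) by move=> y; exact: cvg_fst.
have c2 : continuous (fun z : R * R => z.2) by move=> y; exact: cvg_snd.
have ch : continuous (fun z : R * R => h z.1).
  by move=> y; apply: continuous_comp; [exact: c1|exact: continuous_hgt].
rewrite /depth; apply: continuous_minr; apply: continuous_minr => //.
- by move=> y; apply: cvgB; [exact: c1|exact: cst].
- by move=> y; apply: cvgB; [exact: cst|exact: c1].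
- by move=> y; apply: cvgB; [exact: ch|exact: c2].
Qed.

Lemma h_bound : exists M, forall x, h x <= M.
Proof.
exists (\sum_(0 <= i < n) `|slope X Y i| * (X i.+1 - X i)) => x.
rewrite /h /hgt big_nat_cond [leRHS]big_nat_cond; apply: ler_sum => i; rewrite andbT => /andP[_ i_n].
have r0 : 0 <= ramp X i x by rewrite /ramp le_max lexx.
have r1 : ramp X i x <= X i.+1 - X i.
  by rewrite /ramp ge_max ge_min lexx orbT andbT subr_ge0 ltW // Xlt.
apply: (@le_trans _ _ (`|slope X Y i| * ramp X i x)).
  by apply: ler_wpM2r => //; exact: ler_norm.
by apply: ler_wpM2l.
Qed.

(** The half-line is connected, misses the boundary and is unbounded, so it makes the component of
    [z] unbounded. *)
Lemma exterior_ray z (d : R * R) : `|d| = 1 ->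
  (forall t, 0 <= t -> ~~ (0 <= depth (z + t *: d))) -> exterior W z.
Proof.
move=> d1 H.
have nb t : 0 <= t -> ~ boundary W (z + t *: d).
  by move=> t0; rewrite boundaryE /= => e; move: (H t t0); rewrite e lexx.
have z0 : z = z + 0 *: d by rewrite scale0r addr0.
split; first by rewrite {1}z0; apply: nb.
move=> [M [Mr /(_ (`|M| + 1))]] bd.
have {}bd : globally (connected_component (~` boundary W) z) [set x | `|x| <= `|M| + 1].
  by apply: bd; rewrite (le_lt_trans (ler_norm M)) // ltrDl.
pose t := `|M| + 1 + `|z| + 1.
have t0 : 0 <= t by rewrite /t !addr_ge0.
have : connected_component (~` boundary W) z (z + t *: d).
  apply: (@connected_component_max _ _ ((fun t => z + t *: d) @` `[0, +oo[)).
  - by exists 0; rewrite /= ?in_itv /= ?lexx // -z0.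
  - by move=> y [s s0 <-]; apply: nb; move: s0; rewrite /= in_itv /= andbT.
  - apply: connected_continuous_connected.
      by apply/connected_intervalP; exact: interval_is_interval.
    apply: continuous_subspaceT => x; apply: cvgD; first exact: cvg_cst.
    by apply: cvgZr_tmp; exact: cvg_id.
  - by exists t => //=; rewrite in_itv /= t0.
move=> /bd /=; apply/negP; rewrite -ltNge.
have : `|t *: d| <= `|z + t *: d| + `|z|.
  by rewrite -{1}[t *: d](addKr z) addrC (le_trans (ler_normB _ _)).
rewrite normrZ d1 mulr1 (ger0_norm t0) /t -lerBlDr addrAC addrK.
by apply: lt_le_trans; rewrite ltrDl.
Qed.

(** Replaces the Jordan curve theorem. A connected set avoiding the boundary keeps the sign of
    [depth] by the intermediate value property, and the points of positive depth lie in a box.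
    Conversely, an inequality of [depth] that is violated stays violated when moving away in one of
    the four axis directions. *)
Lemma exteriorE : exterior W = [set z | depth z < 0].
Proof.
apply/seteqP; split=> z.
  move=> [nb unb] /=; rewrite ltNge; apply/negP => dge.
  have dpos : 0 < depth z.
    by rewrite lt_neqAle dge andbT eq_sym; apply/eqP => e; apply: nb; rewrite boundaryE.
  apply: unb; set C := connected_component _ _.
  have Cpos w : C w -> 0 < depth w.
    move=> Cw; rewrite ltNge; apply/negP => dw.
    have /connected_intervalP itv : connected (depth @` C).
      apply: connected_continuous_connected; first exact: component_connected.
      exact: continuous_subspaceT continuous_depth.
    have Cz : C z by apply: connected_component_refl.
    have i0 : depth w <= 0 <= depth z by rewrite dw ltW.
    have [v Cv dv] := itv (depth w) (depth z) (ex_intro2 _ _ w Cw erefl) (ex_intro2 _ _ z Cz erefl) 0 i0.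
    by have := connected_component_sub Cv; apply; rewrite boundaryE.
  have [M hM] := h_bound.
  exists (Num.max (Num.max `|X 0%N| `|X n|) `|M|); split; first exact: num_real.
  move=> K; rewrite !gt_max => /andP[/andP[K0 Kn] KM] w /Cpos.
  rewrite depth_gt0 => /and4P[w1 w2 w3 w4].
  have := hM w.1; move: K0 Kn KM; rewrite !ltr_norml => /andP[? ?] /andP[? ?] /andP[? ?] ?.
  rewrite /= prod_normE ge_max !ler_norml; apply/andP; split; lra.
rewrite /= ltNge depth_ge0 !negb_and -!ltNge => /or4P[H|H|H|H].
- apply: (@exterior_ray _ (-1, 0)).
    by rewrite prod_normE /= normrN1 normr0; apply/max_idPl.
  move=> t t0; rewrite depth_ge0 /= negb_and -ltNge; apply/orP; left.
  by rewrite /GRing.scale /=; lra.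
- apply: (@exterior_ray _ (1, 0)).
    by rewrite prod_normE /= normr1 normr0; apply/max_idPl.
  move=> t t0; rewrite depth_ge0 /= !negb_and -!ltNge; apply/orP; right; apply/orP; left.
  by rewrite /GRing.scale /=; lra.
- apply: (@exterior_ray _ (0, 1)).
    by rewrite prod_normE /= normr1 normr0; apply/max_idPr.
  move=> t t0; rewrite depth_ge0 !negb_and -!ltNge; do 2 (apply/orP; right); apply/orP; left.
  by rewrite /= scaler0 addr0 /GRing.scale /=; lra.
- apply: (@exterior_ray _ (0, -1)).
    by rewrite prod_normE /= normrN1 normr0; apply/max_idPr.
  move=> t t0; rewrite depth_ge0 !negb_and -!ltNge; do 3 (apply/orP; right).
  by rewrite /= /GRing.scale /=; lra.
Qed.

Lemma regionE : region W = [set z | 0 <= depth z].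
Proof. by rewrite /region exteriorE; apply/seteqP; split=> z /=; rewrite leNgt => /negP. Qed.

Lemma insideE : inside W = [set z | 0 < depth z].
Proof.
rewrite /inside regionE boundaryE; apply/seteqP; split=> z /=.
  by move=> [d0 d1]; rewrite lt_neqAle d0 andbT eq_sym; apply/eqP.
by move=> d0; split; [exact: ltW|move=> e; move: d0; rewrite e ltxx].
Qed.

Lemma visibleP p q : visible W p q <-> (forall z, segment p q z -> 0 <= depth z).
Proof.
rewrite /visible exteriorE; split=> [e z pqz|H].
  by rewrite leNgt; apply/negP => d0; have : set0 z by rewrite -e.
by apply/seteqP; split=> // z [/H /=]; rewrite leNgt => /negP.
Qed.

Lemma X_inj i j : (i <= n)%N -> (j <= n)%N -> X i = X j -> i = j.
Proof.
move=> i_n jn e; case: (ltngtP i j) => // lt.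
  by have := X_smono Xlt lt jn; rewrite e ltxx.
by have := X_smono Xlt lt i_n; rewrite e ltxx.
Qed.

Lemma X_lt i j : (i <= n)%N -> (j <= n)%N -> (X i < X j) = (i < j)%N.
Proof.
move=> i_n jn; case: ltnP => [lt|le]; first exact: (X_smono Xlt).
by apply/negbTE; rewrite -leNgt; apply: (X_mono Xlt).
Qed.

(** Chord and graph are both affine over each edge, so the chord lies below the graph as soon as it
    does at the vertices in between. The inequality compares slopes with cleared denominators. *)
Lemma visible_vertex i j : (i < j)%N -> (j <= n)%N ->
  visible W (X i, Y i) (X j, Y j) <->
  (forall k, (i < k < j)%N -> (Y j - Y i) * (X k - X i) <= (Y k - Y i) * (X j - X i)).
Proof.
move=> ij jn; have i_n : (i <= n)%N by apply: leq_trans jn; apply: ltnW.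
have dX : 0 < X j - X i by rewrite subr_gt0 (X_smono Xlt).
pose chord x := Y i + (Y j - Y i) / (X j - X i) * (x - X i).
have chord_le k : (k <= n)%N -> (chord (X k) <= Y k) = ((Y j - Y i) * (X k - X i) <= (Y k - Y i) * (X j - X i)).
  by move=> kn; rewrite /chord -lerBrDl mulrAC ler_pdivrMr.
rewrite visibleP; split=> [H k /andP[ik kj]|H [x y]].
  have kn : (k <= n)%N by apply: leq_trans jn; apply: ltnW.
  rewrite -chord_le //.
  have /H : segment (X i, Y i) (X j, Y j) (X k, chord (X k)).
    apply/segmentP => /=; first by rewrite X_lt.
    by split=> //; rewrite !(X_mono Xlt) // ltnW.
  by rewrite depth_ge0 /= /h hgt_at // => /and4P[].
move=> /segmentP /=; rewrite X_lt // => /(_ ij) [/andP[x1 x2] yE].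
have xn : X 0%N <= x <= X n by rewrite (le_trans _ x1) ?(X_mono Xlt) //= (le_trans x2) ?(X_mono Xlt).
rewrite depth_ge0 /=; case/andP: (xn) => -> -> /=.
have ends : chord (X i) = Y i /\ chord (X j) = Y j.
  by rewrite /chord subrr mulr0 addr0 divfK ?gt_eqF // addrC subrK.
have y0 : 0 <= y.
  have -> : y = (Y i * (X j - x) + Y j * (x - X i)) / (X j - X i).
    by rewrite yE; field; rewrite gt_eqF.
  by rewrite divr_ge0 ?(ltW dX) // addr_ge0 // mulr_ge0 ?subr_ge0 ?Y_ge0.
rewrite y0 andbT -/(chord x) in yE *; rewrite {}yE {y0 y}.
have [k kn xk] := locate n0 xn.
have chY m : (i <= m <= j)%N -> chord (X m) <= Y m.
  move=> /andP[]; rewrite leq_eqVlt => /orP[/eqP <- _|im]; first by rewrite ends.1.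
  rewrite leq_eqVlt => /orP[/eqP ->|mj]; first by rewrite ends.2.
  by rewrite chord_le ?H ?im // ltnW // (leq_trans mj).
have [e|xi] := eqVneq x (X i); first by rewrite e ends.1 /h hgt_at.
have [e|xj] := eqVneq x (X j); first by rewrite e ends.2 /h hgt_at.
have xi' : X i < x by rewrite lt_neqAle eq_sym xi.
have xj' : x < X j by rewrite lt_neqAle xj.
case/andP: (xk) => k1 k2.
have ik : (i <= k)%N by rewrite -ltnS -X_lt //; apply: lt_le_trans k2.
have kj : (k < j)%N by rewrite -X_lt ?(le_lt_trans k1) // ltnW.
have d0 : 0 < X k.+1 - X k by rewrite subr_gt0 Xlt.
rewrite -(ler_pM2r d0) (h_conv kn xk).
have -> : chord x * (X k.+1 - X k) = chord (X k) * (X k.+1 - x) + chord (X k.+1) * (x - X k).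
  by rewrite /chord; field; rewrite gt_eqF.
by apply: lerD; apply: ler_wpM2r; rewrite ?subr_ge0 // chY // ?ik ?kj ?(ltnW kj) //= (leqW ik).
Qed.

Lemma h_eq0 x : X 0%N <= x <= X n -> h x = 0 -> x = X 0%N \/ x = X n.
Proof.
move=> /andP[x0 xn] hx; have [->|ne0] := eqVneq x (X 0%N); first by left.
have [->|nen] := eqVneq x (X n); first by right.
have : 0 < h x by apply: h_gt0; rewrite !lt_neqAle eq_sym ne0 x0 nen xn.
by rewrite hx ltxx.
Qed.

Lemma hill_simple : simple_polygon R W.
Proof.
split; first by rewrite sizeW.
  apply/(uniqP (0, 0)) => i j; rewrite !inE sizeW !ltnS => i_n jn e.
  apply: X_inj => //; have : vertex R W i = vertex R W j.
    by rewrite /vertex !modn_small ?sizeW ?ltnS // e.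
  by rewrite !vertexW // => -[].
suff H i j : (i < j)%N -> (j <= n)%N -> edge W i `&` edge W j `<=`
    [set vertex R W i; vertex R W i.+1] `&` [set vertex R W j; vertex R W j.+1].
  move=> i j; rewrite sizeW !ltnS => i_n jn; case: (ltngtP i j) => // ij _; first exact: H.
  by rewrite setIC [X in _ `<=` X]setIC; apply: H.
move=> ij jn z [Ei Ej].
have i_n : (i < n)%N by apply: leq_trans jn.
move: Ei => /(edgeP z i_n) [/andP[i1 i2] zh].
move: jn ij Ej; rewrite leq_eqVlt => /orP[/eqP -> _|jn ij].
  move=> /base_edgeP [zn z0].
  have zE x : z.1 = x -> z = (x, 0) by case: (z) z0 => a b /= -> ->.
  have [e|e] := h_eq0 zn (etrans (esym zh) z0).
    have i0 : i = 0%N.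
      by apply/eqP; rewrite -leqn0 leqNgt -(X_lt _ (ltnW i_n)) // -leNgt -e.
    have -> : z = vertex R W 0 by rewrite vertexW // Y0; apply: zE.
    by rewrite i0 vertex_last -(vertexW (leq0n n)); split; [left|right].
  have i0 : i.+1 = n.
    by apply/eqP; rewrite eqn_leq i_n leqNgt -X_lt // -leNgt -e.
  have -> : z = vertex R W n by rewrite vertexW // Yn; apply: zE.
  by rewrite i0; split; [right|left].
move=> /(edgeP z jn) [/andP[j1 j2] _].
have ij1 : i.+1 = j.
  by apply/eqP; rewrite eqn_leq ij leqNgt -X_lt // ?(ltnW jn) // -leNgt (le_trans j1).
have zj : z.1 = X j by apply/eqP; rewrite eq_le j1 -ij1 i2.
have -> : z = vertex R W j.
  rewrite vertexW ?(ltnW jn) // [LHS]surjective_pairing zh zj /h hgt_at //; exact: ltnW.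
by rewrite -ij1; split; [right|left].
Qed.

Lemma hill_terrain : terrain R W.
Proof.
have [a sza na] : exists2 a : seq (R * R), size a = n.+1 & forall i, (i <= n)%N -> nth 0 a i = (X i, Y i).
  by exists (mkseq (fun i => (X i, Y i)) n.+1) => [|i i_n]; rewrite ?size_mkseq ?nth_mkseq.
have polyE : polyline a = [set z | X 0%N <= z.1 <= X n /\ z.2 = h z.1].
  apply/seteqP; split=> z.
    move=> [i /=]; rewrite sza /= => i_n; rewrite !na ?(ltnW i_n) //.
    rewrite -!vertexW ?(ltnW i_n) // -/(edge W i) => /(edgeP z i_n) [/andP[i1 i2] ->].
    by rewrite (le_trans _ i1) ?(X_mono Xlt) ?(ltnW i_n) //= (le_trans i2) ?(X_mono Xlt).
  move=> [zn zh]; have [k kn zk] := locate n0 zn; exists k; first by rewrite /= sza.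
  rewrite /= !na ?(ltnW kn) // -!vertexW ?(ltnW kn) //.
  by apply/edgeP.
have hd : head 0 a = (X 0%N, Y 0%N) by rewrite -nth0 na.
have ls : last 0 a = (X n, Y n) by rewrite -nth_last sza na.
exists a; rewrite hd ls; split.
- apply/(sortedP 0) => i; rewrite sza ltnS => i_n.
  by rewrite !na ?(ltnW i_n) //= Xlt.
- rewrite polyE; apply/seteqP; split=> z /=.
    move=> [[zn zh] z0]; have [e|e] := h_eq0 zn (etrans (esym zh) z0); [left|right];
      by rewrite [LHS]surjective_pairing z0 e ?Y0 ?Yn.
  have X0n : X 0%N <= X n by apply: (X_mono Xlt).
  by move=> [->|->] /=; rewrite ?lexx ?X0n /h hgt_at.
rewrite polyE; apply/seteqP; split=> z.
  move=> [i /=]; rewrite sizeW ltnS leq_eqVlt => /orP[/eqP ->|i_n].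
    by move=> Eb; right; move: Eb; rewrite /edge vertex_last vertexW // segmentC.
  move=> /(edgeP z i_n) [/andP[i1 i2] zh]; left; split=> //.
  by rewrite (le_trans _ i1) ?(X_mono Xlt) ?(ltnW i_n) //= (le_trans i2) ?(X_mono Xlt).
move=> [[zn zh]|E].
  have [k kn zk] := locate n0 zn; exists k; first by rewrite /= sizeW ltnS ltnW.
  by apply/edgeP.
by exists n; rewrite /= ?sizeW // /edge vertex_last vertexW // segmentC.
Qed.

(** The vertex lies on the base, so a direction leading inside has nonnegative vertical component;
    its angle lies between 0 and pi, and monotonicity of the outer measure concludes. *)
Lemma angle_le_pi : (interior_angle W (vertex R W 0%N) <= pi%:E)%E.
Proof.
have pi0 : 0 < pi :> R by exact: pi_gt0.
have -> : (pi%:E : \bar R) = lebesgue_measure (`[0, pi]%classic : set R).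
  by rewrite lebesgue_measure_itv /= lte_fin pi0 -EFinB subr0.
apply: le_outer_measure => a [/andP[a0 a2] near_in].
rewrite /= in_itv /= a0 leNgt; apply/negP => api.
have : \forall t \near 0^'+, 0 < t /\ inside W (vertex R W 0 + t *: (cos a, sin a)).
  by near=> t; split; [near: t; exact: nbhs_right_gt|near: t].
move=> /filter_ex[t [t0]]; rewrite insideE vertexW //= depth_gt0 => /and4P[_ _ _].
rewrite /= Y0 add0r /GRing.scale /= pmulr_rgt0 // => sa.
have : 0 < sin (a - pi) by apply: sin_gt0_pi; apply/andP; split; lra.
by rewrite sinB cospi sinpi mulr0 subr0 mulrN1; lra.
Unshelve. all: by end_near.
Qed.

Section Star.
(** In cross-multiplied form: the slope of the line from vertex 0 to vertex [k] does not increase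
    with [k]. *)
Hypothesis star : forall k, (0 < k < n)%N -> Y k.+1 * (X k - X 0%N) <= Y k * (X k.+1 - X 0%N).

Let ray x := h x / (x - X 0%N).

Lemma ray_piece k x y : (k < n)%N -> X 0%N < x -> X k <= x -> x <= y -> y <= X k.+1 -> ray y <= ray x.
Proof.
move=> kn x0 kx xy yk.
have y0 : X 0%N < y by apply: lt_le_trans xy.
have dk : 0 < X k.+1 - X k by rewrite subr_gt0 Xlt.
have dx : 0 < x - X 0%N by rewrite subr_gt0.
have dy : 0 < y - X 0%N by rewrite subr_gt0.
have hx := @h_conv k x kn; have hy := @h_conv k y kn.
rewrite kx (le_trans xy yk) in hx; rewrite yk (le_trans kx xy) in hy.
rewrite /ray ler_pdivrMr // mulrAC ler_pdivlMr // -(ler_pM2r dk).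
rewrite mulrAC hy // [leRHS]mulrAC hx //.
have st : Y k.+1 * (X k - X 0%N) <= Y k * (X k.+1 - X 0%N).
  have [->|k0] := posnP k; first by rewrite Y0 subrr mulr0 mul0r.
  by apply: star; rewrite k0.
rewrite -subr_ge0.
have -> : (Y k * (X k.+1 - x) + Y k.+1 * (x - X k)) * (y - X 0%N) - (Y k * (X k.+1 - y) + Y k.+1 * (y - X k)) * (x - X 0%N)
  = (y - x) * (Y k * (X k.+1 - X 0%N) - Y k.+1 * (X k - X 0%N)) by ring.
by rewrite mulr_ge0 // subr_ge0.
Qed.

Lemma ray_mono x y : X 0%N < x -> x <= y -> y <= X n -> ray y <= ray x.
Proof.
move=> x0 xy yn.
have [|i i_n /andP[i1 i2]] := @locate R n X x n0; first by rewrite ltW // (le_trans xy).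
have H k : (i < k)%N -> (k <= n)%N -> ray (X k) <= ray x.
  elim: k => // k IH; rewrite ltnS leq_eqVlt => /orP[/eqP <- _|ik kn].
    by apply: (@ray_piece i).
  apply: le_trans (IH ik (ltnW kn)).
  apply: (@ray_piece k) => //; last by apply/ltW/Xlt.
  by apply: (X_smono Xlt) => //; [apply: leq_trans ik|exact: ltnW].
have [|j jn /andP[j1 j2]] := @locate R n X y n0; first by rewrite yn (le_trans (ltW x0)).
have [ij|] := leqP j i.
  have [e|ne] := eqVneq i j; first by apply: (@ray_piece i) => //; rewrite e.
  have ji : (j < i)%N by rewrite ltn_neqAle eq_sym ne.
  have Xji : X j.+1 <= X i by apply: (X_mono Xlt) => //; exact: ltnW.
  by have -> : y = x by apply/eqP; rewrite eq_le xy (le_trans j2) // (le_trans Xji).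
move=> ij; apply: le_trans (H j ij (ltnW jn)).
apply: (@ray_piece j) => //.
by apply: (X_smono Xlt) (ltnW jn); apply: leq_trans ij.
Qed.

(** On the segment from vertex 0 to a point of the region, height over horizontal distance is
    constant, whereas [ray], the same quotient for the graph, does not increase. Being below the
    graph at the far end implies being below it all along. *)
Lemma hill_fan : convex_fan R W.
Proof.
exists 0%N; split; first by rewrite sizeW.
  by rewrite /reflex => /lt_le_trans/(_ angle_le_pi); rewrite ltxx.
rewrite regionE => -[x y] /=; rewrite depth_ge0 /= => /and4P[x0 xn yh y0].
apply/visibleP; rewrite vertexW // Y0 => _ [t /= /andP[t0 t1] <-].
rewrite depth_ge0 /= /GRing.scale /= subr0 add0r.
have dx : 0 <= x - X 0%N by rewrite subr_ge0.
have tx : X 0%N + t * (x - X 0%N) <= x by rewrite -lerBrDl ler_piMl.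
rewrite lerDl mulr_ge0 //= (le_trans tx) //= mulr_ge0 // andbT.
have [e|ne] := eqVneq t 0.
  by rewrite e !mul0r addr0 h_ge0 // lexx (X_mono Xlt).
have [e|nx] := eqVneq x (X 0%N).
  have -> : y = 0 by apply/eqP; rewrite eq_le y0 andbT (le_trans yh) // e /h hgt_at // Y0.
  by rewrite e subrr mulr0 addr0 h_ge0 ?mulr0 // lexx (X_mono Xlt).
have tp : 0 < t by rewrite lt_neqAle eq_sym ne.
have dxp : 0 < x - X 0%N by rewrite subr_gt0 lt_neqAle eq_sym nx.
have := @ray_mono (X 0%N + t * (x - X 0%N)) x.
rewrite ltrDl mulr_gt0 // => /(_ isT tx xn).
rewrite /ray [X 0%N + _]addrC addrK ler_pdivrMr // mulrAC ler_pdivlMr ?mulr_gt0 //.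
rewrite mulrA ler_pM2r // [h x * t]mulrC => le; apply: le_trans le.
by rewrite ler_wpM2l.
Qed.
End Star.
End Polygon.
End HillGeometry.

(** * The hill of a data word: coordinates and visibility *)

Section HillCoordinates.
Import Order.TTheory GRing.Theory Num.Theory.
Import numFieldNormedType.Exports.
Local Open Scope classical_set_scope.

(** Vertex 0 is the mirror image of the last one and sees everything; vertices
    1 to [n] are the first columns, and then pits alternate with columns.  A pit
    has abscissa one past its column and is sunk by just what separates the
    columns up to its letter from those between its letter and itself. *)
Section Coordinates.
Variables (n : nat) (w : seq nat).

Let M := n + size w.
Definition is_pit i := odd (i - n).
Definition column i := minn i n + (i - n)./2.
Definition value i := nth 0 w (i - n)./2.
Definition lastv := n + 2 * size w.

Definition sees i c := (c <= value i) || (column i <= c).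
Definition gadj i j :=
  if is_pit i then (if is_pit j then false else sees i (column j))
  else if is_pit j then sees j (column i) else true.

(** The factor [M.+1] exceeds every column, so the curvature of the parabola outweighs the
    displacement of a pit, one unit in abscissa and less than [2 * M] in height. The shift by [M]
    puts the mirrored vertex at abscissa 0, and the term [M * M] brings both ends to height 0. *)
Definition px i := if i == 0 then 0 else M.+1 * (M + column i) + is_pit i.
Definition py i := if i == 0 then 0 else
  M.+1 * (M * M - column i * column i) - (if is_pit i then column i + value i else 0).

Definition hill : polygon := [seq ((px i)%:R, (py i)%:R) | i <- iota 0 lastv.+1]%R.
End Coordinates.

Section Geometry.
Variables (R : realType) (n : nat) (w : seq nat).
Hypothesis n0 : 0 < n.
Hypothesis wn : forall m, m < size w -> nth 0 w m < n.
Hypothesis w0 : 0 < size w.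

Let M := n + size w.
Let L := lastv n w.
Local Notation col := (column n).
Local Notation pit := (is_pit n).
Local Notation val := (value n w).
Let X i : R := (px n w i)%:R%R.
Let Y i : R := (py n w i)%:R%R.

Lemma size_hill : size (hill n w) = L.+1.
Proof. by rewrite size_map size_iota. Qed.

Lemma vertex_hill i : i <= L -> vertex R (hill n w) i = (X i, Y i).
Proof.
move=> iL; rewrite /vertex size_hill modn_small ?ltnS //.
by rewrite (nth_map 0) ?size_iota ?ltnS // nth_iota ?ltnS //= !ratr_nat.
Qed.

Lemma pit_gt i : pit i -> n < i.
Proof. by rewrite /is_pit; case: ltnP => // le; rewrite (_ : i - n = 0) //; lia. Qed.

Lemma column_pit i : pit i -> i <= L -> n <= col i < M.
Proof.
move=> /[dup] /pit_gt ni; rewrite /is_pit /column /M /L /lastv => pi iL.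
have := odd_double_half (i - n); rewrite pi; lia.
Qed.

Lemma column_le i : i <= L -> col i <= M.
Proof. rewrite /column /M /L /lastv; lia. Qed.

Lemma value_lt i : pit i -> i <= L -> val i < n.
Proof.
move=> pi iL; apply: wn; have := column_pit pi iL; have := pit_gt pi.
rewrite /column /M; lia.
Qed.

Open Scope ring_scope.

Let D : R := (M.+1)%:R.
Let mm : R := M%:R.

(** abscissa on the parabola, the vertex 0 being mirrored to the far left *)
Let q i : R := if i == 0%N then - mm else (col i)%:R.
Let t i : R := (val i)%:R.
Let e i : R := (pit i)%:R.

Lemma DE : D = mm + 1. Proof. by rewrite /D /mm -natr1. Qed.

Lemma pit0 : pit 0 = false. Proof. by rewrite /is_pit sub0n. Qed.

Lemma XE i : X i = D * (q i + mm) + e i.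
Proof.
rewrite /X /px /q /e; case: eqP => [->|_]; first by rewrite pit0 addNr mulr0 addr0.
by rewrite natrD natrM natrD [_ + (col i)%:R]addrC.
Qed.

Lemma q_pit i : pit i -> q i = (col i)%:R.
Proof. by move=> /pit_gt; rewrite /q; case: eqP => // ->. Qed.

(** The subtractions of natural numbers in [py] do not truncate: a pit has a column q < M, and (q +
    1)^2 <= M^2 leaves room for q + t, as t < n <= q. *)
Lemma YE i : (i <= L)%N -> Y i = D * (mm ^+ 2 - q i ^+ 2) - e i * (q i + t i).
Proof.
move=> iL; rewrite /Y /py /q /e; case: eqP => [->|_]; first by rewrite pit0 sqrrN subrr mulr0 mul0r subr0.
have cM := column_le iL.
have cc : (col i * col i <= M * M)%N by rewrite leq_mul.
case pi: (pit i); last by rewrite mul0r subr0 subn0 natrM natrB // !natrM -!expr2.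
have vn := value_lt pi iL; have /andP[nc cM1] := column_pit pi iL.
rewrite natrB.
  by rewrite natrM natrB // [X in _ - X]natrD -[true%:R]/(1%R : R) mul1r !natrM -!expr2.
have : (col i * col i + 2 * col i + 1 <= M * M)%N.
  by apply: (@leq_trans ((col i).+1 * (col i).+1)%N); [lia|exact: leq_mul].
move: vn nc cM1; rewrite -/M; nia.
Qed.

(** positive when the vertex [k] is above the chord from [i] to [j] *)
Definition ori i k j := (Y k - Y i) * (X j - X i) - (Y j - Y i) * (X k - X i).

(** The position of [k] relative to the chord from [i] to [j] is interpolated from those of [a] and
    [b], up to a term telling how far [k] is above the chord from [a] to [b]. *)
Lemma ori_interp i j k a b :
  ori i k j * (X b - X a) = ori i a j * (X b - X k) + ori i b j * (X k - X a) + (X j - X i) * ori a k b.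
Proof. by rewrite /ori; ring. Qed.

Lemma oril i j : ori i i j = 0. Proof. by rewrite /ori !subrr mul0r mulr0 subr0. Qed.
Lemma orir i j : ori i j j = 0. Proof. by rewrite /ori mulrC subrr. Qed.

Lemma D_ge2 : 2 <= D.
Proof. by rewrite /D ler_nat /M; lia. Qed.

Lemma e0 i : ~~ pit i -> e i = 0. Proof. by rewrite /e => /negPf ->. Qed.
Lemma e1 i : pit i -> e i = 1. Proof. by rewrite /e => ->. Qed.

(** A Vandermonde determinant, positive for increasing abscissas: the middle point of a concave
    parabola is above the chord. *)
Lemma ori_bbb i k j : (i <= L)%N -> (k <= L)%N -> (j <= L)%N -> ~~ pit i -> ~~ pit k -> ~~ pit j ->
  ori i k j = D ^+ 2 * (q k - q i) * (q j - q i) * (q j - q k).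
Proof.
move=> iL kL jL /e0 PI /e0 PK /e0 PJ.
by rewrite /ori !YE // !XE PI PK PJ; ring.
Qed.

(** When [k] is the column just before the pit, [q k = q j] and the last factor is [t j - q i]. Its
    sign decides whether the pit sees column [q i] past its neighbour. *)
Lemma ori_bbp i k j : (i <= L)%N -> (k <= L)%N -> (j <= L)%N -> ~~ pit i -> ~~ pit k -> pit j ->
  ori i k j = D * (q k - q i) * (D * (q j - q i) * (q j - q k) - q i - q k + q j + t j).
Proof.
move=> iL kL jL /e0 PI /e0 PK /e1 PJ.
by rewrite /ori !YE // !XE PI PK PJ; ring.
Qed.

Lemma ori_pbb i k j : (i <= L)%N -> (k <= L)%N -> (j <= L)%N -> pit i -> ~~ pit k -> ~~ pit j ->
  ori i k j = D * (q j - q k) * (D * (q k - q i) * (q j - q i) - (q k - q i) - (q j - q i) - q i + t i).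
Proof.
move=> iL kL jL /e1 PI /e0 PK /e0 PJ.
by rewrite /ori !YE // !XE PI PK PJ; ring.
Qed.

Lemma ori_pbp i k j : (i <= L)%N -> (k <= L)%N -> (j <= L)%N -> pit i -> ~~ pit k -> pit j -> q k = q j ->
  ori i k j = D * (q j - q i) * (t j - q i) + t i - (q j - q i) - t j.
Proof.
move=> iL kL jL /e1 PI /e0 PK /e1 PJ qk.
by rewrite /ori !YE // !XE PI PK PJ qk; ring.
Qed.

Lemma ori_bpb i k j : (i <= L)%N -> (k <= L)%N -> (j <= L)%N -> ~~ pit i -> pit k -> ~~ pit j ->
  q i = q k -> q j = q k + 1 -> ori i k j = D * (q k + 1 - t k).
Proof.
move=> iL kL jL /e0 PI /e1 PK /e0 PJ qi qj.
by rewrite /ori !YE // !XE PI PK PJ qi qj; ring.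
Qed.

Lemma mm_ge1 : 1 <= mm.
Proof. by rewrite /mm ler1n /M; lia. Qed.

Lemma q_le i : (i <= L)%N -> q i <= mm.
Proof.
move=> iL; rewrite /q; case: eqP => _; first by have := mm_ge1; lra.
by rewrite ler_nat column_le.
Qed.

Lemma col_base i j : (i < j)%N -> ~~ pit j -> (col i < col j)%N.
Proof.
rewrite /is_pit /column => ij pj.
have := odd_double_half (j - n); have := odd_double_half (i - n); rewrite (negPf pj); lia.
Qed.

Lemma col_pit i j : (i < j)%N -> pit i -> pit j -> (col i < col j)%N.
Proof.
rewrite /is_pit /column => ij pi pj.
have := odd_double_half (j - n); have := odd_double_half (i - n); rewrite pi pj; lia.
Qed.

Lemma q_lt i j : (i < j)%N -> (j <= L)%N -> (col i < col j)%N -> q i + 1 <= q j.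
Proof.
move=> ij jL cc; rewrite /q [j == _]gtn_eqF; last by apply: leq_trans ij.
case: eqP => _; last by rewrite natr1 ler_nat.
have : (1 <= col j)%N by lia.
by rewrite -(ler_nat R) => H; have := mm_ge1; lra.
Qed.

Lemma pit_pred k : pit k -> [/\ (0 < k.-1)%N, ~~ pit k.-1, ~~ pit k.+1 & k.-1.+1 = k].
Proof. by move=> /[dup] /pit_gt nk; rewrite /is_pit; split; lia. Qed.

Lemma q_pred k : pit k -> q k.-1 = q k /\ q k.+1 = q k + 1.
Proof.
move=> /[dup] pk /[dup] /pit_gt nk; rewrite /is_pit => odk.
rewrite /q !gtn_eqF; try lia; rewrite natr1 /column; split; congr (_%:R).
  by have := odd_double_half (k.-1 - n); have := odd_double_half (k - n); lia.
by have := odd_double_half (k.+1 - n); have := odd_double_half (k - n); lia.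
Qed.

Lemma t_lt i : pit i -> (i <= L)%N -> t i + 1 <= q i.
Proof.
move=> pi iL; have := value_lt pi iL; have /andP[nc _] := column_pit pi iL.
by rewrite q_pit // /t natr1 ler_nat => vn; apply: leq_trans nc.
Qed.

Lemma t_ge0 i : 0 <= t i. Proof. exact: ler0n. Qed.
Lemma q_ge0 i : (0 < i)%N -> 0 <= q i.
Proof. by rewrite /q; case: eqP => [->|]. Qed.

Lemma X_lt_hill i : (i < L)%N -> X i < X i.+1.
Proof.
move=> iL; have D2 := D_ge2; rewrite !XE.
case pi: (pit i).
  have [_ _ /e0 -> _] := pit_pred pi; have [_ ->] := q_pred pi.
  rewrite (e1 pi); lra.
rewrite (e0 (negbT pi)); case pi1: (pit i.+1).
  by have [<- _] := q_pred pi1; rewrite (e1 pi1) /= addr0 ltrDl ltr01.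
have qq : q i + 1 <= q i.+1 by apply: q_lt => //; apply: col_base => //; rewrite pi1.
by rewrite (e0 (negbT pi1)) !addr0 ltr_pM2l; lra.
Qed.

Lemma X_le_hill i j : (i < j)%N -> (j <= L)%N -> X i < X j.
Proof. by move=> ij jL; apply: (X_smono (n := L)) => //; exact: X_lt_hill. Qed.

(** Decreasing heights over growing abscissas give the hypothesis [star], hence the fan property. *)
Lemma Y_decr i : (0 < i)%N -> (i < L)%N -> Y i.+1 <= Y i.
Proof.
move=> i0 iL; have D2 := D_ge2; rewrite !YE //; last exact: ltnW.
have q0 := q_ge0 i0.
case pi: (pit i).
  have [_ _ /e0 -> _] := pit_pred pi; have [_ ->] := q_pred pi.
  have := t_lt pi (ltnW iL); rewrite (e1 pi) => ti.
  have : 0 <= (D - 1) * q i by rewrite mulr_ge0 //; lra.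
  by lra.
rewrite (e0 (negbT pi)); case pi1: (pit i.+1).
  have [<- _] := q_pred pi1; rewrite (e1 pi1) /=.
  by have := t_ge0 i.+1; lra.
have qq : q i + 1 <= q i.+1 by apply: q_lt => //; apply: col_base => //; rewrite pi1.
rewrite (e0 (negbT pi1)) !mul0r !subr0 ler_pM2l; last by lra.
by rewrite lerD2l lerN2 ler_sqr ?nnegrE; lra.
Qed.

Lemma pitL : ~~ pit L.
Proof. by rewrite /is_pit /L /lastv addKn oddM. Qed.

Lemma colL : col L = M.
Proof. by rewrite /column /L /lastv addKn mul2n doubleK /M; lia. Qed.

Lemma Y_last : Y L = 0.
Proof.
rewrite YE // (e0 pitL) mul0r subr0 /q colL.
by rewrite (_ : L == 0%N = false) ?subrr ?mulr0 // /L /lastv; lia.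
Qed.

Lemma Y_pos i : (0 < i < L)%N -> 0 < Y i.
Proof.
move=> /andP[i0 iL]; have [pi|bi] := boolP (pit i).
  have [_ bi1 /e0 E _] := pit_pred pi; have [_ q1] := q_pred pi.
  have ti := t_lt pi (ltnW iL); have q0 := q_ge0 i0.
  rewrite YE ?(e1 pi) //; last exact: ltnW.
  have : q i + 1 <= mm by rewrite -q1 q_le.
  have D2 := D_ge2; rewrite -subr_ge0 => H.
  have : 0 <= (mm - (q i + 1)) * (mm + q i + 1) by rewrite mulr_ge0 // ?addr_ge0 // ler0n.
  have : 0 <= (D - 2) * (mm ^+ 2 - q i ^+ 2).
    by rewrite mulr_ge0 ?subr_ge0 // ler_sqr ?nnegrE ?ler0n //; lra.
  by lra.
rewrite YE ?(e0 bi) ?mul0r ?subr0; last exact: ltnW.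
have : q i + 1 <= q L by apply: q_lt => //; apply: col_base => //; exact: pitL.
have := q_le (leqnn L); have := q_ge0 i0; have := D_ge2; have := mm_ge1 => m1 D2 q0 qL qi.
rewrite mulr_gt0 ?subr_gt0 ?ltr_sqr ?nnegrE //; lra.
Qed.

(** By [ori_bpb] a pit lies above the chord joining its two neighbours, so by [ori_interp] it blocks
    nothing that they do not block. Only columns remain to be checked. *)
Lemma ori_bases i j : (i < j)%N -> (j <= L)%N ->
  (forall k, (i < k < j)%N -> ~~ pit k -> 0 <= ori i k j) ->
  forall k, (i < k < j)%N -> 0 <= ori i k j.
Proof.
move=> ij jL H k /[dup] ikj /andP[ik kj]; have [pk|] := boolP (pit k); last exact: H.
have [k0 pk0 pk1 kK] := pit_pred pk; have [q0 q1] := q_pred pk.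
have kL : (k < L)%N by apply: leq_trans jL.
have Xa : X k.-1 < X k by apply: X_le_hill; [lia|exact: ltnW].
have Xb : X k < X k.+1 by apply: X_le_hill.
have A : 0 <= ori i k.-1 j.
  by have [->|ne] := eqVneq k.-1 i; [rewrite oril|apply: H => //; lia].
have B : 0 <= ori i k.+1 j.
  by have [->|ne] := eqVneq k.+1 j; [rewrite orir|apply: H => //; lia].
have C : 0 <= ori k.-1 k k.+1.
  rewrite ori_bpb //; try lia.
  by have := t_lt pk (ltnW kL); have := D_ge2 => D2 tk; rewrite mulr_ge0 //; lra.
have Xij : X i < X j by apply: X_le_hill.
have d : 0 < X k.+1 - X k.-1 by rewrite subr_gt0 (lt_trans Xa).
rewrite -(pmulr_lge0 _ d) ori_interp.
by rewrite !addr_ge0 // mulr_ge0 // subr_ge0 ltW.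
Qed.

Lemma visible_hill i j : (i < j)%N -> (j <= L)%N ->
  (forall k, (i < k < j)%N -> 0 <= ori i k j) <-> gadj n w i j.
Proof.
move=> ij jL; have iL : (i <= L)%N by apply: leq_trans jL; exact: ltnW.
have D2 := D_ge2; have m1 := mm_ge1; have Dm := DE.
have qmono a b : (a < b)%N -> (b <= L)%N -> ~~ pit b -> q a + 1 <= q b.
  by move=> ab bL pb; apply: q_lt => //; exact: col_base.
have kL k : (i < k < j)%N -> (k <= L)%N by move=> /andP[_ kj]; apply: ltnW; apply: leq_trans jL.
rewrite /gadj; have [pi|bi] := boolP (pit i); have [pj|bj] := boolP (pit j).
(* Two pits: the column just left of the second one blocks the view, since the letter of the second
   pit is below [n], hence below the column of the first. *)
- split=> // H; exfalso.
  have [k0 pk0 _ kK] := pit_pred pj; have [q0 _] := q_pred pj.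
  have ik : (i < j.-1)%N.
    by rewrite ltn_neqAle; apply/andP; split; [apply/eqP => ie; move: pk0; rewrite -ie pi|lia].
  have : 0 <= ori i j.-1 j by apply: H; rewrite ik; lia.
  rewrite ori_pbp //; last by lia.
  have tj : t j < q i.
    rewrite (q_pit pi) /t ltr_nat; have := value_lt pj jL; have /andP[nc _] := column_pit pi iL.
    by move=> /leq_trans; apply.
  have ti := t_lt pi iL; have qij : q i + 1 <= q j by apply: q_lt => //; exact: col_pit.
  (* [lra] treats products as atoms, so the nonlinear estimate is supplied as a product of
     nonnegative factors; likewise in the other cases. *)
  have : 0 <= (D * (q j - q i) - 1) * (q i - t j - 1).
    have : t j + 1 <= q i.
      by move: tj; rewrite (q_pit pi) /t ltr_nat natr1 ler_nat.
    move=> tji; rewrite mulr_ge0 //; last by lra.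
    have : 0 <= (D - 2) * (q j - q i) by rewrite mulr_ge0; lra.
    by lra.
  have : 0 <= (D - 1) * (q j - q i) by rewrite mulr_ge0; lra.
  have := q_le iL; lra.
- rewrite /sees orbC (_ : (col i <= col j)%N); last by rewrite ltnW // col_base.
  split=> // _; apply: ori_bases => // k ikj pk; rewrite ori_pbb // ?kL //.
  case/andP: (ikj) => ik kj.
  have q1 := qmono _ _ ik (kL _ ikj) pk; have q2 := qmono _ _ kj jL bj.
  have q3 := q_le jL; have ti := t_ge0 i.
  have q4 : 0 <= q i by apply: q_ge0; have := pit_gt pi; lia.
  rewrite mulr_ge0 //; first by rewrite mulr_ge0; lra.
  have : 0 <= (q k - q i - 1) * (q j - q i - 1) by rewrite mulr_ge0; lra.
  have : 0 <= mm * ((q k - q i) * (q j - q i) - 1).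
    rewrite mulr_ge0; try lra.
    have : 0 <= (q k - q i - 1) * (q j - q i - 1) by rewrite mulr_ge0; lra.
    by lra.
  by rewrite Dm; lra.
- rewrite /sees; have [pk|] := leqP (col i) (val j).
    split=> // _; apply: ori_bases => // k ikj pik; rewrite ori_bbp // ?kL //.
    case/andP: (ikj) => ik kj.
    have q1 := qmono _ _ ik (kL _ ikj) pik.
    have q2 : q k <= q j.
      have [k0 pj0 _ jJ] := pit_pred pj; have [<- _] := q_pred pj.
      have [->//|ne] := eqVneq k j.-1.
      by have := qmono k j.-1; rewrite pj0 => /(_ _ _ isT) H; have := H ltac:(lia) ltac:(lia); lra.
    have qt : q i <= t j.
      by rewrite /q /t; case: eqP => _; [have := ler0n R (val j); lra|rewrite ler_nat].
    rewrite mulr_ge0 //; first by rewrite mulr_ge0; lra.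
    have : 0 <= D * (q j - q i) * (q j - q k) by rewrite !mulr_ge0; lra.
    by lra.
  (* A column vertex before the pit whose column is not smaller is its immediate neighbour. Strictly
     between the letter and the column of the pit, the neighbour [j.-1] is the obstacle. *)
  move=> vi; have [cji|] := leqP (col j) (col i).
    split=> // _ k ikj; exfalso.
    have [k0 pj0 _ jJ] := pit_pred pj.
    have ij1 : i <> j.-1 by lia.
    have := @col_base i j.-1; rewrite pj0 => /(_ _ isT).
    have : (col j.-1 <= col j)%N by rewrite /column; lia.
    lia.
  move=> cij; split=> // H; exfalso.
  have [k0 pj0 _ jJ] := pit_pred pj; have [qj _] := q_pred pj.
  have ik : (i < j.-1)%N.
    rewrite ltn_neqAle; apply/andP; split; last lia.
    apply/eqP => ie; move: cij; rewrite ltnNge => /negP; apply.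
    have i0 : (0 < i)%N by rewrite ie.
    have : q i = q j by rewrite ie.
    rewrite /q !gtn_eqF //; last by lia.
    by move=> /eqP; rewrite eqr_nat => /eqP ->.
  have : 0 <= ori i j.-1 j by apply: H; rewrite ik; lia.
  rewrite ori_bbp //; last by lia.
  have q1 : q i + 1 <= q j.-1 by apply: qmono => //; lia.
  have ti : t j + 1 <= q i.
    rewrite /q; case: eqP => [i0|_]; last by rewrite /t natr1 ler_nat.
    by move: vi; rewrite i0 /column min0n sub0n ltn0.
  rewrite qj subrr mulr0 sub0r pmulr_rge0; last by rewrite mulr_gt0; lra.
  by lra.
- split=> // _; apply: ori_bases => // k ikj pk; rewrite ori_bbb // ?kL //.
  case/andP: (ikj) => ik kj.
  have q1 := qmono _ _ ik (kL _ ikj) pk; have q2 := qmono _ _ kj jL bj.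
  by rewrite !mulr_ge0 // ?exprn_ge0; lra.
Qed.

Lemma L_gt1 : (1 < L)%N. Proof. by rewrite /L /lastv; lia. Qed.

Lemma Y_first : Y 0 = 0. Proof. by rewrite /Y /py. Qed.

Lemma gadjC i j : gadj n w i j = gadj n w j i.
Proof. by rewrite /gadj; case: (pit i); case: (pit j). Qed.

Lemma hill_vertex_visible i j : (i < j)%N -> (j <= L)%N ->
  visible (hill n w) (vertex R (hill n w) i) (vertex R (hill n w) j) <-> gadj n w i j.
Proof.
move=> ij jL; rewrite !vertex_hill //; last by apply: leq_trans jL; exact: ltnW.
rewrite (visible_vertex X_lt_hill Y_first Y_last (fun i => @Y_pos i) L_gt1 size_hill vertex_hill ij jL).
rewrite -visible_hill //; split=> H k kij.
  by rewrite /ori subr_ge0; apply: H.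
by have := H k kij; rewrite /ori subr_ge0.
Qed.

Lemma hill_graph (i j : 'I_(size (hill n w))) : visibility_graph R i j = (i != j) && gadj n w i j.
Proof.
have le (k : 'I_(size (hill n w))) : (k <= L)%N by rewrite -ltnS -size_hill.
have iL := le i; have jL := le j.
rewrite /visibility_graph; case: (eqVneq i j) => //= ne; apply/asboolP/idP.
  have /orP[ij|ji] : (i < j)%N || (j < i)%N by rewrite -neq_ltn.
    by move=> H; apply/hill_vertex_visible.
  by move=> H; rewrite gadjC; apply/hill_vertex_visible => //; move: H; rewrite /visible segmentC.
have /orP[ij|ji] : (i < j)%N || (j < i)%N by rewrite -neq_ltn.
  by move=> H; apply/hill_vertex_visible.
by rewrite gadjC => H; rewrite /visible segmentC; apply/hill_vertex_visible.
Qed.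

Lemma hill_polygon : [/\ simple_polygon R (hill n w), terrain R (hill n w) & convex_fan R (hill n w)].
Proof.
split.
- exact: (hill_simple X_lt_hill Y_first Y_last (fun i => @Y_pos i) L_gt1 size_hill vertex_hill).
- exact: (hill_terrain X_lt_hill Y_first Y_last (fun i => @Y_pos i) L_gt1 size_hill vertex_hill).
apply: (hill_fan X_lt_hill Y_first Y_last (fun i => @Y_pos i) L_gt1 size_hill vertex_hill).
move=> k /andP[k0 kL].
have a1 := Y_decr k0 kL; have a2 := X_lt_hill kL.
have a3 : 0 <= X k - X 0%N by rewrite subr_ge0 ltW // X_le_hill // ltnW.
have a4 : 0 <= Y k by rewrite ltW // Y_pos // k0.
apply: (@le_trans _ _ (Y k * (X k - X 0%N))); first by rewrite ler_wpM2r.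
by rewrite ler_wpM2l // lerD2r ltW.
Qed.
End Geometry.
End HillCoordinates.

(** * Formulas on data words *)

(** Variables range over the positions of a word of numbers, [DLt] compares
    positions and [DLe] compares the numbers found there. *)
Inductive df :=
| DLt of nat & nat
| DLe of nat & nat
| DNot of df
| DAnd of df & df
| DOr of df & df
| DEx of nat & df
| DAll of nat & df.

Fixpoint dfree (phi : df) : seq nat :=
  match phi with
  | DLt i j | DLe i j => [:: i; j]
  | DNot f => dfree f
  | DAnd f g | DOr f g => dfree f ++ dfree g
  | DEx i f | DAll i f => [seq j <- dfree f | j != i]
  end.

Fixpoint dholds (w : seq nat) (s : nat -> nat) (phi : df) : bool :=
  match phi with
  | DLt i j => s i < s j
  | DLe i j => nth 0 w (s i) <= nth 0 w (s j)
  | DNot f => ~~ dholds w s f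
  | DAnd f g => dholds w s f && dholds w s g
  | DOr f g => dholds w s f || dholds w s g
  | DEx i f => [exists m : 'I_(size w), dholds w (upd s i (m : nat)) f]
  | DAll i f => [forall m : 'I_(size w), dholds w (upd s i (m : nat)) f]
  end.

(** The variables 9 and 1 are kept for the first and the last pit, and 2 and 3
    for the vertices met when translating atomic formulas. *)
Definition reserved := [:: 1; 2; 3; 9].

Fixpoint dvars_ok (phi : df) : bool :=
  match phi with
  | DLt i j | DLe i j => (i != 2) && (j != 2)
  | DNot f => dvars_ok f
  | DAnd f g | DOr f g => dvars_ok f && dvars_ok g
  | DEx i f | DAll i f => (i \notin reserved) && dvars_ok f
  end.

(** The pits are the vertices whose neighbours form a clique.  The last pit
    (variable 1) sees the first [n] columns, so that a vertex seen from [x] but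
    neither from [y] nor from the last pit lies between [x] and [y].  The first
    pit (variable 9) sees all later columns, so that away from its neighbours a
    pit sees just the columns up to its letter.  If the two extreme pits were
    exchanged, no two letters would compare as equal: [f_ident] excludes it. *)
Definition f_tok x := FOAnd (FONot (FOAdj x 9)) (FONot (FOAdj x 1)).
Definition f_lt x y := FOEx 2 (FOAnd (FOAdj 2 x) (FOAnd (FONot (FOAdj 2 y)) (FONot (FOAdj 2 1)))).
Definition f_le x y := FOAll 2 (FOOr (FOAdj 2 9) (FOOr (FONot (FOAdj 2 x)) (FOAdj 2 y))).
Definition f_pit x := FOAll 2 (FOAll 3 (FOOr (FONot (FOAdj 2 x)) (FOOr (FONot (FOAdj 3 x))
  (FOOr (FOEq 2 3) (FOAdj 2 3))))).
Definition f_ident := FOAnd (f_pit 9) (FOAnd (f_pit 1)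
  (FOAnd (FOAll 4 (FOOr (FOAdj 4 9) (FOOr (FOAdj 4 1) (f_pit 4))))
    (FOEx 5 (FOEx 6 (FOAnd (FONot (FOEq 5 6)) (FOAnd (f_tok 5) (FOAnd (f_tok 6)
      (FOAnd (f_le 5 6) (f_le 6 5))))))))).

Fixpoint df_fo (phi : df) : fo :=
  match phi with
  | DLt i j => f_lt i j
  | DLe i j => f_le i j
  | DNot f => FONot (df_fo f)
  | DAnd f g => FOAnd (df_fo f) (df_fo g)
  | DOr f g => FOOr (df_fo f) (df_fo g)
  | DEx i f => FOEx i (FOAnd (f_tok i) (df_fo f))
  | DAll i f => FOAll i (FOOr (FONot (f_tok i)) (df_fo f))
  end.

Definition df_sentence (phi : df) : fo := FOEx 9 (FOEx 1 (FOAnd f_ident (df_fo phi))).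

Lemma fo_free_df phi : {subset fo_free (df_fo phi) <= [:: 9, 1 & dfree phi]}.
Proof.
have tok i : {subset fo_free (f_tok i) <= [:: 9; 1; i]}.
  by move=> x; rewrite /= !inE => /or4P[] ->; rewrite ?orbT.
elim: phi => [i j|i j|f IH|f IHf g IHg|f IHf g IHg|i f IH|i f IH] x.
- by rewrite /=; case: (i =P 2) => _; case: (j =P 2) => _ /=; rewrite !inE; do ?[case/orP => [->|]]; rewrite ?orbT // => ->; rewrite ?orbT.
- by rewrite /=; case: (i =P 2) => _; case: (j =P 2) => _ /=; rewrite !inE; do ?[case/orP => [->|]]; rewrite ?orbT // => ->; rewrite ?orbT.
- exact: IH.
- rewrite /= mem_cat => /orP[/IHf|/IHg]; rewrite !inE mem_cat => /or3P[] ->; rewrite ?orbT //.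
- rewrite /= mem_cat => /orP[/IHf|/IHg]; rewrite !inE mem_cat => /or3P[] ->; rewrite ?orbT //.
- rewrite [dfree _]/= -[fo_free _]/([seq j <- fo_free (f_tok i) ++ fo_free (df_fo f) | j != i]).
  rewrite mem_filter => /andP[xi]; rewrite mem_cat => /orP[/tok|/IH]; rewrite !inE mem_filter (negPf xi) ?orbF.
    by move=> /orP[] ->; rewrite ?orbT.
  by [].
- rewrite [dfree _]/= -[fo_free _]/([seq j <- fo_free (f_tok i) ++ fo_free (df_fo f) | j != i]).
  rewrite mem_filter => /andP[xi]; rewrite mem_cat => /orP[/tok|/IH]; rewrite !inE mem_filter (negPf xi) ?orbF.
    by move=> /orP[] ->; rewrite ?orbT.
  by [].
Qed.

Lemma df_sentenceP phi : {subset dfree phi <= [:: 9]} -> sentence (df_sentence phi).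
Proof.
move=> H; rewrite /sentence /df_sentence.
rewrite -[fo_free _]/([seq j <- [seq j <- fo_free f_ident ++ fo_free (df_fo phi) | j != 1] | j != 9]).
apply/eqP; rewrite -size_eq0 -filter_predI size_filter -leqn0 leqNgt -has_count.
apply/hasPn => x; rewrite mem_cat => xf /=; rewrite -negb_or negbK.
have /allP idf : all (fun x => (x == 9) || (x == 1)) (fo_free f_ident) by [].
case/orP: xf => [/idf //|/fo_free_df].
by rewrite !inE => /or3P[->|->|/H]; rewrite ?orbT // inE => ->.
Qed.

(** * Recovering the data word from the visibility graph *)

Section Semantics.
Variables (n : nat) (w : seq nat).
Hypothesis n1 : 1 < n.
Hypothesis wn : forall m, m < size w -> nth 0 w m < n.
Hypothesis w1 : 1 < size w.
(** With letter 0 the first pit sees column 0 and all columns from [n] on; with letter [n.-1], found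
    nowhere else, the last pit sees the first [n] columns. So the two together see every column,
    which no other pair of pits does; the tie serves to order them. *)
Hypothesis w0 : nth 0 w 0 = 0.
Hypothesis w_last : forall m, m < size w -> (nth 0 w m == n.-1) = (m == (size w).-1).
Hypothesis w_tie : exists2 m, 0 < m < size w & nth 0 w m = 0.
Variable (N : nat).
Hypothesis NE : N = (lastv n w).+1.
Variable (e : rel 'I_N).
Hypothesis eE : forall i j, e i j = (i != j) && gadj n w i j.

Let K := size w.
Notation V := 'I_N.
Notation pit := (is_pit n).
Definition pos (v : nat) := (v - n)./2.
Let bcol c := if c <= n then c else n + 2 * (c - n).

Lemma vertex_lt (v : V) : v <= n + 2 * K.
Proof. by rewrite -ltnS; have := ltn_ord v; rewrite {2}NE /lastv. Qed.

Lemma pitN m : m < K -> n + 1 + 2 * m < N. Proof. by rewrite NE /lastv /K; lia. Qed.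

Definition pitv m : V := insubd (Ordinal (eq_ind_r (fun k => 0 < k) (ltn0Sn _) NE)) (n + 1 + 2 * m).

Lemma val_pitv m : m < K -> pitv m = n + 1 + 2 * m :> nat.
Proof. by move=> mK; rewrite /pitv /= val_insubd pitN. Qed.

Lemma is_pit_pitv m : m < K -> pit (pitv m).
Proof. by move=> mK; rewrite /is_pit val_pitv //; lia. Qed.

Lemma pos_pitv m : m < K -> pos (pitv m) = m.
Proof. by move=> mK; rewrite /pos val_pitv //; lia. Qed.

Lemma pitvK (v : V) : pit v -> pos v < K /\ v = pitv (pos v).
Proof.
move=> pv; have := vertex_lt v; move: (pv); rewrite /is_pit => od le.
have p : pos v < K by rewrite /pos; lia.
by split=> //; apply/val_inj; rewrite /= val_pitv // /pos; lia.
Qed.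

Lemma bcolN c : c <= n + K -> bcol c < N. Proof. by move=> cK; rewrite NE /lastv /bcol; case: (leqP c n); rewrite /K in cK *; lia. Qed.

Definition basev c : V := insubd (Ordinal (eq_ind_r (fun k => 0 < k) (ltn0Sn _) NE)) (bcol c).

Lemma val_basev c : c <= n + K -> basev c = bcol c :> nat.
Proof. by move=> mK; rewrite /basev /= val_insubd bcolN. Qed.

Lemma pit_basev c : c <= n + K -> pit (basev c) = false.
Proof. by move=> cK; rewrite /is_pit val_basev // /bcol; case: (leqP c n); lia. Qed.

Lemma column_basev c : c <= n + K -> column n (basev c) = c.
Proof. by move=> cK; rewrite /column val_basev // /bcol; case: (leqP c n); lia. Qed.

Lemma adj_pp (x y : V) : pit x -> pit y -> e x y = false.
Proof. by move=> px py; rewrite eE /gadj px py andbF. Qed.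

Lemma adj_bb (x y : V) : ~~ pit x -> ~~ pit y -> e x y = (x != y).
Proof. by move=> /negPf px /negPf py; rewrite eE /gadj px py andbT. Qed.

Lemma adj_bp (x y : V) : ~~ pit x -> pit y ->
  e x y = (column n x <= nth 0 w (pos y)) || (n + pos y <= column n x).
Proof.
move=> px py; rewrite eE /gadj (negPf px) py /sees /value /pos.
have -> : x != y by apply: contraNneq px => ->.
rewrite /=; congr (_ || _); congr (_ <= _).
by move: py; rewrite /is_pit /column; lia.
Qed.

Lemma adjC (x y : V) : e x y = e y x.
Proof. by rewrite !eE eq_sym gadjC. Qed.

Lemma holds_pit s x : x \notin [:: 2; 3] -> fo_holds e s (f_pit x) = pit (s x).
Proof.
rewrite !inE negb_or => /andP[/negPf x2 /negPf x3].
rewrite /= /upd /= ?x2 ?x3; have [px|bx] := boolP (pit (s x)).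
  apply/forallP => y; apply/forallP => z.
  case ey: (e y (s x)) => //=; case ez: (e z (s x)) => //=.
  have py : ~~ pit y by apply/negP => py; rewrite adj_pp in ey.
  have pz : ~~ pit z by apply/negP => pz; rewrite adj_pp in ez.
  by rewrite adj_bb //; case: (y == z).
apply/negbTE/forallPn.
have Kp : 0 < K by rewrite /K; lia.
have K1 : K.-1 < K by rewrite prednK.
have bn1 : n.-1 <= n + K by lia.
(* A column vertex has two nonadjacent neighbours: left of column [n], the last pit and column [n];
   from [n] on, the first pit and column 1. *)
have [xn|nx] := ltnP (column n (s x)) n.
  exists (pitv K.-1); apply/forallPn; exists (basev n).
  rewrite /= [e _ (s x)]adjC adj_bp ?is_pit_pitv // pos_pitv //.
  have -> : nth 0 w K.-1 = n.-1 by apply/eqP; rewrite w_last.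
  rewrite (_ : column n (s x) <= n.-1) /=; last by lia.
  have bn : n <= n + K by lia.
  rewrite adj_bb ?pit_basev // (_ : basev n != s x) /=; last first.
    by apply: contraTneq xn => <-; rewrite column_basev // ltnn.
  rewrite [e _ (basev n)]adjC adj_bp ?is_pit_pitv ?pit_basev // pos_pitv // column_basev //.
  have -> : nth 0 w K.-1 = n.-1 by apply/eqP; rewrite w_last.
  rewrite negb_or; apply/andP; split; last by rewrite /K; lia.
  by apply: contraTneq (is_pit_pitv K1) => ->; rewrite pit_basev.
exists (pitv 0); apply/forallPn; exists (basev 1).
have b1 : 1 <= n + K by lia.
rewrite /= [e _ (s x)]adjC adj_bp ?is_pit_pitv // pos_pitv // w0 addn0 nx orbT /=.
rewrite adj_bb ?pit_basev // (_ : basev 1 != s x) /=; last first.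
  by apply: contraTneq nx => <-; rewrite column_basev // -ltnNge.
rewrite [e _ (basev 1)]adjC adj_bp ?is_pit_pitv ?pit_basev // pos_pitv // column_basev // w0.
rewrite negb_or; apply/andP; split; last by lia.
by apply: contraTneq (is_pit_pitv Kp) => ->; rewrite pit_basev.
Qed.

Definition framed (s : nat -> V) := s 9 = pitv 0 /\ s 1 = pitv K.-1.

Let K0 : 0 < K. Proof. by rewrite /K; lia. Qed.
Let K1 : K.-1 < K. Proof. by rewrite prednK. Qed.

Lemma wK : nth 0 w K.-1 = n.-1. Proof. by apply/eqP; rewrite w_last. Qed.

Lemma covered (x : V) : ~~ pit x -> e x (pitv 0) || e x (pitv K.-1).
Proof.
move=> px; rewrite !adj_bp ?is_pit_pitv // !pos_pitv // w0 wK.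
by lia.
Qed.

Lemma holds_tok s x : s 9 = pitv 0 /\ s 1 = pitv K.-1 \/ s 9 = pitv K.-1 /\ s 1 = pitv 0 ->
  fo_holds e s (f_tok x) = pit (s x).
Proof.
move=> H; rewrite /= -negb_or.
have -> : e (s x) (s 9) || e (s x) (s 1) = e (s x) (pitv 0) || e (s x) (pitv K.-1).
  by case: H => -[-> ->] //; rewrite orbC.
have [px|px] := boolP (pit (s x)); last by rewrite covered.
by rewrite !adj_pp // is_pit_pitv.
Qed.

Lemma holds_lt s x y : framed s -> x != 2 -> y != 2 -> pit (s x) -> pit (s y) ->
  fo_holds e s (f_lt x y) = (pos (s x) < pos (s y)).
Proof.
move=> [_ s1] x2 y2 px py; rewrite /= /upd /= (negPf x2) (negPf y2) /=.
have [xK _] := pitvK px; have [yK _] := pitvK py.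
have Wx := wn xK; have Wy := wn yK.
apply/existsP/idP.
  move=> [c /and3P[cx cy cz]].
  have pc : ~~ pit c by apply/negP => pc; rewrite adj_pp in cx.
  move: cx cy cz; rewrite !adj_bp // ?s1 ?is_pit_pitv // pos_pitv // wK.
  by move: Wx Wy xK yK; rewrite -/K; lia.
(* The column of [x] itself: beyond the letter of [y], and too far left to be on the other side of
   [y] or of the last pit. *)
move=> xy; exists (basev (n + pos (s x))).
have bK : n + pos (s x) <= n + K by rewrite leq_add2l ltnW.
rewrite !adj_bp ?s1 ?is_pit_pitv ?pit_basev // pos_pitv // wK column_basev //.
by move: Wx Wy xK yK; rewrite -/K; lia.
Qed.

Lemma holds_le s x y : s 9 = pitv 0 -> x != 2 -> y != 2 -> pit (s x) -> pit (s y) ->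
  fo_holds e s (f_le x y) = (nth 0 w (pos (s x)) <= nth 0 w (pos (s y))).
Proof.
move=> s9 x2 y2 px py; rewrite /= /upd /= (negPf x2) (negPf y2) /=.
have [xK _] := pitvK px; have [yK _] := pitvK py.
have Wx := wn xK; have Wy := wn yK.
apply/forallP/idP => [H|le c].
  have cK : nth 0 w (pos (s x)) <= n + K by lia.
  (* The letter of [x] is the last column it sees on its left. If that is column 0, it is adjacent
     to the first pit, and the inequality is trivial. *)
  have := H (basev (nth 0 w (pos (s x)))).
  rewrite !adj_bp ?s9 ?is_pit_pitv ?pit_basev // pos_pitv // w0 column_basev //.
  by move: Wx Wy xK yK; rewrite -/K; lia.
have [pc|bc] := boolP (pit c); first by rewrite (adj_pp pc px) orbT.
rewrite !adj_bp ?s9 ?is_pit_pitv // pos_pitv // w0.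
by move: Wx Wy xK yK; rewrite -/K; lia.
Qed.

Lemma holds_df phi s : framed s -> dvars_ok phi -> (forall x, x \in dfree phi -> pit (s x)) ->
  fo_holds e s (df_fo phi) = dholds w (pos \o s) phi.
Proof.
elim: phi s => [i j|i j|f IH|f IHf g IHg|f IHf g IHg|i f IH|i f IH] s fs /=.
- by move=> /andP[i2 j2] H; apply: holds_lt => //; apply: H; rewrite !inE eqxx ?orbT.
- by move=> /andP[i2 j2] H; apply: holds_le => //; [exact: fs.1|apply: H..]; rewrite !inE eqxx ?orbT.
- by move=> ok H; rewrite IH.
- by move=> /andP[okf okg] H; rewrite IHf ?IHg // => x xf; apply: H; rewrite mem_cat xf ?orbT.
- by move=> /andP[okf okg] H; rewrite IHf ?IHg // => x xf; apply: H; rewrite mem_cat xf ?orbT.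
- move=> /andP[ir ok] H.
  have fr v : framed (upd s i v).
    move: ir; rewrite !inE !negb_or => /and4P[i1 _ _ i9].
    by split; rewrite upd_diff //; [exact: fs.1|exact: fs.2].
  have pf (v : V) : pit v -> forall x, x \in dfree f -> pit (upd s i v x).
    move=> pv x xf; rewrite /upd; case: eqP => // /eqP xi.
    by apply: H; rewrite mem_filter xi.
  have tokE (v : V) : fo_holds e (upd s i v) (f_tok i) = pit v.
    by rewrite holds_tok ?upd_same //; left; exact: fr.
  have stepE (v : V) : pit v -> fo_holds e (upd s i v) (df_fo f) = dholds w (upd (pos \o s) i (pos v)) f.
    move=> pv; rewrite IH //; last exact: pf.
    by congr dholds; apply/funext => x; rewrite /= /upd; case: eqP.
  rewrite -[LHS]/([exists v, fo_holds e (upd s i v) (f_tok i) && fo_holds e (upd s i v) (df_fo f)]).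
  apply/existsP/existsP => [[v /andP[]]|[m hm]].
    rewrite tokE => pv; rewrite stepE // => hv.
    by have [vK _] := pitvK pv; exists (Ordinal vK).
  exists (pitv m); rewrite tokE is_pit_pitv //=.
  by rewrite stepE ?is_pit_pitv // pos_pitv.
- move=> /andP[ir ok] H.
  have fr v : framed (upd s i v).
    move: ir; rewrite !inE !negb_or => /and4P[i1 _ _ i9].
    by split; rewrite upd_diff //; [exact: fs.1|exact: fs.2].
  have pf (v : V) : pit v -> forall x, x \in dfree f -> pit (upd s i v x).
    move=> pv x xf; rewrite /upd; case: eqP => // /eqP xi.
    by apply: H; rewrite mem_filter xi.
  have tokE (v : V) : fo_holds e (upd s i v) (f_tok i) = pit v.
    by rewrite holds_tok ?upd_same //; left; exact: fr.
  have stepE (v : V) : pit v -> fo_holds e (upd s i v) (df_fo f) = dholds w (upd (pos \o s) i (pos v)) f.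
    move=> pv; rewrite IH //; last exact: pf.
    by congr dholds; apply/funext => x; rewrite /= /upd; case: eqP.
  rewrite -[LHS]/([forall v, ~~ fo_holds e (upd s i v) (f_tok i) || fo_holds e (upd s i v) (df_fo f)]).
  apply/forallP/forallP => [hm m|hm v].
    have := hm (pitv m); rewrite tokE is_pit_pitv //=.
    by rewrite stepE ?is_pit_pitv // pos_pitv.
  rewrite tokE; have [pv|//] := boolP (pit v).
  by have [vK _] := pitvK pv; rewrite stepE //=; exact: (hm (Ordinal vK)).
Qed.

Lemma holds_ident s : fo_holds e s f_ident <-> framed s.
Proof.
split.
  rewrite /f_ident -[fo_holds _ _ _]/([&& fo_holds e s (f_pit 9), fo_holds e s (f_pit 1),
    [forall v, [|| fo_holds e (upd s 4 v) (FOAdj 4 9), fo_holds e (upd s 4 v) (FOAdj 4 1) | fo_holds e (upd s 4 v) (f_pit 4)]] &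
    [exists v, [exists u, let s' := upd (upd s 5 v) 6 u in
      [&& ~~ (s' 5 == s' 6), fo_holds e s' (f_tok 5), fo_holds e s' (f_tok 6),
          fo_holds e s' (f_le 5 6) & fo_holds e s' (f_le 6 5)]]]]).
  rewrite !holds_pit // => /and4P[p9 p1 /forallP cov /existsP[v /existsP[u]]].
  have [k9 e9] := pitvK p9; have [k1 e1] := pitvK p1.
  have cv c : c <= n + K -> (c <= nth 0 w (pos (s 9))) || (n + pos (s 9) <= c) ||
        (c <= nth 0 w (pos (s 1))) || (n + pos (s 1) <= c).
    move=> cK; have := cov (basev c); rewrite holds_pit // upd_same pit_basev //= orbF.
    by rewrite /upd /= !adj_bp ?pit_basev // column_basev // orbA.
  have W9 := wn k9; have W1 := wn k1.
  have c1 : n.-1 <= n + K by lia.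
  have c2 : n <= n + K by lia.
  (* Among pits, only the last one sees column [n.-1] and only the first one sees column [n]:
     covering these two columns identifies the pair up to order. *)
  have H1 : (pos (s 9) == K.-1) || (pos (s 1) == K.-1).
    by have := cv _ c1; have := w_last k9; have := w_last k1; rewrite /K in k9 k1 *; lia.
  have H2 : (pos (s 9) == 0) || (pos (s 1) == 0) by have := cv _ c2; lia.
  have K2 : 1 < K by [].
  have [e0|ne0] := eqVneq (pos (s 9)) 0.
    move=> _; split; first by rewrite e9 e0.
    by rewrite e1; congr pitv; apply/eqP; move: H1; rewrite e0; lia.
  have e91 : s 9 = pitv K.-1 /\ s 1 = pitv 0.
    rewrite e9 e1; move: H1 H2; rewrite (negPf ne0) /= => H1 /eqP E; move: H1; rewrite E.
    by rewrite orbC (_ : (0 == K.-1) = false) /=; [move=> /eqP ->|lia].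
  pose s' := upd (upd s 5 v) 6 u => body.
  have {body} : [&& ~~ (s' 5 == s' 6), fo_holds e s' (f_tok 5), fo_holds e s' (f_tok 6),
     fo_holds e s' (f_le 5 6) & fo_holds e s' (f_le 6 5)] := body.
  rewrite !(@holds_tok s'); try (by right); move=> /and5P[uv].
  move=> p5 p6.
  have s5 : s' 5 = v by []. have s6 : s' 6 = u by [].
  rewrite s5 in p5; rewrite s6 in p6; have [kv ev] := pitvK p5; have [ku eu] := pitvK p6.
  (* With the last pit in the place of the first, [f_le] also inspects the columns between two pits.
     The column of the left pit is seen from it but not from the right one, so no two distinct pits
     compare as equal, against the last conjunct of [f_ident]. *)
  have sep (a b : V) : s' 9 = pitv K.-1 -> pit a -> pit b -> pos a < pos b ->
      [forall c, (e c (s' 9)) || (~~ e c a || e c b)] -> False.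
    move=> s9 pa pb ab /forallP H.
    have [ka _] := pitvK pa; have [kb _] := pitvK pb.
    have := H (basev (n + pos a)); rewrite s9.
    have bK : n + pos a <= n + K by lia.
    rewrite !adj_bp ?pit_basev ?is_pit_pitv // column_basev // pos_pitv // wK.
    by have := wn kb; lia.
  have s9 : s' 9 = pitv K.-1 by exact: e91.1.
  move=> H56 H65; have : pos v <> pos u by move=> E; move: uv; rewrite s5 s6 ev eu E eqxx.
  case: (ltngtP (pos v) (pos u)) => // lt _; exfalso.
    by apply: (sep v u s9 p5 p6 lt); move: H56; rewrite /= /upd.
  by apply: (sep u v s9 p6 p5 lt); move: H65; rewrite /= /upd.
move=> fs; have [s9 s1] := fs.
rewrite /f_ident -[fo_holds _ _ _]/([&& fo_holds e s (f_pit 9), fo_holds e s (f_pit 1),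
    [forall v, [|| fo_holds e (upd s 4 v) (FOAdj 4 9), fo_holds e (upd s 4 v) (FOAdj 4 1) | fo_holds e (upd s 4 v) (f_pit 4)]] &
    [exists v, [exists u, let s' := upd (upd s 5 v) 6 u in
      [&& ~~ (s' 5 == s' 6), fo_holds e s' (f_tok 5), fo_holds e s' (f_tok 6),
          fo_holds e s' (f_le 5 6) & fo_holds e s' (f_le 6 5)]]]]).
rewrite !holds_pit // s9 s1 !is_pit_pitv //=; apply/andP; split.
  apply/forallP => v; rewrite -[X in _ || (_ || X)]/(fo_holds e (upd s 4 v) (f_pit 4)) holds_pit // upd_same.
  rewrite /upd /= s9 s1 orbA; have [|/covered ->] := boolP (pit v); rewrite ?orbT //.
have [m /andP[m0 mK] wm] := w_tie.
apply/existsP; exists (pitv 0); apply/existsP; exists (pitv m).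
set s' := upd _ 6 _; have fs' : framed s' by [].
have p5 : pit (s' 5) by exact: is_pit_pitv.
have p6 : pit (s' 6) by exact: is_pit_pitv.
rewrite -[X in is_true X]/([&& ~~ (s' 5 == s' 6), fo_holds e s' (f_tok 5), fo_holds e s' (f_tok 6),
     fo_holds e s' (f_le 5 6) & fo_holds e s' (f_le 6 5)]).
rewrite !holds_tok ?p5 ?p6; try by left.
rewrite !holds_le //.
have -> : s' 5 = pitv 0 by []. have -> : s' 6 = pitv m by [].
rewrite !pos_pitv // w0 wm leqnn !andbT.
by apply/eqP => /(congr1 (fun v : V => pos v)); rewrite !pos_pitv // => E; rewrite -E in m0.
Qed.

(** Variable 9 is bound to the first pit, which becomes position 0; hence the assignment
    [fun=> 0]. *)
Lemma models_df phi : dvars_ok phi -> {subset dfree phi <= [:: 9]} ->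
  fo_models e (df_sentence phi) <-> dholds w (fun=> 0) phi.
Proof.
move=> ok fr.
have irr s s' : (forall x, x \in dfree phi -> s x = s' x) -> dholds w s phi = dholds w s' phi.
  elim: phi s s' {ok fr} => [i j|i j|f IH|f IHf g IHg|f IHf g IHg|i f IH|i f IH] s s' H /=.
  - by rewrite !H // !inE eqxx ?orbT.
  - by rewrite !H // !inE eqxx ?orbT.
  - by rewrite (IH s s').
  - by rewrite (IHf s s') ?(IHg s s') // => x xf; apply: H; rewrite mem_cat xf ?orbT.
  - by rewrite (IHf s s') ?(IHg s s') // => x xf; apply: H; rewrite mem_cat xf ?orbT.
  - apply: eq_existsb => m; apply: IH => x xf; rewrite /upd; case: eqP => // /eqP xi.
    by apply: H; rewrite mem_filter xi.
  - apply: eq_forallb => m; apply: IH => x xf; rewrite /upd; case: eqP => // /eqP xi.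
    by apply: H; rewrite mem_filter xi.
have H s : framed s -> fo_holds e s (df_fo phi) = dholds w (fun=> 0) phi.
  move=> fs; rewrite holds_df //.
    by apply: irr => x /fr; rewrite inE => /eqP ->; rewrite /= fs.1 pos_pitv.
  by move=> x /fr; rewrite inE => /eqP ->; rewrite fs.1 is_pit_pitv.
split=> [/(_ (fun=> pitv 0)) /existsP[a /existsP[z /andP[/holds_ident fs hd]]]|hp s].
  by rewrite -(H _ fs).
apply/existsP; exists (pitv 0); apply/existsP; exists (pitv K.-1).
have fs : framed (upd (upd s 9 (pitv 0)) 1 (pitv K.-1)) by [].
have hd : fo_holds e (upd (upd s 9 (pitv 0)) 1 (pitv K.-1)) (df_fo phi) by rewrite (H _ fs).
by apply/andP; split; [apply/holds_ident|exact: hd].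
Qed.
End Semantics.

(** * Quantified Boolean formulas as data words *)

(** Position 9 carries letter 0, and so do the start of each block and the root
    of the matrix.  The matrix is listed in preorder, a node at depth [d] having
    letter [d]: the children of [x] are the later positions [y] with a larger
    letter and no smaller letter in between.  Below a literal, at depth [t],
    comes its variable, with a node [t.+1] in between if it is negative. *)
Definition d_zero y := DLe y 9.
Definition d_between x y psi := DAll 8 (DOr (DNot (DAnd (DLt x 8) (DLt 8 y))) psi).
Definition d_next x y := DAnd (DLt x y) (DAnd (d_zero y) (d_between x y (DNot (d_zero 8)))).
Definition d_same x y := DAnd (DLt x y) (DAnd (DNot (d_zero y)) (d_between x y (DNot (d_zero 8)))).
Definition d_child x y := DAnd (DLt x y) (DAnd (DNot (DLe y x)) (d_between x y (DLe y 8))).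

Definition d_eqv x y := DAnd (DLe x y) (DLe y x).
(** [DNot (DLe y y)] is the empty disjunction. Among the positions held by the variables from 10 on,
    the starts of blocks have letter 0 and cannot match a node strictly below the root of the
    matrix. *)
Fixpoint d_match (I y : nat) : df :=
  if I is I'.+1 then DOr (d_eqv (10 + I') y) (d_match I' y) else DNot (DLe y y).

Definition d_lit I x := DEx 6 (DAnd (d_child x 6) (DOr (d_match I 6)
  (DEx 7 (DAnd (d_child 6 7) (DNot (d_match I 7)))))).

(** Starting from 4, [9 - x] exchanges the variables 4 and 5, which are reused for all layers. *)
Fixpoint d_layers I (conj : bool) d x : df :=
  if d is d'.+1 then
    if conj then DAll (9 - x) (DOr (DNot (d_child x (9 - x))) (d_layers I (~~ conj) d' (9 - x)))
    else DEx (9 - x) (DAnd (d_child x (9 - x)) (d_layers I (~~ conj) d' (9 - x)))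
  else d_lit I x.

(** A step binds a new position: [None] the next block, [Some ex] a further
    variable of the current block, chosen by the player given by [ex]. *)
Fixpoint d_steps (Z : seq (option bool)) (i : nat) (core : df) : df :=
  match Z with
  | [::] => core
  | None :: Z' => DEx (10 + i) (DAnd (d_next (9 + i) (10 + i)) (d_steps Z' i.+1 core))
  | Some true :: Z' => DEx (10 + i) (DAnd (d_same (9 + i) (10 + i)) (d_steps Z' i.+1 core))
  | Some false :: Z' =>
      DAll (10 + i) (DOr (DNot (d_same (9 + i) (10 + i))) (d_steps Z' i.+1 core))
  end.

Definition d_core t I := DEx 4 (DAnd (d_next (9 + I) 4) (d_layers I true t 4)).

Fixpoint block_steps (ex : bool) (bl : seq (seq nat * nat)) : seq (option bool) :=
  if bl is (_, k) :: bl' then None :: nseq k (Some ex) ++ block_steps (~~ ex) bl' else [::].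

Definition d_qbf t (bl : seq (seq nat * nat)) : df :=
  d_steps (block_steps true bl) 0 (d_core t (size (block_steps true bl))).

Section Word.
Variables (t : nat) (vars : seq nat).

(** Letters up to [t] are depths and [t.+1] marks a negation; variables get larger letters, hence
    read as descendants of their literals. *)
Definition vval x := t + 2 + index x vars.

Fixpoint tree_word (d : nat) : tnorm d -> seq nat :=
  match d with
  | 0 => fun l => [:: t] ++ (if l.1 then [::] else [:: t.+1]) ++ [:: vval l.2]
  | d'.+1 => fun F => (t - d'.+1) :: flatten (map (@tree_word d') F)
  end.

Definition blocks_word (bl : seq (seq nat * nat)) : seq nat :=
  flatten [seq 0 :: map vval b.1 | b <- bl].

(** The initial 0 is the position held by variable 9. The final 0 ends the matrix and forms a tie
    with the initial one, and the largest letter stands once, at the end: this is what decoding the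
    hill requires. *)
Definition qword (bl : seq (seq nat * nat)) (F : tnorm t) : seq nat :=
  0 :: blocks_word bl ++ tree_word F ++ [:: 0; t + 2 + size vars].

Lemma tree_wordE d (F : tnorm d) : d <= t ->
  exists2 l, tree_word F = (t - d) :: l & all (ltn (t - d)) l.
Proof.
elim: d F => [|d IH] F dt /=.
  rewrite subn0; eexists; first by [].
  by case: F.1 => /=; rewrite /vval; lia.
eexists; first by [].
elim: F => //= G F IHF; rewrite all_cat IHF andbT.
have [l -> al] := IH G (ltnW dt); rewrite /= subnSK //= leqnn /=.
by apply: sub_all al => x /=; lia.
Qed.
End Word.

Section Qbf.
Variables (t : nat) (vars : seq nat) (w : seq nat).
Hypothesis t0 : 0 < t.
Let K := size w.
Let W m := nth 0 w m.
Notation vval := (vval t vars).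

Lemma dholds_zero s y : W (s 9) = 0 -> dholds w s (d_zero y) = (W (s y) == 0).
Proof. by move=> s9; rewrite /= -[nth 0 w (s 9)]/(W (s 9)) s9 leqn0. Qed.

Lemma dholds_between s x y psi : x != 8 -> y != 8 ->
  dholds w s (d_between x y psi) <->
  (forall m, m < K -> s x < m < s y -> dholds w (upd s 8 m) psi).
Proof.
move=> /negPf x8 /negPf y8; rewrite /= /upd x8 y8 /=.
split=> [/forallP H m mK /andP[xm my]|H].
  by have := H (Ordinal mK); rewrite /= xm my.
by apply/forallP => m; case: andP => //= -[xm my]; apply: H; rewrite ?xm.
Qed.

Lemma dholds_next s x y : W (s 9) = 0 -> x != 8 -> y != 8 ->
  dholds w s (d_next x y) <->
  [/\ s x < s y, W (s y) = 0 & forall m, m < K -> s x < m < s y -> W m <> 0].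
Proof.
move=> s9 x8 y8; rewrite -[dholds _ _ _]/([&& s x < s y, dholds w s (d_zero y) & dholds w s (d_between x y (DNot (d_zero 8)))]).
rewrite dholds_zero //; split=> [/and3P[xy /eqP y0 /(dholds_between _ _ x8 y8) H]|[xy y0 H]].
  split=> // m mK /(H _ mK); rewrite -[dholds _ _ _]/(~~ dholds w (upd s 8 m) (d_zero 8)).
  by rewrite dholds_zero ?upd_same // => /eqP.
rewrite xy y0 eqxx !andTb; apply/(dholds_between _ _ x8 y8) => m mK xm.
rewrite -[dholds _ _ _]/(~~ dholds w (upd s 8 m) (d_zero 8)) dholds_zero ?upd_same //.
by apply/eqP; apply: H.
Qed.

Lemma dholds_same s x y : W (s 9) = 0 -> x != 8 -> y != 8 ->
  dholds w s (d_same x y) <->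
  [/\ s x < s y, W (s y) <> 0 & forall m, m < K -> s x < m < s y -> W m <> 0].
Proof.
move=> s9 x8 y8; rewrite -[dholds _ _ _]/([&& s x < s y, ~~ dholds w s (d_zero y) & dholds w s (d_between x y (DNot (d_zero 8)))]).
rewrite dholds_zero //; split=> [/and3P[xy /eqP y0 /(dholds_between _ _ x8 y8) H]|[xy /eqP y0 H]].
  split=> // m mK /(H _ mK); rewrite -[dholds _ _ _]/(~~ dholds w (upd s 8 m) (d_zero 8)).
  by rewrite dholds_zero ?upd_same // => /eqP.
rewrite xy y0 !andTb; apply/(dholds_between _ _ x8 y8) => m mK xm.
rewrite -[dholds _ _ _]/(~~ dholds w (upd s 8 m) (d_zero 8)) dholds_zero ?upd_same //.
by apply/eqP; apply: H.
Qed.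

Definition childP p m := [/\ p < m, W p < W m & forall k, p < k < m -> W m <= W k].

Lemma dholds_child s x y : x != 8 -> y != 8 -> s y < K ->
  dholds w s (d_child x y) <-> childP (s x) (s y).
Proof.
move=> x8 y8 yK; rewrite -[dholds _ _ _]/([&& s x < s y, ~~ (W (s y) <= W (s x)) & dholds w s (d_between x y (DLe y 8))]).
rewrite -ltnNge; split=> [/and3P[xy yx /(dholds_between _ _ x8 y8) H]|[xy yx H]].
  split=> // m /[dup] xm /andP[_ my]; have := H m (ltn_trans my yK) xm.
  by rewrite /= upd_same upd_diff 1?eq_sym.
rewrite xy yx !andTb; apply/(dholds_between _ _ x8 y8) => m _ xm.
by rewrite /= upd_same upd_diff 1?eq_sym //; apply: H.
Qed.

Lemma child_list A (L : seq (seq nat)) b B c g : w = A ++ c :: flatten L ++ b :: B -> c < g -> b <= c ->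
  (forall l, l \in L -> exists2 l', l = g :: l' & all (ltn g) l') ->
  forall m, m < K -> childP (size A) m <-> exists2 j, j < size L & m = (size A).+1 + size (flatten (take j L)).
Proof.
move=> wE cg bc HL m mK.
have Wc : W (size A) = c by rewrite /W wE nth_cat ltnn subnn.
(* [C] collects the lists already passed; only that its letters are at least [g] matters. *)
suff H C : w = A ++ c :: C ++ flatten L ++ b :: B -> all (leq g) C -> forall m, (size A).+1 + size C <= m ->
    (c < W m /\ (forall k, size A < k < m -> W m <= W k)) <->
    exists2 j, j < size L & m = (size A).+1 + size C + size (flatten (take j L)).
  have := H [::] wE isT m; rewrite addn0 => {}H.
  split=> [[Am + +]|E]; first by rewrite Wc => cm le; apply/H.
  have Am : size A < m by case: E => j _ ->; rewrite addSn ltnS leq_addr.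
  by case/H: E => // cm le; split; rewrite ?Wc.
elim: L C {wE} HL {m mK} => [|l L IH] C HL wE Cg m mC.
  split=> [[cm le]|[] //]; exfalso.
  have Wq : W ((size A).+1 + size C) = b.
    by rewrite /W wE nth_cat ltnNge addSn leqW ?leq_addr //= subSn ?leq_addr // addKn /= nth_cat ltnn subnn.
  move: mC; rewrite leq_eqVlt => /orP[/eqP E|lt].
    by move: cm; rewrite -E Wq; lia.
  have := le ((size A).+1 + size C); rewrite Wq lt andbT addSn ltnS leq_addr => /(_ isT); lia.
have [l' lE al'] := HL l (mem_head _ _).
have nthC k : k < size C -> W ((size A).+1 + k) = nth 0 C k.
  move=> kC; rewrite /W wE nth_cat ltnNge addSn leqW ?leq_addr //= subSn ?leq_addr // addKn /=.
  by rewrite nth_cat kC.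
have nthl k : k < size l -> W ((size A).+1 + size C + k) = nth 0 l k.
  move=> kl; rewrite /W wE nth_cat ltnNge !addSn leqW -?addnA ?leq_addr //= subSn ?leq_addr // addKn /=.
  by rewrite nth_cat ltnNge leq_addr /= addKn -catA nth_cat kl.
have Wq : W ((size A).+1 + size C) = g by rewrite -[X in W X]addn0 nthl lE.
have [|ml] := ltnP m ((size A).+1 + size C + size l).
  move=> ml; move: mC; rewrite leq_eqVlt => /orP[/eqP E|lt].
    rewrite -E Wq; split=> [_|_]; first by exists 0; rewrite // take0 addn0.
    split=> // k /andP[Ak kC].
    have kk : k - (size A).+1 < size C by lia.
    by have := nthC _ kk; rewrite subnKC // => ->; apply: (allP Cg); apply: mem_nth.
  split=> [[cm le]|[j jL E]]; exfalso.
    have := le ((size A).+1 + size C); rewrite Wq lt andbT addSn ltnS leq_addr => /(_ isT).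
    have := nthl (m - ((size A).+1 + size C)); rewrite subnKC ?(ltnW lt) // => ->; last by lia.
    rewrite lE; case E : (m - _) => [|k] /=; first by lia.
    have kl : k < size l' by move: ml; rewrite lE /=; lia.
    by have := allP al' _ (mem_nth 0 kl); rewrite /=; lia.
  case: j jL E => [|j] jL E; first by move: lt; rewrite E take0 addn0 ltnn.
  by move: ml; rewrite E /= size_cat; lia.
have := IH (C ++ l) _ _ _ m; rewrite size_cat addnA => -[].
- by move=> l1 l1L; apply: HL; rewrite inE l1L orbT.
- by rewrite wE /= -!catA.
- rewrite all_cat Cg lE /= leqnn /=; by apply: sub_all al' => x /= /ltnW.
- exact: ml.
move=> H1 H2; split=> [/H1[j jL E]|[[|j] jL E]].
- by exists j.+1 => //; rewrite E /= size_cat addnA.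
- by move: ml; rewrite E take0 addn0 lE /= ; lia.
- by apply: H2; exists j => //; rewrite E /= size_cat addnA.
Qed.

Lemma dholds_match s I y : dholds w s (d_match I y) <-> exists2 i, i < I & W (s (10 + i)) = W (s y).
Proof.
elim: I => [|I IH] /=; first by rewrite leqnn; split=> // -[].
split=> [/orP[/andP[h1 h2]|/IH[i iI E]]|[i]].
- by exists I => //; apply/eqP; rewrite eqn_leq h1.
- by exists i => //; apply: ltnW.
rewrite ltnS leq_eqVlt => /orP[/eqP -> E|iI E]; apply/orP; last by right; apply/IH; exists i.
by left; rewrite -/(W _) E !leqnn.
Qed.

Definition recorded (s : nat -> nat) (I : nat) (T : seq nat) :=
  (forall i, i < I -> W (s (10 + i)) = 0 \/ exists2 x, x \in T & W (s (10 + i)) = vval x) /\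
  (forall x, x \in T -> exists2 i, i < I & W (s (10 + i)) = vval x).

Lemma recorded_eq s s' I T : (forall i, i < I -> s (10 + i) = s' (10 + i)) ->
  recorded s I T -> recorded s' I T.
Proof.
move=> ss [H1 H2]; split=> [i iI|x /H2[i iI E]]; first by rewrite -ss //; apply: H1.
by exists i; rewrite -?ss.
Qed.

Lemma recorded_upd s v m I T : v < 10 -> recorded s I T -> recorded (upd s v m) I T.
Proof.
by move=> v10; apply: recorded_eq => i _; rewrite upd_diff //; apply/eqP => e; move: v10; rewrite e.
Qed.

Lemma vval_inj x y : x \in vars -> y \in vars -> vval x = vval y -> x = y.
Proof.
move=> xv yv /addnI E; rewrite -(nth_index 0 xv) E; exact: nth_index.
Qed.

Lemma match_var s I T y x : recorded s I T -> {subset T <= vars} -> x \in vars -> W (s y) = vval x ->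
  dholds w s (d_match I y) = (x \in T).
Proof.
move=> [H1 H2] Tv xv yE; apply/idP/idP => [/dholds_match[i iI E]|xT]; last first.
  by apply/dholds_match; have [i iI E] := H2 x xT; exists i; rewrite // yE.
have [E0|[z zT Ez]] := H1 i iI; first by move: E; rewrite E0 yE /vval; lia.
by rewrite -(vval_inj (Tv _ zT) xv _) // -Ez E yE.
Qed.

Lemma match_other s I T y : recorded s I T -> 0 < W (s y) < t + 2 -> dholds w s (d_match I y) = false.
Proof.
move=> [H1 _] yt; apply/negP => /dholds_match[i iI E].
by have [E0|[z zT Ez]] := H1 i iI; move: E; rewrite ?E0 ?Ez /vval; lia.
Qed.

Lemma dholds_and s f g : dholds w s (DAnd f g) <-> dholds w s f /\ dholds w s g.
Proof. by split=> [/andP|H]; [|apply/andP]. Qed.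

Lemma dholds_or s f g : dholds w s (DOr f g) <-> dholds w s f \/ dholds w s g.
Proof. by split=> [/orP|H]; [|apply/orP]. Qed.

Lemma dholds_not s f : dholds w s (DNot f) <-> ~ dholds w s f.
Proof. by split=> [/negP|H]; [|apply/negP]. Qed.

Lemma dholds_ex s i psi : dholds w s (DEx i psi) <-> exists2 m, m < K & dholds w (upd s i m) psi.
Proof.
split=> [/existsP[m hm]|[m mK hm]]; first by exists m.
by apply/existsP; exists (Ordinal mK).
Qed.

Lemma dholds_all s i psi : dholds w s (DAll i psi) <-> forall m, m < K -> dholds w (upd s i m) psi.
Proof.
split=> [/forallP h m mK|h]; first exact: (h (Ordinal mK)).
by apply/forallP => m; apply: h.
Qed.

Lemma size_prefix A a B : w = A ++ a :: B -> size A < K.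
Proof. by rewrite /K => ->; rewrite size_cat /= addnS ltnS leq_addr. Qed.

Lemma W_at A a B : w = A ++ a :: B -> W (size A) = a.
Proof. by rewrite /W => ->; rewrite nth_cat ltnn subnn. Qed.

(** The two disjuncts of [d_lit] do not interfere: below a positive literal the variable has no
    child, and below a negative one the mark [t.+1] matches no chosen position. *)
Lemma dholds_lit s I T x A B b conj (l : tnorm 0) : w = A ++ tree_word t vars l ++ b :: B -> b <= t ->
  s x = size A -> x < 6 -> recorded s I T -> {subset T <= vars} -> l.2 \in vars ->
  dholds w s (d_lit I x) = tnorm_eval conj (mem T) l.
Proof.
move=> wE bt sx x6 rec Tv lv; rewrite /d_lit.
have x8 : x != 8 by lia. have x6' : x != 6 by lia. have x7 : x != 7 by lia.
have AK : size A < K by apply: (@size_prefix _ t _); rewrite wE.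
have vK m : m < K -> upd s 6 m x = size A by move=> _; rewrite upd_diff // eq_sym.
case: l lv wE => -[] v vv; rewrite [tree_word _ _ _]/= => wE; rewrite [tnorm_eval _ _ _]/= -?[(_, _).2]/v in vv *; have {}vv : v \in vars := vv.
- have wE' : w = A ++ t :: flatten [:: [:: vval v]] ++ b :: B by rewrite wE.
  have wE2 : w = (A ++ [:: t]) ++ vval v :: flatten [::] ++ b :: B by rewrite wE -catA.
  have tv : t < vval v by rewrite /vval; lia.
  have C1 := child_list wE' tv bt _; have C2 := @child_list _ [::] _ _ _ (vval v).+1 wE2 (ltnSn _) _ _.
  have yK : (size A).+1 < K.
    by have := size_prefix wE2; rewrite size_cat addn1.
  have Wy : W (size A).+1 = vval v by have := W_at wE2; rewrite size_cat addn1.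
  apply/idP/idP.
    move=> /dholds_ex[m mK /dholds_and[]]; rewrite dholds_child ?upd_same ?vK //.
    move=> /C1 [|//|j]; first by move=> l; rewrite inE => /eqP ->; exists [::].
    rewrite ltnS leqn0 => /eqP -> E; rewrite E take0 addn0 in mK *.
    move=> /dholds_or[|/dholds_ex[k kK /dholds_and[]]].
      by rewrite (match_var (recorded_upd _ _ rec) Tv vv) // upd_same.
    rewrite dholds_child ?upd_same //; rewrite upd_diff // upd_same.
    have -> : (size A).+1 = size (A ++ [:: t]) by rewrite size_cat addn1.
    by move=> /C2[] //; rewrite /vval; lia.
  move=> vT; apply/dholds_ex; exists (size A).+1 => //; apply/dholds_and; split.
    rewrite dholds_child ?upd_same ?vK //; apply/C1 => //.
      by move=> l; rewrite inE => /eqP ->; exists [::].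
    by exists 0; rewrite // take0 addn0.
  by apply/dholds_or; left; rewrite (match_var (recorded_upd _ _ rec) Tv vv) // upd_same.
have wE' : w = A ++ t :: flatten [:: [:: t.+1; vval v]] ++ b :: B by rewrite wE.
have wE2 : w = (A ++ [:: t]) ++ t.+1 :: flatten [:: [:: vval v]] ++ b :: B by rewrite wE -catA.
have wE3 : w = (A ++ [:: t; t.+1]) ++ vval v :: b :: B by rewrite wE -catA.
have tv : t.+1 < vval v by rewrite /vval; lia.
have C1 := child_list wE' (ltnSn _) bt _; have C2 := child_list wE2 tv (leqW bt) _.
have yK : (size A).+1 < K by have := size_prefix wE2; rewrite size_cat addn1.
have zK : (size A).+2 < K by have := size_prefix wE3; rewrite size_cat addn2.
have Wy : W (size A).+1 = t.+1 by have := W_at wE2; rewrite size_cat addn1.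
have Wz : W (size A).+2 = vval v by have := W_at wE3; rewrite size_cat addn2.
have s1 : (size A).+1 = size (A ++ [:: t]) by rewrite size_cat addn1.
apply/idP/idP.
  move=> /dholds_ex[m mK /dholds_and[]]; rewrite dholds_child ?upd_same ?vK //.
  move=> /C1 [|//|j]; first by move=> l; rewrite inE => /eqP ->; exists [:: vval v]; rewrite //= tv.
  rewrite ltnS leqn0 => /eqP -> E; rewrite E take0 addn0 in mK *.
  move=> /dholds_or[|].
    by rewrite (match_other (recorded_upd _ _ rec)) // upd_same Wy; lia.
  move=> /dholds_ex[k kK /dholds_and[]]; rewrite dholds_child ?upd_same //; rewrite upd_diff // upd_same s1.
  move=> /C2 [|//|j']; first by move=> l; rewrite inE => /eqP ->; exists [::].
  rewrite ltnS leqn0 => /eqP -> E'; rewrite E' take0 addn0 -s1 in kK *.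
  rewrite -[dholds _ _ _]/(~~ dholds w (upd (upd s 6 (size A).+1) 7 (size A).+2) (d_match I 7)).
  by rewrite (match_var (recorded_upd _ _ (recorded_upd _ _ rec)) Tv vv) // upd_same.
move=> vT; apply/dholds_ex; exists (size A).+1 => //; apply/dholds_and; split.
  rewrite dholds_child ?upd_same ?vK //; apply/C1 => //.
    by move=> l; rewrite inE => /eqP ->; exists [:: vval v]; rewrite //= tv.
  by exists 0; rewrite // take0 addn0.
apply/dholds_or; right; apply/dholds_ex; exists (size A).+2 => //; apply/dholds_and; split.
  rewrite dholds_child ?upd_same // upd_diff // upd_same s1; apply/C2 => //; try by rewrite -s1.
    by move=> l; rewrite inE => /eqP ->; exists [::].
  by exists 0; rewrite // take0 addn0 -s1.
rewrite -[dholds _ _ _]/(~~ dholds w (upd (upd s 6 (size A).+1) 7 (size A).+2) (d_match I 7)).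
by rewrite (match_var (recorded_upd _ _ (recorded_upd _ _ rec)) Tv vv) // upd_same.
Qed.

Lemma flatten_split (L : seq (seq nat)) j : j < size L ->
  flatten L = flatten (take j L) ++ nth [::] L j ++ flatten (drop j.+1 L).
Proof. by move=> jL; rewrite -{1}(cat_take_drop j L) flatten_cat (drop_nth [::] jL). Qed.

Lemma mem_map_ex (T : Type) (U : eqType) (f : T -> U) (s : seq T) y :
  y \in map f s -> exists x, y = f x.
Proof. by elim: s => //= x s IH; rewrite inE => /orP[/eqP ->|/IH //]; exists x. Qed.

Lemma all_nth (T : Type) (p : pred T) (s : seq T) :
  all p s <-> (forall j x, j < size s -> p (nth x s j)).
Proof.
split=> [ps j x|H]; first exact: (all_nthP x ps).
by case: s H => // x s H; apply/(all_nthP x) => j; apply: H.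
Qed.

Lemma has_nth (T : Type) (p : pred T) (s : seq T) :
  has p s <-> (exists j x, j < size s /\ p (nth x s j)).
Proof.
split=> [|[j [x [js pj]]]]; last by apply/(has_nthP x); exists j.
by case: s => // x s /(has_nthP x)[j js pj]; exists j, x.
Qed.

Lemma dholds_layers d (G : tnorm d) conj x s I T A B b : d <= t ->
  w = A ++ tree_word t vars G ++ b :: B -> b <= t - d ->
  s x = size A -> (x == 4) || (x == 5) -> recorded s I T -> {subset T <= vars} ->
  {subset tnorm_vars G <= vars} ->
  dholds w s (d_layers I conj d x) = tnorm_eval conj (mem T) G.
Proof.
elim: d G conj x s A B b => [|d IH] G conj x s A B b dt wE bt sx x45 rec Tv Gv.
  apply: (dholds_lit conj wE) => //; [by rewrite -[t]subn0|by case/orP: x45 => /eqP ->|].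
  by apply: Gv; rewrite inE.
pose L := map (@tree_word t vars d) G.
have LE l : l \in L -> exists2 l', l = (t - d) :: l' & all (ltn (t - d)) l'.
  by move=> /mem_map_ex[g ->]; apply: tree_wordE; exact: ltnW.
have td : t - d.+1 < t - d by lia.
have wE1 : w = A ++ (t - d.+1) :: flatten L ++ b :: B := wE.
have C := child_list wE1 td bt LE.
(* Each subtree is followed by a letter no larger than that of its root, either the next sibling or
   the end [b]: this is the side condition on [b] one level below. *)
have sub j : j < size G -> exists A' B' b', [/\ w = A' ++ nth [::] L j ++ b' :: B',
    b' <= t - d & size A' = (size A).+1 + size (flatten (take j L))].
  move=> jG; have jL : j < size L by rewrite size_map.
  have [b' [B' [E b'd]]] : exists b' B', flatten (drop j.+1 L) ++ b :: B = b' :: B' /\ b' <= t - d.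
    case E : (drop j.+1 L) => [|l L'] /=; first by exists b, B; split=> //; lia.
    have [|l' -> _] := LE l; first by apply: (@mem_drop j.+1); rewrite E mem_head.
    by exists (t - d), (l' ++ flatten L' ++ b :: B); rewrite /= -!catA.
  exists (A ++ (t - d.+1) :: flatten (take j L)), B', b'; split=> //; last by rewrite size_cat /= addnS.
  by rewrite wE1 (flatten_split jL) -!catA /= -E -?catA.
set y := 9 - x; have y45 : (y == 4) || (y == 5) by rewrite /y; case/orP: x45 => /eqP ->.
have x8 : x != 8 by case/orP: x45 => /eqP ->.
have y8 : y != 8 by case/orP: y45 => /eqP ->.
have xy : y != x by rewrite /y; case/orP: x45 => /eqP ->.
have yl : y < 10 by case/orP: y45 => /eqP ->.
pose m j := (size A).+1 + size (flatten (take j L)).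
have mK j : j < size G -> m j < K.
  move=> jG; have [A' [B' [b' [E _ sA]]]] := sub j jG.
  have [|l' El _] := LE (nth [::] L j); first by apply: mem_nth; rewrite size_map.
  by rewrite /m -sA; apply: (@size_prefix _ (t - d) (l' ++ b' :: B')); rewrite E El.
have chm j : j < size G -> dholds w (upd s y (m j)) (d_child x y).
  move=> jG; rewrite dholds_child // ?upd_same ?mK // upd_diff // sx; apply/C; first exact: mK.
  by exists j; rewrite ?size_map.
have chE k : k < K -> dholds w (upd s y k) (d_child x y) -> exists2 j, j < size G & k = m j.
  move=> kK; rewrite dholds_child // ?upd_same // upd_diff // sx => /C[] // j.
  by rewrite size_map => jG ->; exists j.
have val j g0 : j < size G -> dholds w (upd s y (m j)) (d_layers I (~~ conj) d y) = tnorm_eval (~~ conj) (mem T) (nth g0 G j).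
  move=> jG; have [A' [B' [b' [E b'd sA]]]] := sub j jG.
  move: E; rewrite (nth_map g0) // => E.
  apply: (IH _ _ _ _ A' B' b') => //; try by rewrite ?upd_same.
  - exact: ltnW.
  - exact: recorded_upd.
  - move=> v vG; apply: Gv; rewrite /=; apply/flattenP; exists (tnorm_vars (nth g0 G j)) => //.
    by rewrite -(nth_map g0 [::] (@tnorm_vars d)) // mem_nth // size_map.
case: conj val => val.
  rewrite [d_layers _ _ _ _]/= -/y [tnorm_eval _ _ _]/=; apply/idP/idP.
    move=> /dholds_all H; apply/all_nth => j g0 jG.
    by have /dholds_or[/dholds_not/(_ (chm j jG)) //|] := H _ (mK j jG); rewrite (val _ g0).
  move=> /all_nth H; apply/dholds_all => k kK; apply/dholds_or.
  have [/chE|nc] := boolP (dholds w (upd s y k) (d_child x y)); last by left; apply/dholds_not/negP.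
  move=> /(_ kK)[j jG ->]; right.
  case EG : G jG => [//|g0 G'] jG; rewrite -EG in jG.
  by rewrite (val _ g0) //; apply: H.
rewrite [d_layers _ _ _ _]/= -/y [tnorm_eval _ _ _]/=; apply/idP/idP.
  move=> /dholds_ex[k kK /dholds_and[/(chE k kK)[j jG ->]]] H.
  case EG : G jG => [//|g0 G'] jG; rewrite -EG in jG *.
  by apply/has_nth; exists j, g0; rewrite -(val _ g0).
move=> /has_nth[j [g0 [jG pj]]]; apply/dholds_ex; exists (m j); first exact: mK.
by apply/dholds_and; split; [exact: chm|rewrite (val _ g0)].
Qed.

(** The next 0 is unique, so this existential quantifier leaves no choice. *)
Lemma dholds_step s x y psi A B : w = A ++ 0 :: B -> s x < size A ->
  (forall m, s x < m < size A -> W m <> 0) -> W (s 9) = 0 ->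
  x != y -> x != 8 -> y != 8 -> y != 9 ->
  dholds w s (DEx y (DAnd (d_next x y) psi)) <-> dholds w (upd s y (size A)) psi.
Proof.
move=> wE xA nz s9 xy x8 y8 y9; have AK := size_prefix wE; have WA := W_at wE.
have yx : y != x by rewrite eq_sym.
split=> [/dholds_ex[m mK /dholds_and[]]|H].
  rewrite dholds_next //; last by rewrite upd_diff.
  rewrite upd_same upd_diff // => -[xm Wm nzm].
  case: (ltngtP m (size A)) => [lt|gt|-> //].
    by case: (nz m); rewrite ?xm.
  by case: (nzm (size A)) => //; rewrite xA.
apply/dholds_ex; exists (size A) => //; apply/dholds_and; split=> //.
rewrite dholds_next //; last by rewrite upd_diff.
by rewrite upd_same upd_diff //; split=> // m _; exact: nz.
Qed.

(** A subsequence is picked one entry at a time, each to the right of the previous one, just as the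
    [Some] steps bind ever later positions of a block. *)
Lemma subseq_cons_nth (x : nat) U s : subseq (x :: U) s <->
  exists j, [/\ j < size s, nth 0 s j = x & subseq U (drop j.+1 s)].
Proof.
elim: s => [|y s IH]; first by split=> // -[j []].
rewrite [subseq _ _]/=; case: (eqVneq x y) => [->|ne].
  split=> [H|[[|j] [js E H]]]; first by exists 0; rewrite /= drop0.
    by move: H; rewrite /= drop0.
  by apply: (subseq_trans H); rewrite [drop _ _]/=; exact: drop_subseq.
rewrite IH; split=> [[j [js E H]]|[[|j] [js E H]]].
- by exists j.+1.
- by move: ne; rewrite -E /= eqxx.
- by exists j.
Qed.

Lemma recorded_next s i T m x : recorded s i T -> W m = vval x ->
  recorded (upd s (10 + i) m) i.+1 (T ++ [:: x]).
Proof.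
move=> [H1 H2] Wm; split=> [j|z].
  rewrite ltnS leq_eqVlt => /orP[/eqP ->|ji].
    by right; exists x; rewrite ?upd_same // mem_cat mem_head orbT.
  rewrite upd_diff ?eqn_add2l ?gtn_eqF //.
  by have [E|[z zT E]] := H1 j ji; [left|right; exists z; rewrite // mem_cat zT].
rewrite mem_cat inE => /orP[/H2[j ji E]|/eqP ->].
  by exists j; [exact: leqW|rewrite upd_diff ?eqn_add2l ?gtn_eqF].
by exists i; rewrite // upd_same.
Qed.

Lemma recorded_zero s i T m : recorded s i T -> W m = 0 -> recorded (upd s (10 + i) m) i.+1 T.
Proof.
move=> [H1 H2] Wm; split=> [j|z].
  rewrite ltnS leq_eqVlt => /orP[/eqP ->|ji]; first by left; rewrite upd_same.
  by rewrite upd_diff ?eqn_add2l ?gtn_eqF //; exact: H1.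
by move=> /H2[j ji E]; exists j; [exact: leqW|rewrite upd_diff ?eqn_add2l ?gtn_eqF].
Qed.

(** The next position found by [d_next] from [x] is the 0 in front of [B]. *)
Definition at_zero B (s : nat -> nat) x := exists A,
  [/\ w = A ++ 0 :: B, s x < size A & forall m, s x < m < size A -> W m <> 0].

Lemma dholds_vars ex k Z core (Phi : seq nat -> Prop) B : forall i s T A v,
  w = A ++ map vval v ++ 0 :: B -> (s (9 + i)).+1 = size A -> W (s 9) = 0 ->
  recorded s i T -> {subset T <= vars} -> {subset v <= vars} ->
  (forall s2 T2, at_zero B s2 (9 + (i + k)) -> W (s2 9) = 0 -> recorded s2 (i + k) T2 ->
     {subset T2 <= vars} -> (dholds w s2 (d_steps Z (i + k) core) <-> Phi T2)) ->
  dholds w s (d_steps (nseq k (Some ex) ++ Z) i core) <->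
  (if ex then exists U, [/\ subseq U v, size U = k & Phi (T ++ U)]
   else forall U, subseq U v -> size U = k -> Phi (T ++ U)).
Proof.
elim: k => [|k IH] i s T A v wE sA s9 rec Tv vv cont.
  have az : at_zero B s (9 + (i + 0)).
    exists (A ++ map vval v); rewrite addn0 -catA; split=> //; first by rewrite size_cat; lia.
    move=> m; rewrite size_cat size_map => /andP[sm mA].
    have lt : m - size A < size v by lia.
    have Am : m < size A = false by lia.
    by rewrite /W wE nth_cat Am nth_cat size_map lt (nth_map 0) // -[X in X <> 0]/(t + 2 + _) addn2 addSn.
  have := cont s T az s9; rewrite addn0 => /(_ rec Tv) ->.
  have nilU (U : seq nat) : size U = 0 -> U = [::] by case: U.
  case: ex; split.
  - by move=> H; exists [::]; rewrite sub0seq cats0.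
  - by move=> [U [_ /nilU ->]]; rewrite cats0.
  - by move=> H U _ /nilU ->; rewrite cats0.
  - by move=> /(_ [::]); rewrite sub0seq cats0; apply.
have WA j : j < size v -> W (size A + j) = vval (nth 0 v j).
  by move=> jv; rewrite /W wE nth_cat ltnNge leq_addr /= addKn nth_cat size_map jv (nth_map 0).
have Wend : W (size A + size v) = 0.
  by rewrite /W wE nth_cat ltnNge leq_addr /= addKn nth_cat size_map ltnn subnn.
have endK : size A + size v < K.
  by rewrite /K wE !size_cat size_map /=; lia.
have yx : 10 + i != 9 + i by lia.
have same m : m < K -> dholds w (upd s (10 + i) m) (d_same (9 + i) (10 + i)) <->
    exists2 j, j < size v & m = size A + j.
  move=> mK; rewrite dholds_same; try (rewrite ?upd_diff //; lia).
  rewrite upd_same upd_diff //; split=> [[sm Wm nz]|[j jv ->]].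
    have [lt|ge] := ltnP (m - size A) (size v); first by exists (m - size A) => //; lia.
    exfalso; have [e|ne] := eqVneq m (size A + size v); first by rewrite e in Wm.
    by apply: (nz (size A + size v)) => //; lia.
  split; first by lia.
    by rewrite WA // /vval; lia.
  move=> m' _ /andP[sm' m'j].
  have -> : m' = size A + (m' - size A) by lia.
  by rewrite WA ?/vval; lia.
pose sj j := upd s (10 + i) (size A + j).
have step j : j < size v -> dholds w (sj j) (d_steps (nseq k (Some ex) ++ Z) i.+1 core) <->
  (if ex then exists U, [/\ subseq U (drop j.+1 v), size U = k & Phi ((T ++ [:: nth 0 v j]) ++ U)]
   else forall U, subseq U (drop j.+1 v) -> size U = k -> Phi ((T ++ [:: nth 0 v j]) ++ U)).
  move=> jv; apply: (IH _ _ _ (A ++ map vval (take j.+1 v))).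
  - by rewrite -catA [_ ++ _ ++ 0 :: B]catA -map_cat cat_take_drop.
  - by rewrite /sj -[9 + i.+1]addSnnS upd_same size_cat size_map size_takel //; lia.
  - by rewrite /sj upd_diff //; lia.
  - by apply: recorded_next => //; apply: WA.
  - by move=> z; rewrite mem_cat inE => /orP[/Tv //|/eqP ->]; apply: vv; apply: mem_nth.
  - by move=> z /mem_drop/vv.
  - by rewrite (addSnnS i k).
rewrite [nseq _ _ ++ _]/= [d_steps _ _ _]/=; case: ex step {IH cont} => step.
  split=> [/dholds_ex[m mK /dholds_and[/(same m mK)[j jv ->]]]|[[|x U] [//] /subseq_cons_nth[j [jv <- Uv]] [sU] Ph]].
    move=> /(step j jv)[U [Uv sU Ph]]; exists (nth 0 v j :: U); split.
    + by apply/subseq_cons_nth; exists j.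
    + by rewrite /= sU.
    + by rewrite -cat_rcons -cats1.
  have jK : size A + j < K by lia.
  apply/dholds_ex; exists (size A + j) => //; apply/dholds_and; split; first by apply/same => //; exists j.
  by apply/step => //; exists U; split=> //; rewrite -catA.
split=> [H [|x U] // /subseq_cons_nth[j [jv <- Uv]] [sU]|H].
  have jK : size A + j < K by lia.
  move/dholds_all/(_ _ jK)/dholds_or: H => -[/dholds_not H|/(step j jv) H].
    by case: H; apply/same => //; exists j.
  by have := H U Uv sU; rewrite -catA.
apply/dholds_all => m mK; apply/dholds_or.
have [/(same m mK)[j jv ->]|nc] := boolP (dholds w (upd s (10 + i) m) (d_same (9 + i) (10 + i))).
  right; apply/step => // U Uv sU; rewrite -catA; apply: H; last by rewrite /= sU.
  by apply/subseq_cons_nth; exists j.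
by left; apply/dholds_not/negP.
Qed.

Lemma dholds_blocks (F : tnorm t) core B : forall bl ex i s T,
  at_zero (behead (blocks_word t vars bl ++ 0 :: B)) s (9 + i) ->
  W (s 9) = 0 -> recorded s i T -> {subset T <= vars} -> {subset flatten (map fst bl) <= vars} ->
  (forall s2 T2 i2, i2 = i + size (block_steps ex bl) -> at_zero B s2 (9 + i2) -> W (s2 9) = 0 ->
     recorded s2 i2 T2 -> {subset T2 <= vars} ->
     (dholds w s2 core <-> tnorm_eval true (mem T2) F)) ->
  dholds w s (d_steps (block_steps ex bl) i core) <-> qbf_true ex bl T F.
Proof.
elim=> [|[v k] bl IH] ex i s T az s9 rec Tv blv cont.
  by apply: (cont s T i) => //; rewrite addn0.
have [A [wE sA nz]] := az.
have blv' : {subset flatten (map fst bl) <= vars} by move=> x xb; apply: blv; rewrite /= mem_cat xb orbT.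
have vv : {subset v <= vars} by move=> x xv; apply: blv; rewrite /= mem_cat xv.
rewrite [block_steps _ _]/= [d_steps _ _ _]/=.
rewrite (dholds_step _ wE sA nz s9); try lia.
(* Whether a block or the matrix follows, the remaining word starts with 0; this is the letter
   dropped by [behead] in the statement. *)
have E0 : exists B', blocks_word t vars bl ++ 0 :: B = 0 :: B'.
  by case: (bl) => [|b l]; eexists; rewrite /blocks_word /=.
have [B' E] := E0.
have E1 : blocks_word t vars ((v, k) :: bl) ++ 0 :: B = 0 :: map vval v ++ 0 :: B'.
  by rewrite -E /blocks_word /= -catA.
rewrite E1 /= in wE.
rewrite (@dholds_vars ex k _ core (fun T' => qbf_true (~~ ex) bl T' F) B' _ _ T (A ++ [:: 0]) v).
- by case: (ex).
- by rewrite wE -catA.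
- by rewrite -[9 + i.+1]addSnnS upd_same size_cat addn1.
- by rewrite upd_diff //; lia.
- by apply: recorded_zero => //; exact: W_at wE.
- by [].
- by [].
move=> s2 T2 az2 s29 rec2 T2v; apply: IH => //; first by rewrite E.
move=> s3 T3 i3 ->; apply: cont; rewrite /= size_cat size_nseq; lia.
Qed.
End Qbf.

Section QbfWord.
Variables (t : nat) (bl : seq (seq nat * nat)) (F : tnorm t).
Hypothesis t0 : 0 < t.
Let vars := flatten (map fst bl).
Hypothesis Fv : {subset tnorm_vars F <= vars}.

Definition qsize := t + 3 + size vars.
Let w := qword vars bl F.
Let front := 0 :: blocks_word t vars bl ++ tree_word t vars F ++ [:: 0].

Lemma qwordE : w = front ++ [:: qsize.-1].
Proof.
rewrite /w /qword /front /= -!catA; congr (_ :: _ ++ _ ++ _).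
have -> : t + 2 + size vars = qsize.-1 by rewrite /qsize; lia.
by [].
Qed.

Lemma vval_lt x : x \in vars -> vval t vars x < qsize.-1.
Proof.
have -> : qsize.-1 = t + 2 + size vars by rewrite /qsize; lia.
by rewrite -index_mem /vval ltn_add2l.
Qed.

Lemma tree_lt d (G : tnorm d) : {subset tnorm_vars G <= vars} ->
  all (fun x => x < qsize.-1) (tree_word t vars G).
Proof.
elim: d G => [|d IH] G Gv.
  have : G.2 \in vars by apply: Gv; rewrite inE.
  by move=> /vval_lt lt; rewrite /= all_cat /= lt /qsize; case: G.1 => /=; lia.
rewrite /=; apply/andP; split; first by rewrite /qsize; lia.
elim: G Gv => //= g G IHG Gv; rewrite all_cat IH ?IHG //.
  by move=> x xg; apply: Gv; rewrite mem_cat xg orbT.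
by move=> x xg; apply: Gv; rewrite mem_cat xg.
Qed.

Lemma front_lt : all (fun x => x < qsize.-1) front.
Proof.
have q0 : 0 < qsize.-1 by rewrite /qsize; lia.
rewrite /front /= q0 !all_cat /= q0 tree_lt // !andbT.
have : {subset flatten (map fst bl) <= vars} by [].
rewrite /blocks_word; elim: bl => //= b l IH H; rewrite all_cat q0 IH /=.
  rewrite andbT; apply/allP => _ /mapP[x xb ->]; apply: vval_lt; apply: H.
  by rewrite mem_cat xb.
by move=> x xl; apply: H; rewrite mem_cat xl orbT.
Qed.

Lemma size_qword : size w = (size front).+1.
Proof. by rewrite qwordE size_cat addn1. Qed.

Lemma qword_front m : m < size front -> nth 0 w m < qsize.-1.
Proof.
move=> mf; rewrite qwordE nth_cat mf.
exact: (allP front_lt) (mem_nth _ mf).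
Qed.

Lemma qword_end : nth 0 w (size front) = qsize.-1.
Proof. by rewrite qwordE nth_cat ltnn subnn. Qed.

Lemma qword_bound m : m < size w -> nth 0 w m < qsize.
Proof.
rewrite size_qword ltnS leq_eqVlt => /orP[/eqP ->|/qword_front].
  by rewrite qword_end /qsize; lia.
by rewrite /qsize; lia.
Qed.

Lemma qword_last m : m < size w -> (nth 0 w m == qsize.-1) = (m == (size w).-1).
Proof.
rewrite size_qword ltnS leq_eqVlt => /orP[/eqP ->|mf]; first by rewrite qword_end !eqxx.
by rewrite !ltn_eqF // qword_front.
Qed.

Lemma qword_gt1 : 1 < size w.
Proof. by rewrite /w /qword /= !size_cat /=; lia. Qed.

Lemma qword_tie : exists2 m, 0 < m < size w & nth 0 w m = 0.
Proof.
exists (size front).-1.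
  by rewrite size_qword /front /= !size_cat /=; lia.
have -> : front = (0 :: blocks_word t vars bl ++ tree_word t vars F) ++ [:: 0] by rewrite /front /= -catA.
have -> : w = (0 :: blocks_word t vars bl ++ tree_word t vars F) ++ 0 :: [:: t + 2 + size vars].
  by rewrite /w /qword /= -catA.
by rewrite size_cat addn1 /= nth_cat ltnn subnn.
Qed.

Lemma qword_holds : dholds w (fun=> 0) (d_qbf t bl) <-> qbf_true true bl [::] F.
Proof.
have [F' FE _] := tree_wordE vars F (leqnn t); rewrite subnn in FE.
pose B := F' ++ [:: 0; t + 2 + size vars].
have wB : w = 0 :: blocks_word t vars bl ++ 0 :: B by rewrite /w /qword FE /B /=.
have E0 : exists B', blocks_word t vars bl ++ 0 :: B = 0 :: B'.
  by case: (bl) => [|b l]; eexists; rewrite /blocks_word /=.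
have [B' E] := E0.
rewrite /d_qbf; set N := size _.
apply: (@dholds_blocks t vars w t0 F (d_core t N) B bl true 0 (fun=> 0) [::]) => //.
- exists [:: 0]; split; first by rewrite wB E.
    by [].
  by move=> m /andP[] /=; rewrite ltnS leqn0 => + /eqP E1; rewrite E1.
move=> s T i; rewrite add0n -/N => -> [A [wA sA nz]] s9 rec Tv.
rewrite /d_core (dholds_step _ wA sA nz s9); try lia.
have wA' : w = A ++ tree_word t vars F ++ 0 :: [:: t + 2 + size vars].
  by rewrite wA FE /B /= -?catA.
rewrite (@dholds_layers t vars w t0 t F true _ _ _ T A _ _ (leqnn t) wA') ?subnn ?upd_same //; exact: recorded_upd.
Qed.
End QbfWord.

Definition chosen (i v : nat) := (9 <= v) && (v < 10 + i).

Lemma dfree_match I y : {subset dfree (d_match I y) <= [pred v | (v == y) || chosen I v]}.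
Proof.
elim: I => [|I IH] v; first by rewrite /= !inE orbb => ->.
rewrite -[dfree _]/([:: 10 + I, y, y, 10 + I & dfree (d_match I y)]) !inE.
by move=> /or4P[|||/orP[|/IH]]; rewrite ?inE /chosen; lia.
Qed.

Lemma dfree_between x y psi v : v \in dfree (d_between x y psi) ->
  (v == x) || (v == y) || (v != 8) && (v \in dfree psi).
Proof.
rewrite -[dfree _]/([seq j <- [:: x, 8, 8, y & dfree psi] | j != 8]) mem_filter !inE.
by case: (v == 8) => //=; case: (v == x); case: (v == y).
Qed.

Lemma dfree_child x y v : v \in dfree (d_child x y) -> (v == x) || (v == y).
Proof.
rewrite -[dfree _]/([:: x, y, y, x & dfree (d_between x y (DLe y 8))]) !inE.
move=> /or4P[->|->|->|/orP[->|/dfree_between]]; rewrite ?orbT //.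
by rewrite /= !inE; case: (v == x); case: (v == y) => //=; case: (v == 8).
Qed.

Lemma dfree_lit I x : {subset dfree (d_lit I x) <= [pred v | (v == x) || chosen I v]}.
Proof.
move=> v; rewrite -[dfree _]/([seq j <- dfree (d_child x 6) ++ dfree (d_match I 6) ++
   [seq j <- dfree (d_child 6 7) ++ dfree (d_match I 7) | j != 7] | j != 6]).
move: (@dfree_child x 6 v) (@dfree_child 6 7 v) (@dfree_match I 6 v) (@dfree_match I 7 v).
move: (dfree _) (dfree _) (dfree _) (dfree _) => c1 m1 c2 m2 H1 H2 H3 H4.
rewrite mem_filter !mem_cat mem_filter mem_cat inE => /andP[v6 /or3P[/H1|/H3|/andP[v7 /orP[/H2|/H4]]]].
all: rewrite ?inE; lia.
Qed.

Lemma dfree_layers I conj d x : {subset dfree (d_layers I conj d x) <= [pred v | (v == x) || chosen I v]}.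
Proof.
elim: d conj x => [|d IH] conj x v; first exact: dfree_lit.
have -> : dfree (d_layers I conj d.+1 x) = [seq j <- dfree (d_child x (9 - x)) ++
    dfree (d_layers I (~~ conj) d (9 - x)) | j != 9 - x] by case: conj.
by rewrite mem_filter mem_cat => /andP[vx /orP[/dfree_child|/IH]]; rewrite !inE (negPf vx) ?orbF /= => ->; rewrite ?orbT.
Qed.

Lemma dfree_guard x y v : v \in dfree (d_next x y) -> [|| v == x, v == y | v == 9].
Proof.
rewrite -[dfree _]/([:: x, y, y, 9 & dfree (d_between x y (DNot (d_zero 8)))]) !inE.
move=> /or4P[->|->|->|/orP[->|/dfree_between]]; rewrite ?orbT //.
by rewrite /= !inE; case: (v == x); case: (v == y) => //=; case: (v == 8).
Qed.

Lemma dfree_core t I : {subset dfree (d_core t I) <= chosen I}.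
Proof.
move=> v; rewrite -[dfree _]/([seq j <- dfree (d_next (9 + I) 4) ++ dfree (d_layers I true t 4) | j != 4]).
rewrite mem_filter mem_cat => /andP[v4 /orP[/dfree_guard|/dfree_layers]]; rewrite ?inE (negPf v4) //=;
  rewrite /in_mem /= /chosen; lia.
Qed.

Lemma dfree_steps Z i core : {subset dfree core <= chosen (i + size Z)} ->
  {subset dfree (d_steps Z i core) <= chosen i}.
Proof.
elim: Z i => [|z Z IH] i fc; first by move: fc; rewrite addn0.
have {}IH := IH i.+1; rewrite addSnnS in IH; have {}IH := IH fc.
move=> v.
have : v \in dfree (d_steps (z :: Z) i core) -> v \in
   [seq j <- dfree (d_next (9 + i) (10 + i)) ++ dfree (d_steps Z i.+1 core) | j != 10 + i] by case: (z) => [[]|].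
move=> /[apply]; rewrite mem_filter mem_cat => /andP[vi /orP[/dfree_guard|/IH]];
  rewrite /in_mem /= /chosen; move: vi; lia.
Qed.

Lemma dfree_qbf t bl : {subset dfree (d_qbf t bl) <= [:: 9]}.
Proof.
move=> v /dfree_steps; rewrite inE => H; suff : v \in chosen 0 by rewrite /in_mem /= /chosen; lia.
by apply: H; rewrite add0n; exact: dfree_core.
Qed.

Lemma vars_match I y : y != 2 -> dvars_ok (d_match I y).
Proof. by move=> y2; elim: I => [|I IH] /=; rewrite ?y2 //= IH; lia. Qed.

Lemma vars_lit I x : x != 2 -> dvars_ok (d_lit I x).
Proof. by move=> x2; rewrite /= !vars_match // x2. Qed.

Lemma vars_layers I conj d x : (x == 4) || (x == 5) -> dvars_ok (d_layers I conj d x).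
Proof.
elim: d conj x => [|d IH] conj x x45; first by apply: vars_lit; lia.
have := IH (~~ conj) (9 - x); rewrite (_ : (9 - x == 4) || (9 - x == 5)) => [/(_ isT) ok|]; last by lia.
by case: conj ok => /= ->; case/orP: x45 => /eqP ->.
Qed.

Lemma vars_steps Z i core : dvars_ok core -> dvars_ok (d_steps Z i core).
Proof.
move=> ok; elim: Z i => [//|z Z IH] i.
by case: z => [[]|]; rewrite /= IH.
Qed.

Lemma vars_qbf t bl : dvars_ok (d_qbf t bl).
Proof. by apply: vars_steps; rewrite /= vars_layers //; lia. Qed.

(** * Reading codes *)

(** [pfst] and [psnd] follow the program [undl] on malformed words too, where the top of an empty
    stack reads as [false]. Parsing then needs no validity hypothesis. *)
Fixpoint pfst (w : word) : word :=
  match w with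
  | true :: w1 => match w1 with b :: w2 => b :: pfst w2 | [::] => [:: false] end
  | _ => [::]
  end.

Fixpoint psnd (w : word) : word :=
  match w with
  | true :: w1 => match w1 with b :: w2 => psnd w2 | [::] => [::] end
  | _ :: w1 => w1
  | [::] => [::]
  end.

Lemma pfst_dl u v : pfst (dl u ++ v) = u.
Proof. by elim: u => //= b u ->. Qed.

Lemma psnd_dl u v : psnd (dl u ++ v) = v.
Proof. by elim: u => //= b u ->. Qed.

Lemma word_ind2 (P : word -> Prop) : P [::] -> (forall b, P [:: b]) ->
  (forall a b w, P w -> P [:: a, b & w]) -> forall w, P w.
Proof.
move=> P0 P1 P2 w; suff [] : P w /\ forall b, P (b :: w) by [].
by elim: w => [|a w [IH1 IH2]]; split=> // b; apply: P2.
Qed.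

Lemma size_psnd w : size (psnd w) <= size w.
Proof. by elim/word_ind2: w => [//|[]//|[] b w IH] //=; lia. Qed.

Lemma size_pfst w : size (pfst w) <= size w.
Proof. by elim/word_ind2: w => [//|[]//|[] b w IH] //=; lia. Qed.

Lemma runs_parse w x : runs (undl 0 1) (sto [:: w; x]) (5 * size w + 2) (sto [:: psnd w; catrev (pfst w) x]).
Proof.
suff H : forall x, exists w', behead w' = psnd w /\
    runs (While (TopIs1 0) (Comp (Pop 0)
     (Ite (TopIs1 0) (Comp (Pop 0) (Push 1 true)) (Comp (Pop 0) (Push 1 false)))))
     (sto [:: w; x]) (5 * size w + 1) (sto [:: w'; catrev (pfst w) x]).
  have [w' [<- H']] := H x; rewrite -[5 * size w + 2]/(5 * size w + (1 + 1)) addnA.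
  by apply: runs_comp H' _; apply: runs_eq (sto_pop _ _); sto_tac.
have stop v y : ~~ head false v -> runs (While (TopIs1 0) (Comp (Pop 0)
     (Ite (TopIs1 0) (Comp (Pop 0) (Push 1 true)) (Comp (Pop 0) (Push 1 false)))))
     (sto [:: v; y]) 1 (sto [:: v; y]).
  by move=> hv; exists 1 => //; apply: RunWhileF.
have step b v y : runs (Comp (Pop 0)
     (Ite (TopIs1 0) (Comp (Pop 0) (Push 1 true)) (Comp (Pop 0) (Push 1 false))))
     (sto [:: true :: b :: v; y]) 4 (sto [:: v; b :: y]).
  rewrite -[4]/(1 + (1 + 1).+1); apply: runs_comp (sto_pop _ _) _.
  apply: (@runs_ite b) => //=.
  by case: b; apply: runs_comp (sto_pop _ _) (sto_push _ _ _).
elim/word_ind2: w => [|[]|[] b w IH] y /=.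
- by exists [::]; split=> //; apply: runs_le (stop [::] y isT).
- exists [::]; split=> //.
  have [m mT rm] : runs (Comp (Pop 0)
     (Ite (TopIs1 0) (Comp (Pop 0) (Push 1 true)) (Comp (Pop 0) (Push 1 false))))
     (sto [:: [:: true]; y]) 4 (sto [:: [::]; false :: y]).
    rewrite -[4]/(1 + (1 + 1).+1); apply: runs_comp (sto_pop _ _) _.
    by apply: (@runs_ite false) => //=; apply: runs_comp (sto_pop _ _) (sto_push _ _ _).
  have [n nT rn] := stop [::] (false :: y) isT.
  exists (m + n).+1; first by lia.
  exact: RunWhileT rm rn.
- by exists [:: false]; split=> //; apply: runs_le (stop [:: false] y isT).
- have [w' [E [n nT rn]]] := IH (b :: y); exists w'; split=> //.
  have [m mT rm] := step b w y; exists (m + n).+1; first by lia.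
  exact: RunWhileT rm rn.
by exists (false :: b :: w); split=> //; apply: runs_le (stop (false :: b :: w) y isT); lia.
Qed.

Section Parse.
Variables (A : Type) (D : A -> Prop) (f : A -> word).

Lemma ptime_pfst g : ptime D f g -> ptime D f (fun a => pfst (g a)).
Proof.
move=> /ptime_comp; apply.
apply: (@ptimeI _ _ _ _ (Comp (undl 0 1) (Comp (cl 0) (mv 1 0)))
   (fun a => (5 * size (g a) + 2) + ((5 * size (g a)).+1 + (4 * size (g a)).+1)) (fun n => 15 * n + 4)); first by polyb_tac.
  by move=> a _; lia.
move=> a _; have := runs_parse (g a) [::]; rewrite (_ : sto _ = sto [:: g a]); last by sto_tac.
move=> /runs_comp; apply.
apply: runs_comp; first by apply: runs_le (sto_cl 0 _); rewrite /= ltnS leq_mul2l size_psnd.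
have := @sto_mv 1 0 [:: [::]; catrev (pfst (g a)) [::]] isT.
rewrite /= catrev_rev catrevE cats0 size_rev => H.
by apply: runs_eq (runs_le _ H); [sto_tac|rewrite ltnS leq_mul2l size_pfst].
Qed.

Lemma ptime_psnd g : ptime D f g -> ptime D f (fun a => psnd (g a)).
Proof.
move=> /ptime_comp; apply.
apply: (@ptimeI _ _ _ _ (Comp (undl 0 1) (cl 1))
   (fun a => (5 * size (g a) + 2) + (5 * size (g a)).+1) (fun n => 15 * n + 4)); first by polyb_tac.
  by move=> a _; lia.
move=> a _; have := runs_parse (g a) [::]; rewrite (_ : sto _ = sto [:: g a]); last by sto_tac.
move=> /runs_comp; apply.
have := @sto_cl 1 [:: psnd (g a); catrev (pfst (g a)) [::]].
rewrite /= {1}catrevE cats0 size_rev => H.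
by apply: runs_eq (runs_le _ H); [sto_tac|rewrite ltnS leq_mul2l size_pfst].
Qed.

End Parse.

Lemma ptime_iter_psnd A (D : A -> Prop) f g n : ptime D f g -> ptime D f (fun a => un (n a)) ->
  ptime D f (fun a => iter (n a) psnd (g a)).
Proof.
move=> pg pn; have [s ps S] := ptime_size pg.
apply: eq_ptimer (@ptime_iter _ _ f _ (fun a k => iter k psnd (g a)) s pn _ ps _ _) => //.
- by move=> a _; rewrite size_un.
- move=> a k Da _; apply: leq_trans (S a Da).
  by elim: k => //= k; apply: leq_trans; exact: size_psnd.
- by apply: (@ptime_psnd _ _ _ (fun ak => iter ak.2 psnd (g ak.1))); apply: ptime_skip; exact: ptime_arg.
Qed.

(** No end mark: appending lists is appending codes, and the end of the list is recognized by the
    word being exhausted. *)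
Definition lw (l : seq word) : word := flatten (map dl l).

Lemma lw_cons u l : lw (u :: l) = pr u (lw l). Proof. by []. Qed.
Lemma lw_cat l1 l2 : lw (l1 ++ l2) = lw l1 ++ lw l2. Proof. by rewrite /lw map_cat flatten_cat. Qed.

Lemma iter_psnd_lw l k : iter k psnd (lw l) = lw (drop k l).
Proof.
elim: k l => [|k IH] l; first by rewrite drop0.
rewrite iterSr; case: l => [|u l]; first by rewrite -[psnd _]/(lw [::]) IH.
by rewrite lw_cons /pr psnd_dl IH.
Qed.

Lemma nth_lw l k : pfst (iter k psnd (lw l)) = nth [::] l k.
Proof.
rewrite iter_psnd_lw -[in RHS](addn0 k) -nth_drop.
by case: (drop k l) => //= u l'; rewrite pfst_dl.
Qed.

Lemma flatten_below m N : m <= N ->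
  flatten [seq (if k < m then [:: true] else [::]) | k <- iota 0 N] = un m.
Proof.
move=> mN; rewrite -(subnKC mN) iotaD map_cat flatten_cat add0n.
have -> : [seq (if k < m then [:: true] else [::]) | k <- iota m (N - m)] = [seq [::] | _ <- iota m (N - m)].
  by apply/eq_in_map => k; rewrite mem_iota [k < m]ltnNge => /andP[-> _].
rewrite flatten_nil cats0 (eq_flatten_iota (h := fun=> [:: true])) => [|k -> //].
by elim: (m) (0) => //= n IH i; rewrite IH.
Qed.

Section Lists.
Variables (A : Type) (D : A -> Prop) (f : A -> word).

Lemma ptime_nth_lw l n : ptime D f (fun a => lw (l a)) -> ptime D f (fun a => un (n a)) ->
  ptime D f (fun a => nth [::] (l a) (n a)).
Proof.
move=> pl pn; apply: eq_ptimer (ptime_pfst (ptime_iter_psnd pl pn)) => a _.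
exact: nth_lw.
Qed.

Lemma ptime_size_lw l : ptime D f (fun a => lw (l a)) -> ptime D f (fun a => un (size (l a))).
Proof.
move=> pl; apply: (eq_ptimer _ (@ptime_bigcat _ _ _ _
  (fun a k => if iter k psnd (lw (l a)) != [::] then [:: true] else [::]) pl _)).
  move=> a _.
  rewrite (eq_map (g := fun k => if k < size (l a) then [:: true] else [::])); last first.
    move=> k; rewrite iter_psnd_lw -[k < _]subn_gt0 -size_drop.
    by case: (drop k (l a)) => [|[|b u] l0].
  apply: flatten_below.
  by elim: (l a) => // u l' IH; rewrite lw_cons /pr size_cat size_dl /=; lia.
apply: ptime_if; [|exact: ptime_cst|exact: ptime_cst].
by apply: ptime_nonempty; apply: ptime_iter_psnd; [exact: (ptime_up _ pl)|exact: ptime_k].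
Qed.
End Lists.

Lemma flatten_cons (T : Type) (x : seq T) s : flatten (x :: s) = x ++ flatten s.
Proof. by []. Qed.

(** * Writing sentences in polynomial time *)

Section Formulas.
Variables (A : Type) (D : A -> Prop) (f : A -> word).
Implicit Types (i j : A -> nat) (phi psi : A -> fo) (g h : A -> df).

Definition pfo phi := ptime D f (fun a => enc_fo (phi a)).
Definition pdf g := pfo (fun a => df_fo (g a)).
Definition pun i := ptime D f (fun a => un (i a)).

Lemma pun_cst n : pun (fun _ => n). Proof. exact: ptime_un_cst. Qed.

Lemma pun_add i j : pun i -> pun j -> pun (fun a => i a + j a).
Proof. exact: ptime_un_add. Qed.

Lemma pfo_tag3 (b1 b2 b3 : bool) (w : A -> word) : ptime D f w ->
  ptime D f (fun a => [:: b1; b2; b3] ++ w a).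
Proof. by move=> pw; do 3! apply: ptime_cons. Qed.

Lemma pfo_adj i j : pun i -> pun j -> pfo (fun a => FOAdj (i a) (j a)).
Proof. by move=> pi pj; apply/pfo_tag3/ptime_cat; apply: ptime_enc_nat. Qed.

Lemma pfo_not phi : pfo phi -> pfo (fun a => FONot (phi a)).
Proof. exact: pfo_tag3. Qed.

Lemma pfo_and phi psi : pfo phi -> pfo psi -> pfo (fun a => FOAnd (phi a) (psi a)).
Proof. by move=> pi pj; apply/pfo_tag3/ptime_cat. Qed.

Lemma pfo_or phi psi : pfo phi -> pfo psi -> pfo (fun a => FOOr (phi a) (psi a)).
Proof. by move=> pi pj; apply/pfo_tag3/ptime_cat. Qed.

Lemma pfo_ex i phi : pun i -> pfo phi -> pfo (fun a => FOEx (i a) (phi a)).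
Proof. by move=> pi pj; apply/pfo_tag3/ptime_cat => //; apply: ptime_enc_nat. Qed.

Lemma pfo_all i phi : pun i -> pfo phi -> pfo (fun a => FOAll (i a) (phi a)).
Proof. by move=> pi pj; apply/pfo_tag3/ptime_cat => //; apply: ptime_enc_nat. Qed.

Lemma pfo_tok i : pun i -> pfo (fun a => f_tok (i a)).
Proof. by move=> pi; apply: pfo_and; apply: pfo_not; apply: pfo_adj => //; exact: pun_cst. Qed.

Ltac pfo_tac := repeat first [ assumption | exact: pun_cst | apply: pun_add | apply: pfo_not
  | apply: pfo_and | apply: pfo_or | apply: pfo_adj | apply: pfo_ex | apply: pfo_all ].

Lemma pdf_lt i j : pun i -> pun j -> pdf (fun a => DLt (i a) (j a)).
Proof. by move=> pi pj; rewrite /pdf /= /f_lt; pfo_tac. Qed.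

Lemma pdf_le i j : pun i -> pun j -> pdf (fun a => DLe (i a) (j a)).
Proof. by move=> pi pj; rewrite /pdf /= /f_le; pfo_tac. Qed.

Lemma pdf_not g : pdf g -> pdf (fun a => DNot (g a)). Proof. exact: pfo_not. Qed.
Lemma pdf_and g h : pdf g -> pdf h -> pdf (fun a => DAnd (g a) (h a)). Proof. exact: pfo_and. Qed.
Lemma pdf_or g h : pdf g -> pdf h -> pdf (fun a => DOr (g a) (h a)). Proof. exact: pfo_or. Qed.

Lemma pdf_ex i g : pun i -> pdf g -> pdf (fun a => DEx (i a) (g a)).
Proof. by move=> pi pg; apply: pfo_ex => //; apply: pfo_and => //; exact: pfo_tok. Qed.

Lemma pdf_all i g : pun i -> pdf g -> pdf (fun a => DAll (i a) (g a)).
Proof. by move=> pi pg; apply: pfo_all => //; apply: pfo_or => //; apply/pfo_not/pfo_tok. Qed.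

Ltac pdf_tac := repeat first [ assumption | exact: pun_cst | apply: pun_add | apply: pdf_not
  | apply: pdf_and | apply: pdf_or | apply: pdf_lt | apply: pdf_le | apply: pdf_ex | apply: pdf_all ].

Lemma pdf_next i j : pun i -> pun j -> pdf (fun a => d_next (i a) (j a)).
Proof. by move=> pi pj; rewrite /d_next /d_between /d_zero; pdf_tac. Qed.

Lemma pdf_same i j : pun i -> pun j -> pdf (fun a => d_same (i a) (j a)).
Proof. by move=> pi pj; rewrite /d_same /d_between /d_zero; pdf_tac. Qed.

Lemma pdf_child i j : pun i -> pun j -> pdf (fun a => d_child (i a) (j a)).
Proof. by move=> pi pj; rewrite /d_child /d_between; pdf_tac. Qed.

Lemma pdf_eqv i j : pun i -> pun j -> pdf (fun a => d_eqv (i a) (j a)).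
Proof. by move=> pi pj; rewrite /d_eqv; pdf_tac. Qed.
End Formulas.

Section Formulas2.
Variables (A : Type) (D : A -> Prop) (f : A -> word).
Notation pdf := (pdf D f).
Notation pun := (pun D f).

(** [enc_fo] is in Polish notation, so the code of a nested disjunction is a concatenation of pieces
    closed by that of the base case, and the recursion becomes a loop with decreasing indices.
    [enc_steps] treats the quantifier steps in the same way. *)
Lemma pdf_match I y : pun I -> pdf (fun a => d_match (I a) y).
Proof.
move=> pI.
pose base := enc_fo (df_fo (DNot (DLe y y))).
pose g i := [:: true; false; false] ++ enc_fo (df_fo (d_eqv (10 + i) y)).
apply: (@eq_ptimer _ _ _ (fun a => flatten [seq g (I a - k.+1) | k <- iota 0 (size (un (I a)))] ++ base)).
  move=> a _; rewrite size_un; elim: (I a) => [//|n IH].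
  rewrite -[RHS]/([:: true; false; false] ++ enc_fo (df_fo (d_eqv (10 + n) y)) ++ enc_fo (df_fo (d_match n y))).
  rewrite catA -/(g n) -IH -[iota 0 n.+1]/(0 :: iota 1 n) -[1]addn0 iotaDl.
  rewrite map_cons -map_comp subn1 succnK flatten_cons -catA.
  by congr (_ ++ flatten _ ++ _); apply: eq_map => k; rewrite /comp add1n subSS.
apply: ptime_cat; last exact: ptime_cst.
apply: (@ptime_bigcat _ _ _ _ (fun a k => g (I a - k.+1)) pI).
apply/pfo_tag3/pdf_eqv; last exact: pun_cst.
apply: pun_add; first exact: pun_cst.
apply: ptime_un_sub; first exact: (ptime_up _ pI).
apply: (@eq_ptimer _ _ _ (fun ak => un (ak.2 + 1))); first by move=> ak _; rewrite addn1.
by apply: ptime_un_add; [exact: ptime_k|exact: ptime_un_cst].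
Qed.

Lemma pdf_lit I x : pun I -> pdf (fun a => d_lit (I a) x).
Proof.
move=> pI; rewrite /d_lit.
apply: pdf_ex; first exact: pun_cst.
apply: pdf_and; first by apply: pdf_child; exact: pun_cst.
apply: pdf_or; first exact: pdf_match.
apply: pdf_ex; first exact: pun_cst.
apply: pdf_and; first by apply: pdf_child; exact: pun_cst.
by apply: pdf_not; exact: pdf_match.
Qed.

Lemma pdf_layers I conj d x : pun I -> pdf (fun a => d_layers (I a) conj d x).
Proof.
move=> pI; elim: d conj x => [|d IH] conj x; first exact: pdf_lit.
case: conj.
  apply: (@pdf_all _ _ _ (fun=> 9 - x)); first exact: pun_cst.
  by apply: pdf_or => //; apply/pdf_not/pdf_child; exact: pun_cst.
apply: (@pdf_ex _ _ _ (fun=> 9 - x)); first exact: pun_cst.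
by apply: pdf_and => //; apply/pdf_child; exact: pun_cst.
Qed.

Lemma pdf_core t I : pun I -> pdf (fun a => d_core t (I a)).
Proof.
move=> pI; apply: pdf_ex; first exact: pun_cst.
apply: pdf_and; last exact: pdf_layers.
by apply: pdf_next; [apply: pun_add => //|]; exact: pun_cst.
Qed.
End Formulas2.

Definition zword (Z : seq (option bool)) : word :=
  flatten [seq (if z is Some b then [:: true; b] else [:: false; false]) | z <- Z].

Definition step_word (b c : bool) i : word :=
  if b then
    if c then [:: true; false; true] ++ enc_nat (10 + i) ++ [:: false; true; true] ++
      enc_fo (f_tok (10 + i)) ++ [:: false; true; true] ++ enc_fo (df_fo (d_same (9 + i) (10 + i)))
    else [:: true; true; false] ++ enc_nat (10 + i) ++ [:: true; false; false] ++
      enc_fo (FONot (f_tok (10 + i))) ++ [:: true; false; false] ++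
      enc_fo (FONot (df_fo (d_same (9 + i) (10 + i))))
  else [:: true; false; true] ++ enc_nat (10 + i) ++ [:: false; true; true] ++
      enc_fo (f_tok (10 + i)) ++ [:: false; true; true] ++ enc_fo (df_fo (d_next (9 + i) (10 + i))).

Lemma size_zword Z : size (zword Z) = (size Z).*2.
Proof. by elim: Z => //= -[b|] Z IH; rewrite /= IH. Qed.

Lemma enc_steps Z i core : enc_fo (df_fo (d_steps Z i core)) =
  flatten [seq step_word (nth false (zword Z) k.*2) (nth false (zword Z) k.*2.+1) (i + k)
    | k <- iota 0 (size Z)] ++ enc_fo (df_fo core).
Proof.
elim: Z i => [//|z Z IH] i.
rewrite -[iota 0 _]/(0 :: iota 1 (size Z)) -[1]addn0 iotaDl map_cons -map_comp addn0.
rewrite flatten_cons -catA.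
have -> : [seq ((fun k => step_word (nth false (zword (z :: Z)) k.*2) (nth false (zword (z :: Z)) k.*2.+1) (i + k)) \o addn 1) j | j <- iota 0 (size Z)]
   = [seq step_word (nth false (zword Z) k.*2) (nth false (zword Z) k.*2.+1) (i.+1 + k) | k <- iota 0 (size Z)].
  by apply: eq_map => k; rewrite /comp add1n addSnnS; case: z => [[]|].
rewrite -IH /step_word; case: z => [[]|].
- rewrite -[LHS]/([:: true; false; true] ++ enc_nat (10 + i) ++ [:: false; true; true] ++
      enc_fo (f_tok (10 + i)) ++ [:: false; true; true] ++ enc_fo (df_fo (d_same (9 + i) (10 + i))) ++
      enc_fo (df_fo (d_steps Z i.+1 core))).
  by rewrite !catA.
- rewrite -[LHS]/([:: true; true; false] ++ enc_nat (10 + i) ++ [:: true; false; false] ++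
      enc_fo (FONot (f_tok (10 + i))) ++ [:: true; false; false] ++
      enc_fo (FONot (df_fo (d_same (9 + i) (10 + i)))) ++ enc_fo (df_fo (d_steps Z i.+1 core))).
  by rewrite !catA.
- rewrite -[LHS]/([:: true; false; true] ++ enc_nat (10 + i) ++ [:: false; true; true] ++
      enc_fo (f_tok (10 + i)) ++ [:: false; true; true] ++ enc_fo (df_fo (d_next (9 + i) (10 + i))) ++
      enc_fo (df_fo (d_steps Z i.+1 core))).
  by rewrite !catA.
Qed.

Section Sentence.
Variable t : nat.

Lemma ptime_sentence : ptime (fun _ => True) zword
  (fun Z => enc_fo (df_sentence (d_steps Z 0 (d_core t (size Z))))).
Proof.
have pZ : pun (fun _ => True) zword size.
  apply: (@eq_ptimer _ _ _ (fun Z => un (size (zword Z))./2)) => [Z _|].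
    by rewrite size_zword doubleK.
  by apply/ptime_half/ptime_size_un/ptime_id.
apply: pfo_ex; first exact: pun_cst.
apply: pfo_ex; first exact: pun_cst.
apply: pfo_and; first exact: ptime_cst.
apply: (@eq_ptimer _ _ _ (fun Z => flatten [seq step_word (nth false (zword Z) k.*2) (nth false (zword Z) k.*2.+1) k
    | k <- iota 0 (size (un (size Z)))] ++ enc_fo (df_fo (d_core t (size Z))))) => [Z _|].
  by rewrite enc_steps size_un.
apply: ptime_cat; last exact: pdf_core.
apply: (@ptime_bigcat _ _ _ _ (fun Z k => step_word (nth false (zword Z) k.*2) (nth false (zword Z) k.*2.+1) k) pZ).
pose D := below (fun _ : seq (option bool) => True) (fun Z => un (size Z)).
have pk : pun D (withk zword) snd by exact: ptime_k.
have pk2 : pun D (withk zword) (fun ak => ak.2.*2).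
  apply: (@eq_ptimer _ _ _ (fun ak => un (2 * ak.2))) => [ak _|]; first by rewrite mul2n.
  by apply: ptime_un_mul => //; exact: ptime_un_cst.
have pk3 : pun D (withk zword) (fun ak => ak.2.*2.+1).
  apply: (@eq_ptimer _ _ _ (fun ak => un (ak.2.*2 + 1))) => [ak _|]; first by rewrite addn1.
  by apply: ptime_un_add => //; exact: ptime_un_cst.
have pw : ptime D (withk zword) (fun ak => zword ak.1) by apply/ptime_up/ptime_id.
have p10 D' : (forall ak, D' ak -> D ak) -> pun D' (withk zword) (fun ak => 10 + ak.2).
  by move=> sub; apply: pun_add; [exact: pun_cst|exact: ptime_weak sub pk].
have p9 D' : (forall ak, D' ak -> D ak) -> pun D' (withk zword) (fun ak => 9 + ak.2).
  by move=> sub; apply: pun_add; [exact: pun_cst|exact: ptime_weak sub pk].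
rewrite /step_word; apply: ptime_if; first exact: ptime_nth.
  apply: ptime_if; first by apply: ptime_weak (ptime_nth pw pk3) => ak [].
    have sub ak : (D ak /\ nth false (zword ak.1) ak.2.*2) /\ nth false (zword ak.1) ak.2.*2.+1 -> D ak by case=> -[].
    apply/pfo_tag3/ptime_cat; first exact/ptime_enc_nat/p10.
    apply/pfo_tag3/ptime_cat; first exact/pfo_tok/p10.
    by apply/pfo_tag3/pdf_same; [exact: p9|exact: p10].
  have sub ak : (D ak /\ nth false (zword ak.1) ak.2.*2) /\ ~~ nth false (zword ak.1) ak.2.*2.+1 -> D ak by case=> -[].
  apply/pfo_tag3/ptime_cat; first exact/ptime_enc_nat/p10.
  apply/pfo_tag3/ptime_cat; first exact/pfo_not/pfo_tok/p10.
  by apply/pfo_tag3/pfo_not/pdf_same; [exact: p9|exact: p10].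
have sub ak : D ak /\ ~~ nth false (zword ak.1) ak.2.*2 -> D ak by case.
apply/pfo_tag3/ptime_cat; first exact/ptime_enc_nat/p10.
apply/pfo_tag3/ptime_cat; first exact/pfo_tok/p10.
by apply/pfo_tag3/pdf_next; [exact: p9|exact: p10].
Qed.
End Sentence.

(** * Writing the hill and its adjacency matrix *)

Lemma enc_rat_nat k : enc_rat (k%:R)%R = false :: enc_nat k ++ false :: enc_nat 1.
Proof. by rewrite /enc_rat ssrint.pmulrn numq_int denq_int. Qed.

Lemma enc_seqE T (e : T -> word) (s : seq T) : enc_seq e s = flatten [seq true :: e x | x <- s] ++ [:: false].
Proof. by elim: s => //= x s ->; rewrite -catA. Qed.

Section HillCode.
Variables (A : Type) (D : A -> Prop) (f : A -> word) (n i j : A -> nat) (w : A -> seq nat).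
Hypotheses (pn : pun D f n) (pi : pun D f i) (pj : pun D f j).
Hypothesis pw : ptime D f (fun a => lw (map un (w a))).

Lemma pun_sub g h : pun D f g -> pun D f h -> pun D f (fun a => g a - h a).
Proof. exact: ptime_un_sub. Qed.
Lemma pun_mul g h : pun D f g -> pun D f h -> pun D f (fun a => g a * h a).
Proof. exact: ptime_un_mul. Qed.

Lemma pun_S g : pun D f g -> pun D f (fun a => (g a).+1).
Proof.
move=> pg; apply: (@eq_ptimer _ _ _ (fun a => un (g a + 1))) => [a _|]; first by rewrite addn1.
by apply: pun_add => //; exact: pun_cst.
Qed.

Lemma pun_size_word : pun D f (fun a => size (w a)).
Proof. by apply: eq_ptimer (ptime_size_lw pw) => a _; rewrite size_map. Qed.

Lemma ptime_pit : ptime D f (fun a => [:: is_pit (n a) (i a)]).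
Proof. by apply/ptime_odd/pun_sub. Qed.

Lemma pun_half : pun D f (fun a => (i a - n a)./2).
Proof. by apply/ptime_half/pun_sub. Qed.

Lemma pun_column : pun D f (fun a => column (n a) (i a)).
Proof.
apply: pun_add pun_half.
apply: (@eq_ptimer _ _ _ (fun a => un (i a - (i a - n a)))) => [a _|]; first by congr un; lia.
by do 2! apply: pun_sub => //.
Qed.

Lemma pun_value : pun D f (fun a => value (n a) (w a) (i a)).
Proof.
apply: eq_ptimer (ptime_nth_lw pw pun_half) => a _; rewrite /value.
have [lt|ge] := ltnP (i a - n a)./2 (size (w a)); first by rewrite (nth_map 0).
by rewrite !nth_default // size_map.
Qed.
End HillCode.

Section HillCode2.
Variables (A : Type) (D : A -> Prop) (f : A -> word) (n i j : A -> nat) (w : A -> seq nat).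
Hypotheses (pn : pun D f n) (pi : pun D f i) (pj : pun D f j).
Hypothesis pw : ptime D f (fun a => lw (map un (w a))).

Lemma ptime_sees : ptime D f (fun a => [:: sees (n a) (w a) (i a) (column (n a) (j a))]).
Proof.
apply: ptime_orb; apply: ptime_leq; try exact: pun_column; exact: pun_value.
Qed.
End HillCode2.

Section HillCode3.
Variables (A : Type) (D : A -> Prop) (f : A -> word) (n i j : A -> nat) (w : A -> seq nat).
Hypotheses (pn : pun D f n) (pi : pun D f i) (pj : pun D f j).
Hypothesis pw : ptime D f (fun a => lw (map un (w a))).

Lemma ptime_gadj : ptime D f (fun a => [:: (i a != j a) && gadj (n a) (w a) (i a) (j a)]).
Proof.
apply: ptime_andb; first exact/ptime_negb/ptime_eqn.
apply: (@eq_ptimer _ _ _ (fun a => if is_pit (n a) (i a) then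
   [:: ~~ is_pit (n a) (j a) && sees (n a) (w a) (i a) (column (n a) (j a))]
   else [:: ~~ is_pit (n a) (j a) || sees (n a) (w a) (j a) (column (n a) (i a))])) => [a _|].
  by rewrite /gadj; case: (is_pit _ (i a)); case: (is_pit _ (j a)).
apply: ptime_if; first exact: ptime_pit.
  apply: ptime_weak (ptime_andb (ptime_negb (ptime_pit pn pj)) (ptime_sees pn pi pj pw)) => a [] //.
apply: ptime_weak (ptime_orb (ptime_negb (ptime_pit pn pj)) (ptime_sees pn pj pi pw)) => a [] //.
Qed.

Lemma pun_M : pun D f (fun a => n a + size (w a)).
Proof. by apply: pun_add => //; exact: pun_size_word. Qed.

Lemma pun_px : pun D f (fun a => px (n a) (w a) (i a)).
Proof.
apply: (@eq_ptimer _ _ _ (fun a => if i a == 0 then [::] else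
   un ((n a + size (w a)).+1 * (n a + size (w a) + column (n a) (i a)) + (if is_pit (n a) (i a) then 1 else 0)))) => [a _|].
  by rewrite /px; case: eqP => // _; case: is_pit.
apply: ptime_if; [by apply: ptime_eqn => //; exact: pun_cst|exact: ptime_cst|].
apply: (@ptime_weak _ _ D) => [a []//|].
apply: pun_add; first apply: pun_mul; [exact/pun_S/pun_M|by apply: pun_add; [exact: pun_M|exact: pun_column]|].
apply: (@eq_ptimer _ _ _ (fun a => if is_pit (n a) (i a) then un 1 else un 0)) => [a _|]; first by case: is_pit.
by apply: ptime_if; [exact: ptime_pit|exact: ptime_cst|exact: ptime_cst].
Qed.

Lemma pun_py : pun D f (fun a => py (n a) (w a) (i a)).
Proof.
apply: (@eq_ptimer _ _ _ (fun a => if i a == 0 then [::] else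
   un ((n a + size (w a)).+1 * ((n a + size (w a)) * (n a + size (w a)) - column (n a) (i a) * column (n a) (i a)) -
     (if is_pit (n a) (i a) then column (n a) (i a) + value (n a) (w a) (i a) else 0)))) => [a _|].
  by rewrite /py; case: eqP.
have pM := pun_M; have pc := pun_column pn pi.
apply: ptime_if; [by apply: ptime_eqn => //; exact: pun_cst|exact: ptime_cst|].
apply: (@ptime_weak _ _ D) => [a []//|].
apply: pun_sub.
  by apply: pun_mul; [exact: pun_S|apply: pun_sub; exact: pun_mul].
apply: (@eq_ptimer _ _ _ (fun a => if is_pit (n a) (i a) then un (column (n a) (i a) + value (n a) (w a) (i a)) else un 0)) => [a _|]; first by case: is_pit.
apply: ptime_if; [exact: ptime_pit| |exact: ptime_cst].
by apply: (@ptime_weak _ _ D) => [a []//|]; apply: pun_add => //; exact: pun_value.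
Qed.

Lemma ptime_enc_rat (k : A -> nat) : pun D f k -> ptime D f (fun a => enc_rat ((k a)%:R)%R).
Proof.
move=> pk; apply: (@eq_ptimer _ _ _ (fun a => false :: enc_nat (k a) ++ false :: enc_nat 1)) => [a _|].
  by rewrite enc_rat_nat.
by apply/ptime_cons/ptime_cat; [exact: ptime_enc_nat|exact: ptime_cst].
Qed.
End HillCode3.

Section HillCode4.
Variables (A : Type) (D : A -> Prop) (f : A -> word) (n : A -> nat) (w : A -> seq nat).
Hypothesis pn : pun D f n.
Hypothesis pw : ptime D f (fun a => lw (map un (w a))).

Let N a := (lastv (n a) (w a)).+1.
Lemma pun_N : pun D f N.
Proof.
apply: pun_S; apply: pun_add => //; apply: pun_mul; first exact: pun_cst.
exact: pun_size_word.
Qed.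

Lemma ptime_hill_code : ptime D f (fun a => enc_seq (enc_pair enc_rat enc_rat) (hill (n a) (w a))).
Proof.
apply: (@eq_ptimer _ _ _ (fun a => flatten [seq true :: enc_rat ((px (n a) (w a) k)%:R)%R ++ enc_rat ((py (n a) (w a) k)%:R)%R
   | k <- iota 0 (size (un (N a)))] ++ [:: false])) => [a _|].
  by rewrite enc_seqE size_un /hill -map_comp.
apply: ptime_cat; last exact: ptime_cst.
apply: (@ptime_bigcat _ _ _ _ (fun a k => true :: enc_rat ((px (n a) (w a) k)%:R)%R ++ enc_rat ((py (n a) (w a) k)%:R)%R) pun_N).
have pn' := ptime_up (fun a => un (N a)) pn; have pw' := ptime_up (fun a => un (N a)) pw.
have pk := @ptime_k _ D f (fun a => un (N a)).
by apply/ptime_cons/ptime_cat; apply: ptime_enc_rat; [exact: pun_px pn' pk pw'|exact: pun_py pn' pk pw'].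
Qed.

Definition gbits n w := flatten [seq flatten [seq [:: (i != j) && gadj n w i j] | j <- iota 0 (lastv n w).+1] | i <- iota 0 (lastv n w).+1].

Lemma ptime_gbits : ptime D f (fun a => gbits (n a) (w a)).
Proof.
pose c a := un (N a).
apply: (@eq_ptimer _ _ _ (fun a => flatten [seq flatten [seq [:: (k != j) && gadj (n a) (w a) k j]
   | j <- iota 0 (size (c a))] | k <- iota 0 (size (c a))])) => [a _|]; first by rewrite size_un.
apply: (@ptime_bigcat _ _ _ _ (fun a k => flatten [seq [:: (k != j) && gadj (n a) (w a) k j] | j <- iota 0 (size (c a))]) pun_N).
have pn' := ptime_up c pn; have pw' := ptime_up c pw; have pk := @ptime_k _ D f c.
have pN' := ptime_up c pun_N.
apply: (@ptime_bigcat _ _ _ _ (fun ak j => [:: (ak.2 != j) && gadj (n ak.1) (w ak.1) ak.2 j]) pN').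
have pn2 := ptime_up (fun ak => c ak.1) pn'; have pw2 := ptime_up (fun ak => c ak.1) pw'.
have pk2 := ptime_up (fun ak => c ak.1) pk; have pj := @ptime_k _ (below D c) (withk f) (fun ak => c ak.1).
exact: (ptime_gadj pn2 pk2 pj pw2).
Qed.
End HillCode4.

(** The program evaluates the combinatorial [gadj]; [hill_graph] identifies the result with true
    visibility. *)
Lemma adjacency_hill (R : realType) n w : 0 < n -> (forall m, m < size w -> nth 0 w m < n) -> 0 < size w ->
  adjacency_bits R (hill n w) = gbits n w.
Proof.
move=> n0 wn w0; have sz : size (hill n w) = (lastv n w).+1 by exact: size_hill.
rewrite /adjacency_bits /gbits.
have E (g : nat -> nat -> bool) : (forall i j : 'I_(size (hill n w)), visibility_graph R i j = g i j) ->
  [seq visibility_graph R i j | i <- enum 'I_(size (hill n w)), j <- enum 'I_(size (hill n w))]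
  = flatten [seq flatten [seq [:: g i j] | j <- iota 0 (size (hill n w))] | i <- iota 0 (size (hill n w))].
  move=> Eg; rewrite -[in RHS](val_enum_ord (size (hill n w))) -map_comp; congr flatten.
  apply: eq_map => i; rewrite /= -map_comp.
  by elim: (enum _) => //= j s ->; rewrite Eg.
by rewrite (E (fun i j => (i != j) && gadj n w i j)) ?sz // => i j; exact: hill_graph.
Qed.

(** * Reduction to model checking *)

Section Scan.
Variables (S : Type) (es : S -> word) (step : S -> S).
Hypothesis pstep : ptime (fun _ => True) es (fun x => es (step x)).
Variables (A : Type) (D : A -> Prop) (f : A -> word) (init : A -> S).

Lemma ptime_iterate n t : polyb t ->
  (forall a k, D a -> k <= n a -> size (es (iter k step (init a))) <= t (size (f a))) ->
  ptime D f (fun a => es (init a)) -> pun D f n ->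
  ptime D f (fun a => es (iter (n a) step (init a))).
Proof.
move=> pt bound pi pn.
apply: eq_ptimer (@ptime_iter _ _ f _ (fun a k => es (iter k step (init a))) _ pn pi pt _ _) => //.
- by move=> a _; rewrite size_un.
- by move=> a k Da; rewrite size_un; exact: bound.
apply: (@ptime_comp _ _ _ (fun ak => es (iter ak.2 step (init ak.1)))); first exact/ptime_skip/ptime_arg.
by have := @ptime_sub (A * nat) S (fun ak => D ak.1 /\ ak.2 < size (un (n ak.1))) (fun _ => True)
  (fun ak => iter ak.2 step (init ak.1)) es (fun x => es (step x)) (fun _ _ => I) pstep.
Qed.

(** If a step lengthens the state by at most a constant, sizes grow linearly with the number of
    steps. *)
Lemma ptime_iterate_add K n : (forall x, size (es (step x)) <= size (es x) + K) ->
  ptime D f (fun a => es (init a)) -> pun D f n ->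
  ptime D f (fun a => es (iter (n a) step (init a))).
Proof.
move=> sK pi pn; have [s ps S1] := ptime_size pi; have [r pr R1] := ptime_size pn.
apply: (@ptime_iterate n (fun m => s m + K * r m)) => //; first by polyb_tac.
move=> a k Da kn; have := S1 a Da; have := R1 a Da; rewrite /= !size_un => rn si.
have : size (es (iter k step (init a))) <= size (es (init a)) + K * k.
  elim: k {kn} => [|k IH]; first exact: leq_addr.
  by rewrite iterS mulnS addnCA addnC; apply: leq_trans (sK _) _; rewrite leq_add2r.
by move=> /leq_trans; apply; rewrite leq_add // leq_mul2l (leq_trans kn rn) orbT.
Qed.

(** The [k]-th state is recomputed from the initial one at each turn. This costs a polynomial factor
    and leaves a loop without state of its own. *)
Lemma ptime_scan c (e : A -> S -> word) : ptime D f c ->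
  ptime (below D c) (withk f) (fun ak => es (iter ak.2 step (init ak.1))) ->
  ptime (fun ax : A * S => D ax.1) (fun ax => pr (es ax.2) (f ax.1)) (fun ax => e ax.1 ax.2) ->
  ptime D f (fun a => flatten [seq e a (iter k step (init a)) | k <- iota 0 (size (c a))]).
Proof.
move=> pc pi pe; apply: (@ptime_bigcat _ _ _ _ (fun a k => e a (iter k step (init a))) pc).
apply: (ptime_comp (ptime_pair pi (ptime_up c (ptime_id D f)))).
by apply: (@ptime_sub _ _ (below D c) (fun ax : A * S => D ax.1) (fun ak => (ak.1, iter ak.2 step (init ak.1)))
  (fun ax => pr (es ax.2) (f ax.1)) _ _ pe) => ak [].
Qed.
End Scan.

Section Emit.
Variables (S : Type) (step : S -> S) (e : S -> word).

(** From [x], [n] steps of the scan write [w] and lead to [y]. *)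
Definition emits x n w y := flatten [seq e (iter k step x) | k <- iota 0 n] = w /\ iter n step x = y.

Lemma emits1 x y w : e x = w -> step x = y -> emits x 1 w y.
Proof. by move=> <- <-; split; rewrite //= cats0. Qed.

Lemma emits_cat x y z m n u v : emits x m u y -> emits y n v z -> emits x (m + n) (u ++ v) z.
Proof.
move=> [<- <-] [<- <-]; split; last by rewrite addnC iterD.
rewrite iotaD map_cat flatten_cat add0n; congr (_ ++ flatten _).
rewrite -[m in iota m]addn0 iotaDl -map_comp; apply: eq_map => k /=.
by rewrite [m + k]addnC iterD.
Qed.

(** The scan may go on once the input is exhausted. *)
Lemma emits_idle x n w y N : emits x n w y -> n <= N -> (forall k, e (iter k step y) = [::]) ->
  flatten [seq e (iter k step x) | k <- iota 0 N] = w.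
Proof.
move=> H nN E; have : emits y (N - n) [::] (iter (N - n) step y).
  by split=> //; rewrite (eq_map E) flatten_nil.
by move=> /(emits_cat H)[]; rewrite subnKC // cats0.
Qed.
End Emit.

(** * Scanning the code of a quantified formula *)

Section QbfScan.
Variable t : nat.
Hypothesis t0 : 0 < t.

Definition qstate : Type := nat * word.
Definition enc_qstate (x : qstate) := pr (un x.1) x.2.

(** Modes 0 and 1 expect a block of the existential or universal player, modes
    2 and 3 are inside such a block, and mode [4 + d] is inside a layer of
    height [d] of the matrix. *)
Definition qstep (x : qstate) : qstate :=
  let: (m, u) := x in
  if head false u then
    if m < 2 then (m + 2, behead u) else
    if m < 4 then (m, psnd (behead u)) else
    if m == 5 then (m, psnd (behead (behead u))) else (m - 1, behead u)
  else
    if m < 2 then (4 + t, behead u) else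
    if m < 4 then (3 - m, psnd (behead u)) else (m + 1, behead u).

Variables (fblock froot : word) (fvar : word -> word) (fcount : bool -> word -> word)
  (flit : bool -> word -> word) (fnode : nat -> word).

(** One scan serves three outputs, according to the emitters chosen: the names of the variables, the
    quantifier steps and the data word. *)
Definition qemit (x : qstate) : word :=
  let: (m, u) := x in
  if head false u then
    if m < 2 then fblock else
    if m < 4 then fvar (pfst (behead u)) else
    if m == 5 then flit (nth false u 1) (pfst (behead (behead u))) else fnode (m - 5)
  else
    if m < 2 then froot else
    if m < 4 then fcount (m == 2) (pfst (behead u)) else [::].

Fixpoint emit_blocks ex (bl : seq (seq nat * nat)) : word :=
  if bl is b :: bl' then
    (fblock ++ flatten [seq fvar (nat_bits x) | x <- b.1] ++ fcount ex (nat_bits b.2)) ++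
    emit_blocks (~~ ex) bl'
  else [::].

(** A literal writes its own node through [flit], so [fnode] is omitted in front of it. *)
Fixpoint emit_tree d : tnorm d -> word :=
  match d with
  | 0 => fun l => flit l.1 (nat_bits l.2)
  | d'.+1 => fun F => flatten [seq (if d' is 0 then [::] else fnode d') ++ emit_tree G | G <- F]
  end.

Local Notation emits := (emits qstep qemit).

Lemma emits_vars ex s u : exists2 n, n <= size (enc_seq enc_nat s) &
  emits (if ex then 2 else 3, enc_seq enc_nat s ++ u) n.+1
    (flatten [seq fvar (nat_bits x) | x <- s] ++ fcount ex (pfst u)) (if ex then 1 else 0, psnd u).
Proof.
elim: s => [|x s [n le IH]]; first by exists 0 => //; apply: emits1; case: ex.
exists n.+1; first by rewrite /= size_cat; lia.
rewrite -[n.+2]add1n map_cons flatten_cons -catA; apply: emits_cat IH; apply: emits1.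
  by case: ex; rewrite /= -!catA /enc_nat pfst_dl.
by case: ex; rewrite /= -!catA /enc_nat psnd_dl.
Qed.

Lemma emits_blocks ex bl u : exists2 n, n < size (enc_seq (enc_pair (enc_seq enc_nat) enc_nat) bl) &
  emits (if ex then 0 else 1, enc_seq (enc_pair (enc_seq enc_nat) enc_nat) bl ++ u) n.+1
    (emit_blocks ex bl ++ froot) (4 + t, u).
Proof.
elim: bl ex => [|[s k] bl IH] ex; first by exists 0 => //; apply: emits1; case: ex.
have [n len Hn] := IH (~~ ex).
have [m lem Hm] := emits_vars ex s (enc_nat k ++ enc_seq (enc_pair (enc_seq enc_nat) enc_nat) bl ++ u).
exists (1 + m.+1 + n).
  rewrite -[enc_seq _ _]/([:: true] ++ (enc_seq enc_nat s ++ enc_nat k) ++ enc_seq (enc_pair (enc_seq enc_nat) enc_nat) bl).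
  have k0 : 0 < size (enc_nat k) by rewrite /enc_nat size_dl; lia.
  by rewrite !size_cat -[size [:: true]]/1; lia.
rewrite -addnS -[emit_blocks _ (_ :: _)]/((fblock ++ flatten [seq fvar (nat_bits x) | x <- s] ++ fcount ex (nat_bits k)) ++
    emit_blocks (~~ ex) bl) -catA.
rewrite [pfst (enc_nat k ++ _)]pfst_dl [psnd (enc_nat k ++ _)]psnd_dl in Hm.
apply: emits_cat; last by rewrite if_neg in Hn; exact: Hn.
apply: emits_cat Hm; apply: emits1; first by case: (ex).
by rewrite /= /enc_pair /= -!catA; case: (ex).
Qed.

Lemma emits_tree d (F : tnorm d.+1) u : exists2 n, n < size (enc_tnorm F) &
  emits (5 + d, enc_tnorm F ++ u) n.+1 (emit_tree F) (6 + d, u).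
Proof.
elim: d F u => [|d IH]; elim=> [|G F IHF] u; try by exists 0 => //; apply: emits1; rewrite //= addn1.
  have [n le Hn] := IHF u; exists n.+1.
    rewrite -[enc_tnorm _]/([:: true] ++ (@enc_tnorm 0 G) ++ @enc_tnorm 1 F) !size_cat -[size [:: true]]/1.
    by move: (size _) le => ? ?; lia.
  rewrite -[n.+2]add1n -[emit_tree _]/(flit G.1 (nat_bits G.2) ++ @emit_tree 1 F).
  apply: emits_cat Hn; apply: emits1; first by rewrite /= /enc_pair /= -!catA /enc_nat pfst_dl.
  by rewrite /= /enc_pair /= -!catA /enc_nat psnd_dl.
have [n le Hn] := IHF u; have [m lem Hm] := IH G (@enc_tnorm d.+2 F ++ u).
exists (1 + m.+1 + n).
  rewrite -[enc_tnorm _]/([:: true] ++ (@enc_tnorm d.+1 G) ++ @enc_tnorm d.+2 F) !size_cat -[size [:: true]]/1.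
  by move: (size _) (size _) lem le => ? ? ? ?; lia.
rewrite -addnS -[emit_tree _]/((fnode d.+1 ++ @emit_tree d.+1 G) ++ @emit_tree d.+2 F).
apply: emits_cat Hn; apply: emits_cat Hm.
apply: emits1; first by [].
rewrite -[enc_tnorm _]/(true :: (@enc_tnorm d.+1 G) ++ @enc_tnorm d.+2 F) /= -catA.
by rewrite subn1.
Qed.

Lemma qemit_scan (I : qbf_inst t) :
  flatten [seq qemit (iter k qstep (0, qbf_code I)) | k <- iota 0 (size (qbf_code I))] =
  emit_blocks true I.1 ++ froot ++ emit_tree I.2.
Proof.
have tree d (F : tnorm d) : 0 < d -> exists2 n, n < size (enc_tnorm F) &
    emits (4 + d, enc_tnorm F) n.+1 (emit_tree F) (5 + d, [::]).
  by case: d F => // d F _; have := emits_tree F [::]; rewrite cats0.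
have [m lem Hm] := tree t I.2 t0; have [n len Hn] := emits_blocks true I.1 (enc_tnorm I.2).
rewrite catA; apply: emits_idle (emits_cat Hn Hm) _ _; first by rewrite /qbf_code /enc_pair size_cat; exact: leq_add.
(* Once the code is exhausted the mode only increases and nothing is written, so one step per bit of
   the code is a safe number of steps. *)
move=> k; suff -> : iter k qstep (5 + t, [::]) = (5 + t + k, [::]) by [].
by elim: k => [|k IH]; [rewrite addn0|rewrite iterS IH /= addn1 addnS].
Qed.
End QbfScan.

Definition usearch (p : pred nat) n : word := flatten [seq (if p j then un j else [::]) | j <- iota 0 n].

Lemma usearchE p n k : k < n -> (forall j, j < n -> p j = (j == k)) -> usearch p n = un k.
Proof.
move=> kn pk; rewrite /usearch (eq_flatten_iota (h := fun j => if j == k then un j else [::])); last first.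
  by move=> j jn; rewrite pk.
have H i m : flatten [seq (if j == k then un j else [::]) | j <- iota i m] = if i <= k < i + m then un k else [::].
  elim: m i => [|m IH] i; first by rewrite addn0 ltnNge andbN.
  rewrite /= IH addSnnS; case: (i =P k) => [->|ik]; first by rewrite ltnn cats0 leqnn -addn1 leq_add2l.
  by rewrite [i < k]ltn_neqAle; move/eqP: ik => ->.
by rewrite H /= add0n kn.
Qed.

Lemma ptime_usearch A (D : A -> Prop) f (p : A -> pred nat) n : pun D f n ->
  (forall c, ptime (below D c) (withk f) (fun ak => [:: p ak.1 ak.2])) ->
  ptime D f (fun a => usearch (p a) (n a)).
Proof.
move=> pn pp; rewrite /usearch.
apply: (@eq_ptimer _ _ _ (fun a => flatten [seq (if p a j then un j else [::]) | j <- iota 0 (size (un (n a)))])) => [a _|].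
  by rewrite size_un.
apply: (@ptime_bigcat _ _ _ _ (fun a j => if p a j then un j else [::]) pn).
apply: ptime_if; [exact: pp| |exact: ptime_cst].
by apply: ptime_weak (@ptime_k _ D f (fun a => un (n a))) => a [].
Qed.

(** Unary decoding is polynomial only below a known bound, found here by search. It serves for the
    sizes of the blocks, which are at most the parameter, given in unary. *)
Definition dec_nat b w := usearch (fun j => nat_bits j == w) b.+1.

Lemma dec_natE b k : k <= b -> dec_nat b (nat_bits k) = un k.
Proof. by move=> kb; apply: usearchE => // j _; rewrite (inj_eq nat_bits_inj). Qed.

Lemma ptime_dec_nat A (D : A -> Prop) f b g : pun D f b -> ptime D f g ->
  ptime D f (fun a => dec_nat (b a) (g a)).
Proof.
move=> pb pg; apply: (@ptime_usearch _ _ _ (fun a j => nat_bits j == g a)); first exact: pun_S.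
by move=> c; apply: ptime_eqw; [exact/ptime_nat_bits/ptime_k|exact: ptime_up].
Qed.

Lemma ptime_has A (D : A -> Prop) f (p : A -> pred nat) n : pun D f n ->
  (forall c, ptime (below D c) (withk f) (fun ak => [:: p ak.1 ak.2])) ->
  ptime D f (fun a => [:: has (p a) (iota 0 (n a))]).
Proof.
move=> pn pp; apply: (@eq_ptimer _ _ _ (fun a =>
    [:: flatten [seq (if p a k then [:: true] else [::]) | k <- iota 0 (size (un (n a)))] != [::]])) => [a _|].
  by rewrite size_un; elim: (iota _ _) => //= k s; case: (p a k).
apply: ptime_nonempty.
apply: (@ptime_bigcat _ _ _ _ (fun a k => if p a k then [:: true] else [::]) pn).
by apply: ptime_if; [exact: pp|exact: ptime_cst|exact: ptime_cst].
Qed.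

Lemma ptime_index A (D : A -> Prop) f l g : ptime D f (fun a => lw (l a)) -> ptime D f g ->
  pun D f (fun a => index (g a) (l a)).
Proof.
move=> pl pg; have ps := ptime_size_lw pl.
(* The index is obtained by counting the [k] such that no entry up to [k] equals [g a]. *)
apply: (@eq_ptimer _ _ _ (fun a => flatten [seq (if has (fun j => (j <= k) && (nth [::] (l a) j == g a)) (iota 0 (size (l a)))
    then [::] else [:: true]) | k <- iota 0 (size (un (size (l a))))])) => [a _|].
  rewrite size_un (eq_flatten_iota (h := fun k => if k < index (g a) (l a) then [:: true] else [::])).
    exact/flatten_below/index_size.
  move=> k kl; rewrite ltnNge; suff -> : has (fun j => (j <= k) && (nth [::] (l a) j == g a)) (iota 0 (size (l a))) =
      (index (g a) (l a) <= k) by case: leqP.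
  apply/hasP/idP => [[j _ /andP[jk jg]]|ik].
    by apply: leq_trans _ jk; rewrite leqNgt; apply/negP => /(before_find [::]); rewrite /= jg.
  have il := leq_ltn_trans ik kl.
  by exists (index (g a) (l a)); rewrite ?mem_iota // ik nth_index ?eqxx // -index_mem.
apply: (@ptime_bigcat _ _ _ _ (fun a k => if has (fun j => (j <= k) && (nth [::] (l a) j == g a)) (iota 0 (size (l a)))
  then [::] else [:: true]) ps).
apply: ptime_if; [|exact: ptime_cst|exact: ptime_cst].
apply: (@ptime_has _ _ _ (fun ak j => (j <= ak.2) && (nth [::] (l ak.1) j == g ak.1)) (fun ak => size (l ak.1))).
  exact: (ptime_up _ ps).
move=> c; pose c' := fun a => un (size (l a)).
apply: ptime_andb; first by apply: ptime_leq; [exact: ptime_k|exact: (ptime_up c (@ptime_k _ D f c'))].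
apply: ptime_eqw; last exact: (ptime_up c (ptime_up c' pg)).
apply: ptime_nth_lw; last exact: ptime_k.
exact: (ptime_up c (ptime_up c' pl)).
Qed.

Section Scan.
Variable t : nat.

Lemma ptime_qstep : ptime (fun _ => True) enc_qstate (fun x => enc_qstate (qstep t x)).
Proof.
pose T := fun _ : qstate => True.
have pm : pun T enc_qstate fst by exact: ptime_arg.
have pu : ptime T enc_qstate snd by exact/ptime_skip/ptime_id.
have W (E : qstate -> Prop) g : ptime T enc_qstate g -> ptime E enc_qstate g by exact: ptime_weak.
pose st m u := pr (un m) u.
apply: (@eq_ptimer _ _ _ (fun x =>
  if head false x.2 then
    if x.1 < 2 then pr (un (x.1 + 2)) (behead x.2) else
    if x.1 < 4 then pr (un x.1) (psnd (behead x.2)) else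
    if x.1 == 5 then pr (un x.1) (psnd (behead (behead x.2))) else pr (un (x.1 - 1)) (behead x.2)
  else
    if x.1 < 2 then pr (un (4 + t)) (behead x.2) else
    if x.1 < 4 then pr (un (3 - x.1)) (psnd (behead x.2)) else pr (un (x.1 + 1)) (behead x.2))) => [[m u] _|].
  by rewrite /=; do 4! case: ifP => //.
have p2 : ptime T enc_qstate (fun x => [:: x.1 < 2]).
  by apply: (@ptime_leq _ _ _ (fun x => x.1.+1)); [exact: pun_S|exact: pun_cst].
have p4 : ptime T enc_qstate (fun x => [:: x.1 < 4]).
  by apply: (@ptime_leq _ _ _ (fun x => x.1.+1)); [exact: pun_S|exact: pun_cst].
have p5 : ptime T enc_qstate (fun x => [:: x.1 == 5]) by apply: ptime_eqn; [|exact: pun_cst].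
have pb := ptime_behead pu.
apply: ptime_if; first exact: ptime_head.
  apply: ptime_if; first exact: W; first by apply/W/ptime_pair => //; apply: pun_add => //; exact: pun_cst.
  apply: ptime_if; first exact: W; first by apply/W/ptime_pair => //; exact: ptime_psnd.
  apply: ptime_if; first exact: W; first by apply/W/ptime_pair => //; exact/ptime_psnd/ptime_behead.
  by apply/W/ptime_pair => //; apply: pun_sub => //; exact: pun_cst.
apply: ptime_if; first exact: W; first by apply/W/ptime_pair => //; exact: pun_cst.
apply: ptime_if; first exact: W.
  by apply/W/ptime_pair; [apply: pun_sub => //; exact: pun_cst|exact: ptime_psnd].
by apply/W/ptime_pair => //; apply: pun_add => //; exact: pun_cst.
Qed.

Lemma size_qstep x : size (enc_qstate (qstep t x)) <= size (enc_qstate x) + 2 * (4 + t).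
Proof.
case: x => m u; rewrite /enc_qstate /pr /=.
have H i v : size (dl (un i) ++ v) = 2 * i + 1 + size v by rewrite size_cat size_dl size_un; lia.
have := size_psnd (behead u); have := size_psnd (behead (behead u)); rewrite !size_behead.
by do ?[case: ifP => _ /=]; rewrite !H ?size_behead; lia.
Qed.

Variables (A : Type) (D : A -> Prop) (f c : A -> word).

Let E (ax : A * qstate) := D ax.1.
Let h (ax : A * qstate) := pr (enc_qstate ax.2) (f ax.1).

Lemma ptime_qscan (e : A -> qstate -> word) : ptime D f c -> ptime E h (fun ax => e ax.1 ax.2) ->
  ptime D f (fun a => flatten [seq e a (iter k (qstep t) (0, c a)) | k <- iota 0 (size (c a))]).
Proof.
move=> pc; apply: ptime_scan => //.
apply: (ptime_iterate_add ptime_qstep (init := fun ak => (0, c ak.1)) size_qstep); last exact: ptime_k.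
by apply: ptime_pair; [exact: ptime_cst|exact: ptime_up].
Qed.

Variables (fblock froot : word) (fvar : A -> word -> word) (fcount flit : A -> bool -> word -> word)
  (fnode : nat -> word).
Let E1 (aw : A * word) := D aw.1.
Let h1 (aw : A * word) := pr aw.2 (f aw.1).

Lemma ptime_qemit :
  ptime E1 h1 (fun aw => fvar aw.1 aw.2) ->
  (forall b, ptime E1 h1 (fun aw => fcount aw.1 b aw.2)) ->
  (forall b, ptime E1 h1 (fun aw => flit aw.1 b aw.2)) ->
  ptime (fun _ => True) un fnode ->
  ptime E h (fun ax => qemit fblock froot (fvar ax.1) (fcount ax.1) (flit ax.1) fnode ax.2).
Proof.
move=> pv pct pl pn.
have px : ptime E h (fun ax => enc_qstate ax.2) by exact: ptime_arg.
have pm : pun E h (fun ax => ax.2.1) by exact: ptime_fst px.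
have pu : ptime E h (fun ax => ax.2.2) by exact: ptime_snd px.
have pf : ptime E h (fun ax => f ax.1) by exact/ptime_skip/ptime_id.
have W (E' : _ -> Prop) g : (forall a, E' a -> E a) -> ptime E h g -> ptime E' h g by exact: ptime_weak.
have use g r : ptime E1 h1 (fun aw => g aw.1 aw.2) -> ptime E h r -> ptime E h (fun ax => g ax.1 (r ax)).
  move=> pg pr; apply: (ptime_comp (ptime_pair pr pf)).
  exact: (@ptime_sub _ _ E E1 (fun ax => (ax.1, r ax)) h1 _ (fun ax Ea => Ea) pg).
have useb (g : A -> bool -> word -> word) b r : (forall b, ptime E1 h1 (fun aw => g aw.1 b aw.2)) ->
    ptime E h (fun ax => [:: b ax]) -> ptime E h r -> ptime E h (fun ax => g ax.1 (b ax) (r ax)).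
  move=> pg pb pr; apply: (@eq_ptimer _ _ _ (fun ax => if b ax then g ax.1 true (r ax) else g ax.1 false (r ax))).
    by move=> ax _; case: (b ax).
  by apply: ptime_if => //; apply: W (use (fun a w => g a _ w) _ (pg _) pr) => ax [].
apply: (@eq_ptimer _ _ _ (fun ax =>
  if head false ax.2.2 then
    if ax.2.1 < 2 then fblock else
    if ax.2.1 < 4 then fvar ax.1 (pfst (behead ax.2.2)) else
    if ax.2.1 == 5 then flit ax.1 (nth false ax.2.2 1) (pfst (behead (behead ax.2.2))) else fnode (ax.2.1 - 5)
  else
    if ax.2.1 < 2 then froot else
    if ax.2.1 < 4 then fcount ax.1 (ax.2.1 == 2) (pfst (behead ax.2.2)) else [::])) => [[a [m u]]//|].
have p2 : ptime E h (fun x => [:: x.2.1 < 2]).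
  by apply: (@ptime_leq _ _ _ (fun x => x.2.1.+1)); [exact: pun_S|exact: pun_cst].
have p4 : ptime E h (fun x => [:: x.2.1 < 4]).
  by apply: (@ptime_leq _ _ _ (fun x => x.2.1.+1)); [exact: pun_S|exact: pun_cst].
have pe k : ptime E h (fun x => [:: x.2.1 == k]) by apply: ptime_eqn; [|exact: pun_cst].
have pb := ptime_behead pu.
apply: ptime_if; first exact: ptime_head.
  apply: ptime_if; [by apply: W p2 => a []|exact: ptime_cst|].
  apply: ptime_if; [by apply: W p4 => a [[]]| |].
    by apply: W (use fvar _ pv (ptime_pfst pb)) => a [[[]]].
  apply: ptime_if; [by apply: W (pe _) => a [[[]]]| |].
    apply: W (useb flit _ _ pl _ (ptime_pfst (ptime_behead pb))) => [a [[[[]]]]//|].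
    by apply: ptime_nth => //; exact: pun_cst.
  apply: (@ptime_weak _ _ E) => [a [[[[]]]]//|].
  apply: ptime_comp (pun_sub pm (pun_cst E h 5)) _.
  exact: (@ptime_sub _ _ _ (fun _ => True) (fun ax => ax.2.1 - 5) un _ _ pn).
apply: ptime_if; [by apply: W p2 => a []|exact: ptime_cst|].
apply: ptime_if; [by apply: W p4 => a [[]]| |exact: ptime_cst].
by apply: W (useb fcount _ _ pct (pe _) (ptime_pfst pb)) => a [[[]]].
Qed.

End Scan.

Section Outputs.
Implicit Types bl : seq (seq nat * nat).

Lemma emit_names bl : emit_blocks [::] dl (fun _ _ => [::]) true bl = lw (map nat_bits (flatten (map fst bl))).
Proof.
elim: bl true => [//|b bl IH] ex; rewrite [LHS]/= IH map_cat lw_cat; congr (_ ++ _).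
by rewrite /lw -map_comp cats0.
Qed.

Lemma emit_tree_nil d (F : tnorm d) : emit_tree (fun _ _ => [::]) (fun _ => [::]) F = [::].
Proof.
elim: d F => //= d IH F; elim: F => //= G F ->.
by rewrite IH; case: (d).
Qed.

Definition fsteps b (ex : bool) w := flatten [seq [:: true; ex] | _ <- iota 0 (size (dec_nat b w))].

Lemma emit_steps b bl : (forall k, k \in map snd bl -> k <= b) ->
  forall ex, emit_blocks [:: false; false] (fun _ => [::]) (fsteps b) ex bl = zword (block_steps ex bl).
Proof.
elim: bl => [//|[s k] bl IH] kb ex.
rewrite /= IH => [|j jb]; last by apply: kb; rewrite inE jb orbT.
have -> : flatten [seq [::] | _ <- s] = [::] :> word by elim: (s).
rewrite /fsteps dec_natE; last by apply: kb; rewrite inE eqxx.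
rewrite size_un -[zword (None :: _)]/([:: false; false] ++ zword (nseq k (Some ex) ++ block_steps (~~ ex) bl)).
rewrite /zword map_cat flatten_cat catA; congr ([:: _, _ & _] ++ _).
by elim: (k) (0) => //= n IHn j; rewrite -(IHn j.+1).
Qed.

Variables (t : nat) (vars : seq nat).
Let names := map nat_bits vars.
(** The letter of a variable comes from the rank of its binary name among all names; the number it
    denotes is not evaluated. *)
Definition fref t (names : seq word) w := dl (un (t + 2 + index w names)).
Definition flitw t names (b : bool) w := dl (un t) ++ (if b then [::] else dl (un t.+1)) ++ fref t names w.
Definition fnodew t d := dl (un (t - d)).

Lemma fref_vval x : fref t names (nat_bits x) = dl (un (vval t vars x)).
Proof. by rewrite /fref /names (index_map nat_bits_inj). Qed.

Lemma emit_words bl ex :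
  emit_blocks (dl (un 0)) (fref t names) (fun _ _ => [::]) ex bl = lw (map un (blocks_word t vars bl)).
Proof.
rewrite /blocks_word; elim: bl ex => [//|b bl IH] ex.
rewrite [LHS]/= IH [flatten _]/= map_cons map_cat lw_cons lw_cat cats0; congr (_ :: _ ++ _).
by rewrite /lw -map_comp; congr flatten; rewrite -map_comp; apply: eq_map => x; rewrite fref_vval.
Qed.

Lemma emit_tree_word d (F : tnorm d.+1) :
  dl (un (t - d.+1)) ++ emit_tree (flitw t names) (fnodew t) F = lw (map un (tree_word t vars F)).
Proof.
elim: d F => [|d IH] F; rewrite [tree_word _ _ _]/= map_cons lw_cons /pr; congr (_ ++ _).
  elim: F => //= l F ->; rewrite lw_cons map_cat lw_cat /flitw fref_vval.
  by case: l.1; rewrite /lw /pr -!catA /= ?cats0 -?catA.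
rewrite [RHS](_ : _ = lw (map un (flatten [seq @tree_word t vars d.+1 G | G <- F]))) //.
elim: F => [//|G F IHF].
rewrite -[flatten _]/(@tree_word t vars d.+1 G ++ flatten [seq @tree_word t vars d.+1 G | G <- F]).
rewrite -[emit_tree _ _ _]/((fnodew t d.+1 ++ @emit_tree (flitw t names) (fnodew t) d.+1 G) ++ @emit_tree (flitw t names) (fnodew t) d.+2 F).
by rewrite map_cat lw_cat -IH -IHF.
Qed.
End Outputs.

Lemma emit_tree_top t vars (F : tnorm t) : 0 < t ->
  dl (un 0) ++ emit_tree (flitw t (map nat_bits vars)) (fnodew t) F = lw (map un (tree_word t vars F)).
Proof. by case: t F => // d F _; rewrite -emit_tree_word subnn. Qed.

(** * Assembling the reduction from QBFSAT *)

Section Hardness.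
Variables (R : realType) (t : nat).
Hypothesis t0 : 0 < t.
Let A := qbf_inst t.
Let D := @qbf_valid t.
Let f (a : A) := pr (un (qbf_param a)) (qbf_code a).
Let vars (a : A) := flatten (map fst a.1).
Let E1 (aw : A * word) := D aw.1.
Let h1 (aw : A * word) := pr aw.2 (f aw.1).

Let pcode : ptime D f (@qbf_code t).
Proof. exact/ptime_skip/ptime_id. Qed.

Let pparam : pun D f (@qbf_param t).
Proof. exact: ptime_arg. Qed.

Lemma ptime_emissions fblock froot (fvar : A -> word -> word) fcount flit fnode :
  ptime E1 h1 (fun aw => fvar aw.1 aw.2) ->
  (forall b, ptime E1 h1 (fun aw => fcount aw.1 b aw.2)) ->
  (forall b, ptime E1 h1 (fun aw => flit aw.1 b aw.2)) ->
  ptime (fun _ => True) un fnode ->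
  ptime D f (fun a => emit_blocks fblock (fvar a) (fcount a) true a.1 ++ froot ++
    emit_tree (flit a) fnode a.2).
Proof.
move=> pv pct pl pn; have H := @ptime_qscan t A D f (@qbf_code t) (fun a => qemit fblock froot (fvar a) (fcount a) (flit a) fnode) pcode
  (ptime_qemit fblock froot pv pct pl pn).
apply: eq_ptimer H.
by move=> a _; exact: (qemit_scan t0).
Qed.

Lemma ptime_names : ptime D f (fun a => lw (map nat_bits (vars a))).
Proof.
apply: eq_ptimer (@ptime_emissions [::] [::] (fun _ => dl) (fun _ _ _ => [::]) (fun _ _ _ => [::]) (fun _ => [::]) _ _ _ _).
- by move=> a _; rewrite emit_names emit_tree_nil !cats0.
- exact/ptime_dl/ptime_arg.
- by move=> b; exact: ptime_cst.
- by move=> b; exact: ptime_cst.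
- exact: ptime_cst.
Qed.

Let up g : ptime D f g -> ptime E1 h1 (fun aw => g aw.1).
Proof.
move=> pg; apply: (@ptime_comp _ _ _ (fun aw => f aw.1)); first exact/ptime_skip/ptime_id.
exact: (@ptime_sub _ _ E1 D fst _ _ (fun _ Da => Da) pg).
Qed.

Lemma ptime_steps : ptime D f (fun a => zword (block_steps true a.1)).
Proof.
apply: eq_ptimer (@ptime_emissions [:: false; false] [::] (fun _ _ => [::]) (fun a => fsteps (qbf_param a))
  (fun _ _ _ => [::]) (fun _ => [::]) _ _ _ _).
- move=> a _; rewrite emit_tree_nil !cats0 emit_steps // => k kb.
  rewrite /qbf_param; apply: leq_trans (leq_addl _ _).
  elim: (map snd a.1) kb => //= j l IH; rewrite inE => /orP[/eqP ->|/IH]; lia.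
- exact: ptime_cst.
- move=> b; apply: (@ptime_bigcat _ _ _ (fun aw => dec_nat (qbf_param aw.1) aw.2) (fun _ _ => [:: true; b])); last exact: ptime_cst.
  by apply: ptime_dec_nat; [exact: (up pparam)|exact: ptime_arg].
- by move=> b; exact: ptime_cst.
- exact: ptime_cst.
Qed.

Lemma ptime_qword : ptime D f (fun a => lw (map un (qword (vars a) a.1 a.2))).
Proof.
have pref : ptime E1 h1 (fun aw => fref t (map nat_bits (vars aw.1)) aw.2).
  apply/ptime_dl/pun_add; first exact: pun_cst.
  by apply: ptime_index; [exact: (up ptime_names)|exact: ptime_arg].
have H := @ptime_emissions (dl (un 0)) (dl (un 0)) (fun a => fref t (map nat_bits (vars a))) (fun _ _ _ => [::])
  (fun a => flitw t (map nat_bits (vars a))) (fnodew t) pref _ _ _.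
apply: (@eq_ptimer _ _ _ (fun a => dl (un 0) ++ (emit_blocks (dl (un 0)) (fref t (map nat_bits (vars a))) (fun _ _ => [::]) true a.1 ++
   dl (un 0) ++ emit_tree (flitw t (map nat_bits (vars a))) (fnodew t) a.2) ++ dl (un 0) ++ dl (un (t + 2 + size (vars a))))).
  move=> a _.
  have tree : dl (un 0) ++ emit_tree (flitw t (map nat_bits (vars a))) (fnodew t) a.2 =
      lw (map un (tree_word t (vars a) a.2)).
    exact: emit_tree_top.
  rewrite emit_words // tree /qword map_cons lw_cons !map_cat !lw_cat; congr (_ ++ _).
  by rewrite -catA /lw /= cats0.
apply: ptime_cat; first exact: ptime_cst.
apply: ptime_cat.
  apply: H => [b|b|]; first exact: ptime_cst.
    apply: ptime_cat; first exact: ptime_cst.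
    by apply: ptime_cat => //; case: b; exact: ptime_cst.
  by apply/ptime_dl/ptime_un_sub; [exact: ptime_cst|exact: ptime_id].
apply: ptime_cat; first exact: ptime_cst.
apply/ptime_dl/pun_add; first exact: pun_cst.
by apply: eq_ptimer (ptime_size_lw ptime_names) => a _; rewrite size_map.
Qed.

Let y (a : A) : polygon * fo :=
  (hill (qsize t a.1) (qword (vars a) a.1 a.2), df_sentence (d_qbf t a.1)).

Lemma ptime_sentence_qbf : ptime D f (fun a => enc_fo (y a).2).
Proof.
apply: (ptime_comp ptime_steps).
exact: (@ptime_sub _ _ D (fun _ => True) (fun a : A => block_steps true a.1) _ _ (fun _ _ => I) (ptime_sentence t)).
Qed.

Lemma size_block_steps ex (bl : seq (seq nat * nat)) : size (block_steps ex bl) = size bl + sumn (map snd bl).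
Proof. by elim: bl ex => //= -[s k] bl IH ex; rewrite /= size_cat size_nseq IH /=; lia. Qed.

Let w0 a : 0 < size (qword (vars a) a.1 a.2).
Proof. exact: ltnW (qword_gt1 a.1 a.2 t0). Qed.

Let n0 (a : A) : 0 < qsize t a.1.
Proof. by rewrite /qsize; lia. Qed.

Lemma ptime_polygon : ptime D f (fun a => vis_code R (y a)).
Proof.
have pn : pun D f (fun a => qsize t a.1).
  apply: pun_add; first exact: pun_cst.
  by apply: eq_ptimer (ptime_size_lw ptime_names) => a _; rewrite size_map.
apply: (@eq_ptimer _ _ _ (fun a => enc_seq (enc_pair enc_rat enc_rat) (y a).1 ++
  dl (gbits (qsize t a.1) (qword (vars a) a.1 a.2)) ++ enc_fo (y a).2)) => [a [ua va]|].
  by rewrite /vis_code (adjacency_hill R (n0 a) (qword_bound t0 va) (w0 a)).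
apply: ptime_cat; first exact: ptime_hill_code pn ptime_qword.
apply: ptime_cat; last exact: ptime_sentence_qbf.
by apply: ptime_dl; exact: ptime_gbits pn ptime_qword.
Qed.

Lemma qbf_to_polygon (C : polygon -> Prop) : (forall W, terrain R W -> convex_fan R W -> C W) ->
  poly_reduces (QBFSAT t) (visibility_FOMC R C).
Proof.
move=> incl; have [s [c [d sb]] S] := ptime_size (ptime_sentence t).
(* For fixed [t] the sentence is computed from [zword] alone, whose length is twice the parameter.
   The size bound that comes with this computation bounds the new parameter. *)
exists y, (fun k => c * (k.*2).+1 ^ d).
split.
- move=> a [ua va]; have [|sp te fa] := @hill_polygon R _ _ (n0 a) _ (w0 a); first exact: qword_bound.
  by split=> //; [exact: incl|exact/df_sentenceP/dfree_qbf].
- by apply: ptime_pair; [exact/ptime_size_un/ptime_sentence_qbf|exact: ptime_polygon].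
- by apply: polyb_bound; exists 2, 1 => n; lia.
- move=> a Da; have := leq_trans (S (block_steps true a.1) I) (sb _).
  by rewrite size_zword [in X in _ <= X]size_block_steps.
- move=> a [ua va]; rewrite -[yes a]/(qbf_true true a.1 [::] a.2) -(qword_holds t0 va).
  have n1 : 1 < qsize t a.1 by rewrite /qsize; lia.
  apply: iff_sym; apply: (@models_df _ _ n1 (qword_bound t0 va) (qword_gt1 _ _ t0) _ (qword_last t0 va) (qword_tie _ _ t0)).
  - by [].
  - exact: size_hill.
  - exact: hill_graph (n0 a) (qword_bound t0 va) (w0 a).
  - exact: vars_qbf.
  - exact: dfree_qbf.
Qed.
End Hardness.

(** * Model checking as a game *)

Fixpoint fo_nodes (phi : fo) : nat :=
  match phi with
  | FOEq _ _ | FOAdj _ _ => 1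
  | FONot f => (fo_nodes f).+1
  | FOAnd f g | FOOr f g => (fo_nodes f + fo_nodes g).+1
  | FOEx _ f | FOAll _ f => (fo_nodes f).+1
  end.

(** The player to move at each node, in preorder, when the verifier claims that
    the formula has truth value [pol]; [true] is the verifier. *)
Fixpoint moves (phi : fo) (pol : bool) : seq bool :=
  match phi with
  | FOEq _ _ | FOAdj _ _ => [:: true]
  | FONot f => true :: moves f (~~ pol)
  | FOAnd f g => ~~ pol :: moves f pol ++ moves g pol
  | FOOr f g => pol :: moves f pol ++ moves g pol
  | FOEx _ f => pol :: moves f pol
  | FOAll _ f => ~~ pol :: moves f pol
  end.

Lemma size_moves phi pol : size (moves phi pol) = fo_nodes phi.
Proof.
by elim: phi pol => //= [f IH|f IHf g IHg|f IHf g IHg|i f IH|i f IH] pol; rewrite ?size_cat ?IH ?IHf ?IHg.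
Qed.

(** The claimed truth value, the quantifier nodes binding the variables, and
    literals that hold when the current node is not reached. *)
Definition ctx : Type := (bool * seq (word * nat)) * seq literal.

(** Node 0 is the default for an unbound name. A sentence has none, and the default keeps all values
    below the number of nodes, as [win_clauses] asks. *)
Definition binder (env : seq (word * nat)) w := (nth ([::], 0) env (index w (map fst env))).2.

Section Game.
Variables (n : nat) (b : nat -> nat -> bool).
Hypothesis n1 : 1 < n.

Definition atom_clauses (r : nat -> nat -> bool) (c : ctx) (wi wj : word) : seq (seq literal) :=
  flatten [seq flatten [seq (if r v w != c.1.1 then
      [:: c.2 ++ [:: (false, binder c.1.2 wi * n + v); (false, binder c.1.2 wj * n + w)]] else [::])
    | w <- iota 0 n] | v <- iota 0 n].

Definition ctx_not (c : ctx) : ctx := ((~~ c.1.1, c.1.2), c.2).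
(** The variable [u * n] says that 0, i.e. left, is played at node [u]. Negated for the left branch
    and plain for the right one, it holds exactly when the play does not enter that branch. *)
Definition ctx_side u side (c : ctx) : ctx := (c.1, (side, u * n) :: c.2).
Definition ctx_bind u w (c : ctx) : ctx := ((c.1.1, (w, u) :: c.1.2), c.2).

Fixpoint clauses (phi : fo) (u : nat) (c : ctx) : seq (seq literal) :=
  match phi with
  | FOEq i j => atom_clauses eqn c (nat_bits i) (nat_bits j)
  | FOAdj i j => atom_clauses b c (nat_bits i) (nat_bits j)
  | FONot f => clauses f u.+1 (ctx_not c)
  | FOAnd f g | FOOr f g => clauses f u.+1 (ctx_side u false c) ++
      clauses g (u.+1 + fo_nodes f) (ctx_side u true c)
  | FOEx i f | FOAll i f => clauses f u.+1 (ctx_bind u (nat_bits i) c)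
  end.

Definition block_vars u := [seq u * n + v | v <- iota 0 n].

(** Blocks alternate starting with an existential one, so each move takes two of them, the block of
    the idle player being empty. Two blocks and one chosen variable give a parameter of 3 per
    node. *)
Definition move_blocks u (ex : bool) : seq (seq nat * nat) :=
  if ex then [:: (block_vars u, 1); ([::], 0)] else [:: ([::], 0); (block_vars u, 1)].

Fixpoint game_blocks u (ms : seq bool) : seq (seq nat * nat) :=
  if ms is m :: ms' then move_blocks u m ++ game_blocks u.+1 ms' else [::].

(** A play assigns to every node a number below [n]: the value of the variable
    at a quantifier, and whether to go left (0) or right at a connective. *)
Fixpoint game (ms : seq bool) u (c : nat -> nat) (P : (nat -> nat) -> Prop) : Prop :=
  match ms with
  | [::] => P c
  | true :: ms' => exists2 v, v < n & game ms' u.+1 (upd c u v) P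
  | false :: ms' => forall v, v < n -> game ms' u.+1 (upd c u v) P
  end.

Definition play_vars (c : nat -> nat) u := [seq k * n + c k | k <- iota 0 u].

Lemma subseq_nil U : subseq U [::] -> U = [::] :> seq nat. Proof. by case: U. Qed.

Lemma subseq_block u (U : seq nat) : subseq U (block_vars u) /\ size U = 1 <-> exists2 v, v < n & U = [:: u * n + v].
Proof.
split=> [[]|[v vn ->]]; last first.
  by rewrite sub1seq; split=> //; apply/mapP; exists v => //; rewrite mem_iota.
case: U => [|x []] // + _; rewrite sub1seq => /mapP[v]; rewrite mem_iota => vn ->.
by exists v.
Qed.

Lemma qbf_game t (F : tnorm t) ms u c :
  qbf_true true (game_blocks u ms) (play_vars c u) F <->
  game ms u c (fun c' => tnorm_eval true (mem (play_vars c' (u + size ms))) F).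
Proof.
elim: ms u c => [|m ms IH] u c; first by rewrite addn0.
have E v : play_vars c u ++ [:: u * n + v] = play_vars (upd c u v) u.+1.
  rewrite /play_vars -addn1 iotaD map_cat /= upd_same add0n; congr (_ ++ _).
  by apply/eq_in_map => k; rewrite mem_iota => ku; rewrite upd_diff //; apply/eqP; lia.
rewrite -[size (m :: ms)]/(size ms).+1 addnS -addSn; case: m => /=.
  split=> [[U [sU zU H]]|[v vn /IH]].
    have [v vn UE] := (subseq_block u U).1 (conj sU zU); exists v => //; apply/IH.
    by have := H [::] isT erefl; rewrite cats0 UE E.
  have [sU zU] := (subseq_block u [:: u * n + v]).2 (ex_intro2 _ _ v vn erefl).
  by rewrite -E => H; exists [:: u * n + v]; split=> // U' /subseq_nil-> _; rewrite cats0.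
split=> [[U [/subseq_nil-> _ H]] v vn|H].
  have [sU zU] := (subseq_block u [:: u * n + v]).2 (ex_intro2 _ _ v vn erefl).
  by apply/IH; rewrite -E; have := H _ sU zU; rewrite cats0.
exists [::]; split=> // U sU zU; have [v vn ->] := (subseq_block u U).1 (conj sU zU).
by rewrite cats0 E; apply/IH/H.
Qed.

Definition extends u m (c c' : nat -> nat) :=
  (forall k, k < u \/ u + m <= k -> c' k = c k) /\ (forall k, u <= k < u + m -> c' k < n).

Lemma extends_step u m c c' v : v < n -> extends u.+1 m (upd c u v) c' -> extends u m.+1 c c'.
Proof.
move=> vn [H1 H2]; split=> k kP.
  have ku : u != k by case: kP => kP; apply/eqP; lia.
  rewrite (H1 k) ?upd_diff //; case: kP => kP; [left|right]; lia.
have [->|ku] := eqVneq k u; first by rewrite H1 ?upd_same //; left.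
by apply: H2; move/eqP: ku; lia.
Qed.

Lemma eq_game ms u c P P' : (forall c', extends u (size ms) c c' -> P c' <-> P' c') ->
  game ms u c P <-> game ms u c P'.
Proof.
elim: ms u c => [|m ms IH] u c H; first by apply: H; split=> // k; rewrite /=; lia.
have IH' v : v < n -> game ms u.+1 (upd c u v) P <-> game ms u.+1 (upd c u v) P'.
  by move=> vn; apply: IH => c' /(extends_step vn); exact: H.
case: m H => /= _; split.
- by move=> [v vn /(IH' v vn)]; exists v.
- by move=> [v vn /(IH' v vn)]; exists v.
- by move=> G v vn; apply/(IH' v vn)/G.
- by move=> G v vn; apply/(IH' v vn)/G.
Qed.

(** Both players always have a legal move, so once the outcome is settled playing on changes
    nothing. This disposes of the moves in a branch that is not taken. *)
Lemma game_cst ms u c (Q : Prop) : game ms u c (fun=> Q) <-> Q.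
Proof.
elim: ms u c => [//|[] ms IH] u c /=; split.
- by case=> v _ /IH.
- by move=> q; exists 0; [exact: ltnW|apply/IH].
- by move=> /(_ 0 (ltnW n1))/IH.
- by move=> q v vn; apply/IH.
Qed.

Lemma game_cat ms1 ms2 u c P : game (ms1 ++ ms2) u c P <->
  game ms1 u c (fun c' => game ms2 (u + size ms1) c' P).
Proof.
elim: ms1 u c => [|m ms IH] u c; first by rewrite addn0.
rewrite -[size (m :: ms)]/(size ms).+1 addnS -addSn; case: m => /=.
  by split=> -[v vn /IH]; exists v.
by split=> H v vn; apply/IH; exact: H.
Qed.

Fixpoint win (phi : fo) (pol : bool) u (s c : nat -> nat) : bool :=
  match phi with
  | FOEq i j => eqn (s i) (s j) == pol
  | FOAdj i j => b (s i) (s j) == pol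
  | FONot f => win f (~~ pol) u.+1 s c
  | FOAnd f g | FOOr f g =>
      if c u == 0 then win f pol u.+1 s c else win g pol (u.+1 + fo_nodes f) s c
  | FOEx i f | FOAll i f => win f pol u.+1 (upd s i (c u)) c
  end.

Lemma eq_win phi pol u s s' c c' : (forall i, i \in fo_free phi -> s i = s' i) ->
  (forall k, u <= k < u + fo_nodes phi -> c k = c' k) -> win phi pol u s c = win phi pol u s' c'.
Proof.
elim: phi pol u s s' => [i j|i j|f IH|f IHf g IHg|f IHf g IHg|i f IH|i f IH] pol u s s' ss cc /=.
- by rewrite !ss ?inE ?eqxx ?orbT.
- by rewrite !ss ?inE ?eqxx ?orbT.
- by apply: IH => // k kP; apply: cc; rewrite /=; lia.
- rewrite cc; last by rewrite /=; lia.
  case: ifP => _; [apply: IHf|apply: IHg] => [x xP|k kP|x xP|k kP]; try by apply: cc; rewrite /=; lia.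
    by apply: ss; rewrite /= mem_cat xP.
  by apply: ss; rewrite /= mem_cat xP orbT.
- rewrite cc; last by rewrite /=; lia.
  case: ifP => _; [apply: IHf|apply: IHg] => [x xP|k kP|x xP|k kP]; try by apply: cc; rewrite /=; lia.
    by apply: ss; rewrite /= mem_cat xP.
  by apply: ss; rewrite /= mem_cat xP orbT.
- rewrite cc; last by rewrite /=; lia.
  apply: IH => [x xP|k kP]; last by apply: cc; rewrite /=; lia.
  by rewrite /upd; case: eqP => // /eqP xi; apply: ss; rewrite /= mem_filter xi.
- rewrite cc; last by rewrite /=; lia.
  apply: IH => [x xP|k kP]; last by apply: cc; rewrite /=; lia.
  by rewrite /upd; case: eqP => // /eqP xi; apply: ss; rewrite /= mem_filter xi.
Qed.

Variable e : rel 'I_n.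
Hypothesis eb : forall i j, e i j = b i j.

(** Both subformulas are played out whatever is chosen at the connective. After a move to the left,
    the moves for [g] come last and no longer matter; after a move to the right, those for [f] come
    first and are forgotten. [game_cst] removes them in either case. *)
Lemma game_branch u (Ml Mr : seq bool) pol (f g : fo) (s : nat -> nat) c v (P : (nat -> nat) -> Prop) (hf hg : bool) :
  size Ml = fo_nodes f -> size Mr = fo_nodes g -> v < n ->
  (forall c P, (forall c', extends u.+1 (fo_nodes f) c c' -> P c' <-> win f pol u.+1 s c') -> game Ml u.+1 c P <-> hf) ->
  (forall c P, (forall c', extends (u.+1 + fo_nodes f) (fo_nodes g) c c' -> P c' <-> win g pol (u.+1 + fo_nodes f) s c') ->
     game Mr (u.+1 + fo_nodes f) c P <-> hg) ->
  (forall c', extends u (fo_nodes f + fo_nodes g).+1 c c' ->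
     P c' <-> (if c' u == 0 then win f pol u.+1 s c' else win g pol (u.+1 + fo_nodes f) s c')) ->
  game (Ml ++ Mr) u.+1 (upd c u v) P <-> if v == 0 then hf else hg.
Proof.
move=> sl sr vn IHf IHg HP; rewrite game_cat.
rewrite -sl -sr in IHg HP; rewrite -sl in IHf.
have ext c1 c2 : extends u.+1 (size Ml) (upd c u v) c1 -> extends (u.+1 + size Ml) (size Mr) c1 c2 ->
    extends u (size Ml + size Mr).+1 c c2 /\ c2 u = v.
  move=> [A1 A2] [B1 B2]; have uv : c2 u = v.
    by rewrite B1 ?A1 ?upd_same //; left; lia.
  split=> //; apply: (extends_step vn); split=> k kP.
    by rewrite B1 ?A1 //; case: kP => kP; [left|right|left|right]; lia.
  have [kl|kl] := ltnP k (u.+1 + size Ml); last by apply: B2; lia.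
  by rewrite B1; [apply: A2; lia|left].
have [v0|v0] := eqVneq v 0.
  apply: IHf => c1 ex1; rewrite -[X in _ <-> X](game_cst Mr (u.+1 + size Ml) c1).
  apply: eq_game => c2 ex2; have [/HP-> ->] := ext _ _ ex1 ex2; rewrite v0 eqxx.
  rewrite (@eq_win f pol u.+1 s s c2 c1) // => k kP; apply: ex2.1; left; rewrite sl; lia.
rewrite -[X in _ <-> X](game_cst Ml u.+1 (upd c u v)); apply: eq_game => c1 ex1.
apply: IHg => c2 ex2; have [/HP-> ->] := ext _ _ ex1 ex2.
by rewrite (negbTE v0).
Qed.

(** Claiming a truth value [pol] instead of truth handles negation: below it the claim is flipped
    and the players exchange roles. Two sides at a connective require [1 < n]. *)
Lemma game_win phi pol u (S : nat -> 'I_n) c P :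
  (forall c', extends u (fo_nodes phi) c c' -> P c' <-> win phi pol u (fun i => S i) c') ->
  game (moves phi pol) u c P <-> fo_holds e S phi == pol.
Proof.
move: phi pol u S c P; have n0 := ltnW n1.
have branch (Q : nat -> Prop) (a1 a2 : bool) : (forall v, v < n -> Q v <-> if v == 0 then a1 else a2) ->
    ((exists2 v, v < n & Q v) <-> a1 || a2) /\ ((forall v, v < n -> Q v) <-> a1 && a2).
  move=> H; split; split.
  - by case=> v vn /(H v vn); case: eqP => _ ->; rewrite ?orbT.
  - by case/orP=> h; [exists 0|exists 1] => //; apply/H.
  - by move=> h; have /(H 0 n0) /= -> := h 0 n0; have /(H 1 n1) /= -> := h 1 n1.
  - by case/andP=> h1 h2 v vn; apply/(H v vn); case: eqP.
have bind (pl : bool) i f (S' : nat -> 'I_n) (Q : nat -> Prop) :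
    (forall v : 'I_n, Q v <-> fo_holds e (upd S' i v) f == pl) ->
    ((exists2 v, v < n & Q v) <-> [exists v, fo_holds e (upd S' i v) f == pl]) /\
    ((forall v, v < n -> Q v) <-> [forall v, fo_holds e (upd S' i v) f == pl]).
  move=> H; split; split.
  - by case=> v vn q; apply/existsP; exists (Ordinal vn); apply/H.
  - by case/existsP=> v /H q; exists v.
  - by move=> h; apply/forallP => v; apply/H/h.
  - by move=> /forallP h v vn; apply/(H (Ordinal vn)).
have step i f (v : 'I_n) pol u S c P : (forall pol u (S : nat -> 'I_n) c P,
      (forall c', extends u (fo_nodes f) c c' -> P c' <-> win f pol u (fun i => S i) c') ->
      game (moves f pol) u c P <-> fo_holds e S f == pol) ->
    (forall c', extends u (fo_nodes f).+1 c c' -> P c' <-> win f pol u.+1 (upd (fun i => nat_of_ord (S i)) i (c' u)) c') ->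
    game (moves f pol) u.+1 (upd c u v) P <-> fo_holds e (upd S i v) f == pol.
  move=> IH HP; apply: IH => c' ex; rewrite (HP c' (extends_step (ltn_ord v) ex)).
  have -> : c' u = v by rewrite (ex.1 u) ?upd_same //; left.
  by rewrite (@eq_win f pol u.+1 _ (fun j => upd S i v j) c' c') // => j _; rewrite /upd; case: eqP.
elim=> [i j|i j|f IH|f IHf g IHg|f IHf g IHg|i f IH|i f IH] pol u S c P HP.
- have H : game [:: true] u c P <-> game [:: true] u c (fun=> eqn (S i) (S j) == pol) by exact: eq_game.
  by rewrite [moves _ _]/= H game_cst.
- have H : game [:: true] u c P <-> game [:: true] u c (fun=> b (S i) (S j) == pol) by exact: eq_game.
  by rewrite [moves _ _]/= H game_cst /= eb.
- have H v : v < n -> game (moves f (~~ pol)) u.+1 (upd c u v) P <-> fo_holds e S f == ~~ pol.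
    by move=> vn; apply: IH => c' /(extends_step vn); exact: HP.
  have -> : (fo_holds e S (FONot f) == pol) = (fo_holds e S f == ~~ pol) by rewrite /=; case: fo_holds; case: (pol).
  split=> [[v vn /(H v vn)] //|h]; exists 0; first exact: ltnW.
  by apply/(H 0 (ltnW n1)).
- have H v (vn : v < n) := @game_branch u (moves f pol) (moves g pol) pol f g _ c v P _ _
    (size_moves _ _) (size_moves _ _) vn (IHf pol u.+1 S) (IHg pol (u.+1 + fo_nodes f) S) HP.
  have [Hor Hand] := branch _ (fo_holds e S f == pol) (fo_holds e S g == pol) H.
  rewrite [moves _ _]/= [fo_holds _ _ _]/=; case: (pol) Hor Hand => Hor Hand; first by apply: iff_trans Hand _; case: fo_holds; case: fo_holds.
  by apply: iff_trans Hor _; case: fo_holds; case: fo_holds.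
- have H v (vn : v < n) := @game_branch u (moves f pol) (moves g pol) pol f g _ c v P _ _
    (size_moves _ _) (size_moves _ _) vn (IHf pol u.+1 S) (IHg pol (u.+1 + fo_nodes f) S) HP.
  have [Hor Hand] := branch _ (fo_holds e S f == pol) (fo_holds e S g == pol) H.
  rewrite [moves _ _]/= [fo_holds _ _ _]/=; case: (pol) Hor Hand => Hor Hand; first by apply: iff_trans Hor _; case: fo_holds; case: fo_holds.
  by apply: iff_trans Hand _; case: fo_holds; case: fo_holds.
- have [Hor Hand] := bind pol i f S (fun v => game (moves f pol) u.+1 (upd c u v) P) (fun v => step i f v pol u S c P IH HP).
  rewrite [moves _ _]/= [fo_holds _ _ _]/=; case: (pol) Hor Hand => Hor Hand.
    by apply: iff_trans Hor _; rewrite eqb_id; under eq_existsb do rewrite eqb_id.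
  apply: iff_trans Hand _; rewrite eqbF_neg negb_exists.
  by under eq_forallb do rewrite eqbF_neg.
- have [Hor Hand] := bind pol i f S (fun v => game (moves f pol) u.+1 (upd c u v) P) (fun v => step i f v pol u S c P IH HP).
  rewrite [moves _ _]/= [fo_holds _ _ _]/=; case: (pol) Hor Hand => Hor Hand.
    by apply: iff_trans Hand _; rewrite eqb_id; under eq_forallb do rewrite eqb_id.
  apply: iff_trans Hor _; rewrite eqbF_neg negb_forall.
  by under eq_existsb do rewrite eqbF_neg.
Qed.

Definition lit_true (T : pred nat) (l : literal) := if l.1 then T l.2 else ~~ T l.2.

Section Clauses.
Variables (T : pred nat) (c : nat -> nat) (m : nat).
Hypothesis TE : forall k v, k < m -> v < n -> T (k * n + v) = (c k == v).
Hypothesis cn : forall k, k < m -> c k < n.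

Lemma atom_clausesP r (x : ctx) wi wj : binder x.1.2 wi < m -> binder x.1.2 wj < m ->
  all (has (lit_true T)) (atom_clauses r x wi wj) =
  has (lit_true T) x.2 || (r (c (binder x.1.2 wi)) (c (binder x.1.2 wj)) == x.1.1).
Proof.
move=> im jm; rewrite /atom_clauses; set qi := binder _ wi; set qj := binder _ wj.
apply/allP/idP => [H|H cl].
  apply: contraT; rewrite negb_or => /andP[/negbTE nx rx].
  have : x.2 ++ [:: (false, qi * n + c qi); (false, qj * n + c qj)] \in flatten [seq flatten
     [seq (if r v w != x.1.1 then [:: x.2 ++ [:: (false, qi * n + v); (false, qj * n + w)]] else [::])
        | w <- iota 0 n] | v <- iota 0 n].
    apply/flatten_mapP; exists (c qi); first by rewrite mem_iota cn.
    by apply/flatten_mapP; exists (c qj); [rewrite mem_iota cn|rewrite rx inE].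
  by move=> /H; rewrite has_cat nx /= /lit_true /= !TE ?cn // !eqxx.
move=> /flatten_mapP[v]; rewrite mem_iota => /= vn /flatten_mapP[w]; rewrite mem_iota => /= wn.
case: ifP => // rx; rewrite inE => /eqP ->; rewrite has_cat.
case/orP: H => [->//|/eqP rE]; apply/orP; right.
rewrite /= /lit_true /= !TE // orbF -negb_and; apply: contraNN rx => /andP[/eqP <- /eqP <-].
exact/eqP.
Qed.

(** The literals of the context satisfy all clauses of a subformula missed by the play. At a
    connective the branch not entered is satisfied by its new literal, while in the other branch
    that literal is false: this is the case distinction of [win]. *)
Lemma win_clauses phi u s (x : ctx) : (forall w, binder x.1.2 w < m) -> u + fo_nodes phi <= m ->
  (forall i, s i = c (binder x.1.2 (nat_bits i))) ->
  all (has (lit_true T)) (clauses phi u x) = has (lit_true T) x.2 || win phi x.1.1 u s c.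
Proof.
have n0 := ltnW n1.
have bind (y : ctx) u' i s' : (forall w, binder y.1.2 w < m) -> u' < m -> (forall j, s' j = c (binder y.1.2 (nat_bits j))) ->
    (forall w, binder (ctx_bind u' (nat_bits i) y).1.2 w < m) /\
    (forall j, upd s' i (c u') j = c (binder (ctx_bind u' (nat_bits i) y).1.2 (nat_bits j))).
  move=> bm um sb; split=> [w|j]; rewrite /binder /=; first by case: ifP => _ //=; exact: bm.
  by rewrite (inj_eq nat_bits_inj) /upd eq_sym; case: ifP => //= _; exact: sb.
have side sd u' (y : ctx) : u' < m -> has (lit_true T) (ctx_side u' sd y).2 = (sd == (c u' == 0)) || has (lit_true T) y.2.
  by move=> um; rewrite /= {1}/lit_true -[_ * n]addn0 TE //=; case: sd => /=; rewrite ?eqbF_neg // eq_sym eqb_id.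
elim: phi u s x => [i j|i j|f IH|f IHf g IHg|f IHf g IHg|i f IH|i f IH] u s x bm um sb; rewrite /= in um *.
- by rewrite atom_clausesP // -!sb.
- by rewrite atom_clausesP // -!sb.
- by rewrite (IH _ s) //; lia.
- rewrite all_cat (IHf _ s) ?(IHg _ s) //; try lia.
  by rewrite !side; [case: (c u == 0); case: (has _ x.2); rewrite /= ?andbT|lia|lia].
- rewrite all_cat (IHf _ s) ?(IHg _ s) //; try lia.
  by rewrite !side; [case: (c u == 0); case: (has _ x.2); rewrite /= ?andbT|lia|lia].
- have [|bm' sb'] := bind x u i s bm _ sb; first by lia.
  by rewrite (IH _ (upd s i (c u))) //; lia.
- have [|bm' sb'] := bind x u i s bm _ sb; first by lia.
  by rewrite (IH _ (upd s i (c u))) //; lia.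
Qed.
End Clauses.

Definition ctx0 : ctx := ((true, [::]), [::]).

Lemma mem_play_vars (c : nat -> nat) m k v : (forall k, k < m -> c k < n) -> k < m -> v < n ->
  (k * n + v \in play_vars c m) = (c k == v).
Proof.
move=> cn km vn; apply/mapP/eqP => [[k']|<-]; last by exists k; rewrite ?mem_iota.
rewrite mem_iota add0n => k'm E; have ck := cn k' k'm.
have n0 := ltnW n1.
have : (k * n + v) %/ n = (k' * n + c k') %/ n by rewrite E.
rewrite !divnMDl // !divn_small // !addn0 => kk; move: E; rewrite kk; lia.
Qed.

Lemma game_models phi : sentence phi ->
  qbf_true (t := 2) true (game_blocks 0 (moves phi true)) [::] (clauses phi 0 ctx0) <-> fo_models e phi.
Proof.
move=> sen; have n0 := ltnW n1.
rewrite -[[::]]/(play_vars (fun=> 0) 0) qbf_game size_moves add0n.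
have H (S : nat -> 'I_n) : game (moves phi true) 0 (fun=> 0)
    (fun c => tnorm_eval (t := 2) true (mem (play_vars c (fo_nodes phi))) (clauses phi 0 ctx0)) <-> fo_holds e S phi == true.
  apply: game_win => c [_ cn].
  have cn' k : k < fo_nodes phi -> c k < n by exact: cn.
  have m0 : 0 < fo_nodes phi by case: (phi).
  have E := @win_clauses (mem (play_vars c (fo_nodes phi))) c _ (fun k v km vn => mem_play_vars cn' km vn) cn'
    phi 0 (fun=> c 0) ctx0 (fun=> m0) (leqnn _) (fun=> erefl).
  rewrite -[tnorm_eval _ _ _]/(all (has (lit_true (mem (play_vars c (fo_nodes phi))))) (clauses phi 0 ctx0)) E.
  by rewrite (@eq_win _ _ _ _ (fun i => S i) c c) // => i; rewrite sen.
split=> [G S|G]; first by have /(H S)/eqP := G.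
by apply/(H (fun=> Ordinal n0))/eqP/G.
Qed.

Lemma game_vars u ms : flatten (map fst (game_blocks u ms)) = iota (u * n) (size ms * n).
Proof.
elim: ms u => [|ex ms IH] u; first by rewrite mul0n.
rewrite -[size _]/(size ms).+1 mulSn iotaD -mulSnr -IH /=.
have -> : iota (u * n) n = block_vars u by rewrite -{1}[u * n]addn0 iotaDl.
by case: ex; rewrite /= ?cats0.
Qed.

Lemma clauses_bound m phi u (x : ctx) : (forall w, binder x.1.2 w < m) -> u + fo_nodes phi <= m ->
  all (fun l => l.2 < m * n) x.2 -> all (all (fun l : literal => l.2 < m * n)) (clauses phi u x).
Proof.
have n0 := ltnW n1.
have lt k v : k < m -> v < n -> k * n + v < m * n by move=> km vn; nia.
have atom r (y : ctx) wi wj : (forall w, binder y.1.2 w < m) -> all (fun l => l.2 < m * n) y.2 ->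
    all (all (fun l : literal => l.2 < m * n)) (atom_clauses r y wi wj).
  move=> bm xm; apply/allP => cl /flatten_mapP[v]; rewrite mem_iota => /= vn /flatten_mapP[w].
  rewrite mem_iota => /= wn; case: ifP => // _; rewrite inE => /eqP ->.
  by rewrite all_cat xm /= !lt.
have bind (y : ctx) u' i : (forall w, binder y.1.2 w < m) -> u' < m ->
    forall w, binder (ctx_bind u' (nat_bits i) y).1.2 w < m.
  by move=> bm um w; rewrite /binder /=; case: ifP => _ //=; exact: bm.
have side u' : u' < m -> u' * n < m * n by move=> um; rewrite ltn_pmul2r.
elim: phi u x => [i j|i j|f IH|f IHf g IHg|f IHf g IHg|i f IH|i f IH] u x bm um xm; rewrite /= in um *.
- exact: atom.
- exact: atom.
- by apply: IH => //; lia.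
- by rewrite all_cat IHf ?IHg //= ?side //; lia.
- by rewrite all_cat IHf ?IHg //= ?side //; lia.
- by apply: IH => //; [apply: bind => //; lia|lia].
- by apply: IH => //; [apply: bind => //; lia|lia].
Qed.

Lemma game_valid phi : qbf_valid (t := 2) (game_blocks 0 (moves phi true), clauses phi 0 ctx0).
Proof.
rewrite /qbf_valid /= game_vars size_moves; split; first exact: iota_uniq.
have m0 : 0 < fo_nodes phi by case: (phi).
have := @clauses_bound (fo_nodes phi) phi 0 ctx0 (fun=> m0) (leqnn _) isT.
move=> /allP H x /flatten_mapP[cl /H/allP clP] /flatten_mapP[l /clP lt].
by rewrite inE => /eqP ->; rewrite mem_iota.
Qed.

Lemma game_param phi : qbf_param (t := 2) (game_blocks 0 (moves phi true), clauses phi 0 ctx0) = 3 * fo_nodes phi.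
Proof.
rewrite /qbf_param /= -(size_moves phi true).
elim: (moves phi true) {1 2}0 => [//|ex ms IH] u.
rewrite -[game_blocks _ _]/(move_blocks u ex ++ game_blocks u.+1 ms) size_cat map_cat sumn_cat.
by have := IH u.+1; rewrite -[size (ex :: ms)]/(size ms).+1; case: ex => /=; lia.
Qed.
End Game.

(** * Reduction from model checking *)

Definition enc_lit : literal -> word := enc_pair enc_bool enc_nat.
Definition enc_path (p : seq literal) : word := flatten [seq true :: enc_lit l | l <- p].

Definition enc_ctx (c : ctx) : word :=
  c.1.1 :: pr (lw (map fst c.1.2)) (pr (lw (map (fun x => un x.2) c.1.2)) (enc_path c.2)).

(** The recursion on the sentence is run with an explicit stack: number of vertices, current node,
    unread code, and one context for each pending subformula. *)
Definition fstate : Type := (nat * nat) * (word * seq ctx).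

Definition enc_fstate (s : fstate) : word :=
  pr (un s.1.1) (pr (un s.1.2) (pr s.2.1 (lw (map enc_ctx s.2.2)))).

Section Step.

Definition tagbit k (w : word) := nth false w k.
(** Tests on the three tag bits of [enc_fo]. [is_not] and [is_bin] are conclusive only once the
    preceding cases are excluded; what then remains is a quantifier. *)
Definition is_atom w := ~~ tagbit 0 w && ~~ tagbit 1 w.
Definition is_not w := ~~ tagbit 0 w && ~~ tagbit 2 w.
Definition is_bin w := if tagbit 0 w then ~~ tagbit 1 w && ~~ tagbit 2 w else tagbit 2 w.

Definition fstep (s : fstate) : fstate :=
  let: ((n, u), (w, st)) := s in
  if st is c :: st' then
    let v := drop 3 w in
    ((n, u + 1),
     if is_atom w then (psnd (psnd v), st')
     else if is_not w then (v, ctx_not c :: st')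
     else if is_bin w then (v, ctx_side n u false c :: ctx_side n u true c :: st')
     else (psnd v, ctx_bind u (pfst v) c :: st'))
  else s.

Definition mover w pol :=
  if tagbit 0 w then if tagbit 1 w then ~~ pol else pol
  else if tagbit 1 w && tagbit 2 w then ~~ pol else true.

Variables (fmove : nat -> bool -> word) (fatom : bool -> ctx -> word -> word -> word).

(** Again one scan gives three outputs: the parameter, the blocks of moves and the clauses. *)
Definition femit (s : fstate) : word :=
  let: ((n, u), (w, st)) := s in
  if st is c :: _ then
    fmove u (mover w c.1.1) ++
    (if is_atom w then fatom (tagbit 2 w) c (pfst (drop 3 w)) (pfst (psnd (drop 3 w))) else [::])
  else [::].

Variable n : nat.

Fixpoint fout (phi : fo) u (c : ctx) : word :=
  match phi with
  | FOEq i j => fmove u true ++ fatom false c (nat_bits i) (nat_bits j)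
  | FOAdj i j => fmove u true ++ fatom true c (nat_bits i) (nat_bits j)
  | FONot f => fmove u true ++ fout f (u + 1) (ctx_not c)
  | FOAnd f g => fmove u (~~ c.1.1) ++ fout f (u + 1) (ctx_side n u false c) ++
      fout g (u + 1 + fo_nodes f) (ctx_side n u true c)
  | FOOr f g => fmove u c.1.1 ++ fout f (u + 1) (ctx_side n u false c) ++
      fout g (u + 1 + fo_nodes f) (ctx_side n u true c)
  | FOEx i f => fmove u c.1.1 ++ fout f (u + 1) (ctx_bind u (nat_bits i) c)
  | FOAll i f => fmove u (~~ c.1.1) ++ fout f (u + 1) (ctx_bind u (nat_bits i) c)
  end.

Lemma emits_fo phi u c st w :
  emits fstep femit ((n, u), (enc_fo phi ++ w, c :: st)) (fo_nodes phi) (fout phi u c)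
    ((n, u + fo_nodes phi), (w, st)).
Proof.
have pE i v : pfst (enc_nat i ++ v) = nat_bits i := pfst_dl _ _.
have sE i v : psnd (enc_nat i ++ v) = v := psnd_dl _ _.
elim: phi u c st w => [i j|i j|f IH|f IHf g IHg|f IHf g IHg|i f IH|i f IH] u c st w.
- by apply: emits1; rewrite /= /is_atom /= ?drop0 -?catA ?pE ?sE ?pE ?sE.
- by apply: emits1; rewrite /= /is_atom /= ?drop0 -?catA ?pE ?sE ?pE ?sE.
- rewrite -[fo_nodes _]/(1 + fo_nodes f) addnA; apply: emits_cat (IH _ _ _ _).
  by apply: emits1; rewrite /= ?drop0 ?cats0.
- rewrite -[fo_nodes _]/(1 + (fo_nodes f + fo_nodes g)) !addnA.
  rewrite -[X in emits _ _ _ X]addnA; apply: emits_cat; last first.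
    apply: emits_cat (IHg _ _ _ _); exact: IHf.
  by apply: emits1; rewrite /= ?drop0 -?catA ?cats0.
- rewrite -[fo_nodes _]/(1 + (fo_nodes f + fo_nodes g)) !addnA.
  rewrite -[X in emits _ _ _ X]addnA; apply: emits_cat; last first.
    apply: emits_cat (IHg _ _ _ _); exact: IHf.
  by apply: emits1; rewrite /= ?drop0 -?catA ?cats0.
- rewrite -[fo_nodes _]/(1 + fo_nodes f) addnA; apply: emits_cat (IH _ _ _ _).
  by apply: emits1; rewrite /= ?drop0 -?catA ?pE ?sE ?cats0.
- rewrite -[fo_nodes _]/(1 + fo_nodes f) addnA; apply: emits_cat (IH _ _ _ _).
  by apply: emits1; rewrite /= ?drop0 -?catA ?pE ?sE ?cats0.
Qed.

Lemma femit_scan phi c N : fo_nodes phi <= N ->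
  flatten [seq femit (iter k fstep ((n, 0), (enc_fo phi, [:: c]))) | k <- iota 0 N] = fout phi 0 c.
Proof.
move=> mN; have := emits_fo phi 0 c [::] [::]; rewrite cats0 => H.
(* With an empty stack the state is a fixed point of [fstep] and nothing more is written. *)
by apply: emits_idle H mN _ => k; rewrite (iter_fix k).
Qed.
End Step.

Lemma fo_nodes_size phi : fo_nodes phi <= size (enc_fo phi).
Proof. by elim: phi => *; rewrite /= ?size_cat; lia. Qed.

Section FoOutputs.
Variable n : nat.

Lemma fout_param phi u c : fout (fun _ _ => [:: true; true; true]) (fun _ _ _ _ => [::]) n phi u c = un (3 * fo_nodes phi).
Proof.
have E y : [:: true, true, true & nseq y true] = nseq (3 + y) true by [].
by elim: phi u c => [i j|i j|f IH|f IHf g IHg|f IHf g IHg|i f IH|i f IH] u c; rewrite // [fout _ _ _ _ _ _]/=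
  ?IH ?IHf ?IHg /un -?nseqD E; congr nseq; rewrite /=; lia.
Qed.

Lemma game_blocks_cat ms1 ms2 u :
  game_blocks n u (ms1 ++ ms2) = game_blocks n u ms1 ++ game_blocks n (u + size ms1) ms2.
Proof.
elim: ms1 u => [|ex ms IH] u; first by rewrite addn0.
by rewrite -[size (ex :: ms)]/(size ms).+1 addnS -addSn [LHS]/= IH catA.
Qed.

Definition enc_block : seq nat * nat -> word := enc_pair (enc_seq enc_nat) enc_nat.
Definition fblocks u ex := flatten [seq true :: enc_block p | p <- move_blocks n u ex].

Lemma fout_blocks phi u c : fout fblocks (fun _ _ _ _ => [::]) n phi u c =
  flatten [seq true :: enc_block p | p <- game_blocks n u (moves phi c.1.1)].
Proof.
have E ex ms v : flatten [seq true :: enc_block p | p <- game_blocks n v (ex :: ms)] =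
    fblocks v ex ++ flatten [seq true :: enc_block p | p <- game_blocks n (v + 1) ms].
  by rewrite addn1 -flatten_cat -map_cat.
have EC ms1 ms2 v : flatten [seq true :: enc_block p | p <- game_blocks n v (ms1 ++ ms2)] =
    flatten [seq true :: enc_block p | p <- game_blocks n v ms1] ++
    flatten [seq true :: enc_block p | p <- game_blocks n (v + size ms1) ms2].
  by rewrite game_blocks_cat map_cat flatten_cat.
by elim: phi u c => [i j|i j|f IH|f IHf g IHg|f IHf g IHg|i f IH|i f IH] u c;
  rewrite [fout _ _ _ _ _ _]/= [moves _ _]/= ?IH ?IHf ?IHg E ?EC ?size_moves.
Qed.

Definition fclauses (b : nat -> nat -> bool) (adj : bool) (c : ctx) wi wj :=
  flatten [seq true :: enc_tnorm (t := 1) cl | cl <- atom_clauses n (if adj then b else eqn) c wi wj].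

Lemma fout_clauses b phi u c : fout (fun _ _ => [::]) (fclauses b) n phi u c =
  flatten [seq true :: enc_tnorm (t := 1) cl | cl <- clauses n b phi u c].
Proof.
by elim: phi u c => [i j|i j|f IH|f IHf g IHg|f IHf g IHg|i f IH|i f IH] u c;
  rewrite [fout _ _ _ _ _ _]/= [clauses _ _ _ _ _]/= ?IH ?IHf ?IHg ?addn1 ?map_cat ?flatten_cat ?cats0.
Qed.

(** A clause is the path of the context followed by two literals; a path stored in encoded form
    without end mark can be copied as it is. *)
Lemma enc_path_clause (p : seq literal) l1 l2 : enc_tnorm (t := 1) (p ++ [:: l1; l2]) =
  enc_path p ++ (true :: enc_lit l1) ++ (true :: enc_lit l2) ++ [:: false].
Proof.
elim: p => [|l p IH]; first by rewrite /= /enc_lit /enc_path.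
by rewrite -[LHS]/((true :: enc_lit l) ++ enc_tnorm (t := 1) (p ++ [:: l1; l2])) IH /enc_path /= !catA.
Qed.

Lemma fclausesE b adj c wi wj : fclauses b adj c wi wj =
  flatten [seq flatten [seq (if (if adj then b v w else v == w) != c.1.1 then
      true :: enc_path c.2 ++ (true :: enc_lit (false, binder c.1.2 wi * n + v)) ++
        (true :: enc_lit (false, binder c.1.2 wj * n + w)) ++ [:: false] else [::])
    | w <- iota 0 n] | v <- iota 0 n].
Proof.
rewrite /fclauses /atom_clauses; move: {1 3}(iota 0 n) => r; elim: (iota 0 n) => [//|v s IH].
rewrite !map_cons !flatten_cons map_cat flatten_cat IH; congr (_ ++ _).
elim: r {IH} => [//|w r IHr]; rewrite !map_cons !flatten_cons map_cat flatten_cat IHr; congr (_ ++ _).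
by rewrite (_ : (if adj then b else eqn) v w = if adj then b v w else v == w); [|by case: (adj)]; case: ifP => // _; rewrite -enc_path_clause -[RHS]cats0.
Qed.
End FoOutputs.

Section Ctx.
Variables (A : Type) (E : A -> Prop) (h : A -> word) (c : A -> ctx).
Hypothesis pc : ptime E h (fun a => enc_ctx (c a)).

Lemma ptime_pol : ptime E h (fun a => [:: (c a).1.1]).
Proof. exact: ptime_head pc. Qed.

Let pb : ptime E h (fun a => pr (lw (map fst (c a).1.2)) (pr (lw (map (fun x => un x.2) (c a).1.2)) (enc_path (c a).2))).
Proof. exact: ptime_behead pc. Qed.

Lemma ptime_bound_names : ptime E h (fun a => lw (map fst (c a).1.2)).
Proof. exact: ptime_fst pb. Qed.

Lemma ptime_bound_nodes : ptime E h (fun a => lw (map (fun x => un x.2) (c a).1.2)).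
Proof. exact: ptime_fst (ptime_snd pb). Qed.

Lemma ptime_path : ptime E h (fun a => enc_path (c a).2).
Proof. exact: ptime_snd (ptime_snd pb). Qed.

Lemma ptime_binder w : ptime E h w -> pun E h (fun a => binder (c a).1.2 (w a)).
Proof.
move=> pw; apply: eq_ptimer (ptime_nth_lw ptime_bound_nodes (ptime_index ptime_bound_names pw)) => a _.
rewrite /binder; set k := index _ _.
have [lt|ge] := ltnP k (size (c a).1.2); first by rewrite (nth_map ([::], 0)).
by rewrite !nth_default ?size_map.
Qed.

Lemma ptime_ctx_not : ptime E h (fun a => enc_ctx (ctx_not (c a))).
Proof.
apply: (@eq_ptimer _ _ _ (fun a => [:: ~~ (c a).1.1] ++ behead (enc_ctx (c a)))) => [//|].
by apply: ptime_cat; [exact/ptime_negb/ptime_pol|exact: ptime_behead].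
Qed.

Variables (n u : A -> nat).
Hypotheses (pn : pun E h n) (pu : pun E h u).

Lemma ptime_ctx_side side : ptime E h (fun a => enc_ctx (ctx_side (n a) (u a) side (c a))).
Proof.
apply: (@eq_ptimer _ _ _ (fun a => [:: (c a).1.1] ++ pr (lw (map fst (c a).1.2))
    (pr (lw (map (fun x => un x.2) (c a).1.2)) (true :: side :: enc_nat (u a * n a) ++ enc_path (c a).2)))) => [//|].
apply: ptime_cat; first exact: ptime_pol.
apply: ptime_pair; first exact: ptime_bound_names.
apply: ptime_pair; first exact: ptime_bound_nodes.
by do 2! apply: ptime_cons; apply: ptime_cat; [exact/ptime_enc_nat/pun_mul|exact: ptime_path].
Qed.

Lemma ptime_ctx_bind w : ptime E h w -> ptime E h (fun a => enc_ctx (ctx_bind (u a) (w a) (c a))).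
Proof.
move=> pw.
apply: (@eq_ptimer _ _ _ (fun a => [:: (c a).1.1] ++ pr (pr (w a) (lw (map fst (c a).1.2)))
    (pr (pr (un (u a)) (lw (map (fun x => un x.2) (c a).1.2))) (enc_path (c a).2)))) => [//|].
apply: ptime_cat; first exact: ptime_pol.
apply: ptime_pair; first by apply: ptime_pair => //; exact: ptime_bound_names.
by apply: ptime_pair; [apply: ptime_pair => //; exact: ptime_bound_nodes|exact: ptime_path].
Qed.
End Ctx.

Definition top (s : fstate) := head ctx0 s.2.2.

Section State.
Variables (A : Type) (E : A -> Prop) (h : A -> word) (s : A -> fstate).
Hypothesis ps : ptime E h (fun a => enc_fstate (s a)).

Lemma ptime_vertices : pun E h (fun a => (s a).1.1).
Proof. exact: ptime_fst ps. Qed.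

Lemma ptime_node : pun E h (fun a => (s a).1.2).
Proof. exact: ptime_fst (ptime_snd ps). Qed.

Lemma ptime_rest : ptime E h (fun a => (s a).2.1).
Proof. exact: ptime_fst (ptime_snd (ptime_snd ps)). Qed.

Lemma ptime_stack : ptime E h (fun a => lw (map enc_ctx (s a).2.2)).
Proof. exact: ptime_snd (ptime_snd (ptime_snd ps)). Qed.

Lemma ptime_tag k : ptime E h (fun a => [:: tagbit k (s a).2.1]).
Proof. by apply: ptime_nth; [exact: ptime_rest|exact: pun_cst]. Qed.

Lemma ptime_body : ptime E h (fun a => drop 3 (s a).2.1).
Proof. by apply: ptime_drop; [exact: ptime_rest|exact: pun_cst]. Qed.

Lemma ptime_is_atom : ptime E h (fun a => [:: is_atom (s a).2.1]).
Proof. by apply: ptime_andb; apply: ptime_negb; exact: ptime_tag. Qed.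

Lemma ptime_is_not : ptime E h (fun a => [:: is_not (s a).2.1]).
Proof. by apply: ptime_andb; apply: ptime_negb; exact: ptime_tag. Qed.

Hypothesis ne : forall a, E a -> (s a).2.2 <> [::].

Lemma ptime_top : ptime E h (fun a => enc_ctx (top (s a))).
Proof.
apply: eq_ptimer (ptime_pfst ptime_stack) => a /ne; rewrite /top.
by case: (s a).2.2 => [//|c st] _; rewrite [map _ _]/= lw_cons /pr pfst_dl.
Qed.

Lemma ptime_pop : ptime E h (fun a => lw (map enc_ctx (behead (s a).2.2))).
Proof.
apply: eq_ptimer (ptime_psnd ptime_stack) => a /ne.
by case: (s a).2.2 => [//|c st] _; rewrite [map _ _]/= lw_cons /pr psnd_dl.
Qed.
End State.

Lemma ptime_is_bin A (E : A -> Prop) h s : ptime E h (fun a => enc_fstate (s a)) ->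
  ptime E h (fun a => [:: is_bin (s a).2.1]).
Proof.
move=> ps; apply: (@eq_ptimer _ _ _ (fun a => if tagbit 0 (s a).2.1 then [:: ~~ tagbit 1 (s a).2.1 && ~~ tagbit 2 (s a).2.1]
  else [:: tagbit 2 (s a).2.1])) => [a _|]; first by rewrite /is_bin; case: (tagbit 0).
have pt k := ptime_tag ps k.
apply: ptime_if => //; apply: (@ptime_weak _ _ E) => [a []//|] //.
by apply: ptime_andb; exact: ptime_negb.
Qed.

Lemma ptime_mover A (E : A -> Prop) h s pol : ptime E h (fun a => enc_fstate (s a)) ->
  ptime E h (fun a => [:: pol a]) -> ptime E h (fun a => [:: mover (s a).2.1 (pol a)]).
Proof.
move=> ps pp; have pt k := ptime_tag ps k; have pnp := ptime_negb pp.
have W (E' : A -> Prop) g : (forall a, E' a -> E a) -> ptime E h g -> ptime E' h g by exact: ptime_weak.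
apply: (@eq_ptimer _ _ _ (fun a => if tagbit 0 (s a).2.1 then if tagbit 1 (s a).2.1 then [:: ~~ pol a] else [:: pol a]
  else if tagbit 1 (s a).2.1 && tagbit 2 (s a).2.1 then [:: ~~ pol a] else [:: true])) => [a _|].
  by rewrite /mover; do ?case: ifP.
apply: ptime_if => //.
  by apply: ptime_if; [apply: W (pt 1) => a []|apply: W pnp => a [[]]|apply: W pp => a [[]]].
apply: ptime_if; [|by apply: W pnp => a [[]]|exact: ptime_cst].
by apply: W (ptime_andb (pt 1) (pt 2)) => a [].
Qed.

Lemma ptime_fstep : ptime (fun _ => True) enc_fstate (fun s => enc_fstate (fstep s)).
Proof.
apply: (@eq_ptimer _ _ _ (fun s => if lw (map enc_ctx s.2.2) != [::] then enc_fstate (fstep s) else enc_fstate s)).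
  by case=> [[n u] [w [|c st]]].
apply: ptime_if; first by apply: ptime_nonempty; exact: (ptime_stack (s := id) (ptime_id _ _)).
  set E := fun _ => _.
  have ne s : E s -> s.2.2 <> [::] by case=> _; case: s.2.2.
  have ps : ptime E enc_fstate enc_fstate by exact: ptime_id.
  have pn := ptime_vertices (s := id) ps; have pu := ptime_node (s := id) ps.
  have pv := ptime_body (s := id) ps; have pc := ptime_top (s := id) ps ne; have pst := ptime_pop (s := id) ps ne.
  have pt k := ptime_tag (s := id) ps k.
  have W (E' : fstate -> Prop) g : (forall a, E' a -> E a) -> ptime E enc_fstate g -> ptime E' enc_fstate g by exact: ptime_weak.
  apply: (@eq_ptimer _ _ _ (fun s => pr (un s.1.1) (pr (un (s.1.2 + 1))
    (let v := drop 3 s.2.1 in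
     if is_atom s.2.1 then pr (psnd (psnd v)) (lw (map enc_ctx (behead s.2.2)))
     else if is_not s.2.1 then pr v (pr (enc_ctx (ctx_not (top s))) (lw (map enc_ctx (behead s.2.2))))
     else if is_bin s.2.1 then pr v (pr (enc_ctx (ctx_side s.1.1 s.1.2 false (top s)))
       (pr (enc_ctx (ctx_side s.1.1 s.1.2 true (top s))) (lw (map enc_ctx (behead s.2.2)))))
     else pr (psnd v) (pr (enc_ctx (ctx_bind s.1.2 (pfst v) (top s))) (lw (map enc_ctx (behead s.2.2)))))))).
    case=> [[n u] [w [|c st]]] [_ //] _; rewrite /= /top /=.
    by case: is_atom => //; case: is_not => //; case: is_bin.
  apply: ptime_pair => //; apply: ptime_pair; first by apply: pun_add => //; exact: pun_cst.
  apply: ptime_if; first exact: (ptime_is_atom (s := id)).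
    by apply: (@ptime_weak _ _ E) => [a []//|]; apply: ptime_pair => //; do 2! apply: ptime_psnd.
  apply: ptime_if; first by apply: W (ptime_is_not (s := id) ps) => a [].
    by apply: (@ptime_weak _ _ E) => [a [[]]//|]; do 2! apply: ptime_pair => //; exact: ptime_ctx_not.
  apply: ptime_if; first by apply: W (ptime_is_bin (s := id) ps) => a [[]].
    by apply: (@ptime_weak _ _ E) => [a [[[]]]//|]; apply: ptime_pair => //; do 2! (apply: ptime_pair; first exact: ptime_ctx_side).
  apply: (@ptime_weak _ _ E) => [a [[[]]]//|]; apply: ptime_pair; first exact: ptime_psnd.
  by apply: ptime_pair => //; apply: ptime_ctx_bind => //; exact: ptime_pfst.
exact: ptime_id.
Qed.

Lemma size_nat_bits m : size (nat_bits m) <= m.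
Proof.
rewrite (nat_bits_flatten (leqnn m)); apply: leq_trans (size_flatten_le (m := 1) _) _.
  by move=> k _; case: ifP.
by rewrite size_iota muln1.
Qed.

Lemma size_lw l B : all (fun w => size w <= B) l -> size (lw l) <= size l * (2 * B + 1).
Proof. by elim: l => //= w l IH /andP[wB /IH]; rewrite lw_cons /pr size_cat size_dl mulSn; lia. Qed.

Lemma size_enc_ctx c : size (enc_ctx c) = 2 * size (lw (map fst c.1.2)) +
  2 * size (lw (map (fun x => un x.2) c.1.2)) + size (enc_path c.2) + 3.
Proof. by rewrite /enc_ctx /pr -cat1s !size_cat !size_dl -[size [:: _]]/1; lia. Qed.

Section Bound.
Variables (n K L : nat).
Let M := 4 * L + 4 * K + 2 * (K * n) + 7.

(** A step adds at most one context to the stack and lengthens a context by at most [M]: a binder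
    costs its name and its node in unary, a branch literal the digits of [u * n]. So [K] steps keep
    the state polynomial. *)
Lemma fstep_bound w k : size w <= L -> k <= K ->
  size (enc_fstate (iter k fstep ((n, 0), (w, [:: ctx0])))) <=
  2 * n + 2 * K + 2 * L + 3 + K.+1 * (2 * (3 + K * M) + 1).
Proof.
move=> wL kK; set s := iter _ _ _.
have [sn su sr ss sc] : [/\ s.1.1 = n, s.1.2 <= k, size s.2.1 <= L, size s.2.2 <= k.+1 &
    all (fun x => size (enc_ctx x) <= 3 + k * M) s.2.2].
  rewrite {}/s; elim: k kK => [|k IH] kK; first by split.
  rewrite iterS; case: (iter _ _ _) (IH (ltnW kK)) => [[n' u] [v st]] [/= -> uk vL].
  case: st => [|c st] /=; first by split=> //; lia.
  move=> sk /andP[cB stB].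
  have {}cB : size (enc_ctx c) <= 3 + k * M by exact: cB.
  have le x : x <= 3 + k * M -> x <= 3 + k.+1 * M by rewrite mulSn; lia.
  have {}stB : all (fun x => size (enc_ctx x) <= 3 + k.+1 * M) st by apply: sub_all stB => x; exact: le.
  have dL : size (drop 3 v) <= L by rewrite size_drop; lia.
  have pL : size (psnd (drop 3 v)) <= L by apply: leq_trans (size_psnd _) dL.
  have side sd : size (enc_ctx (ctx_side n u sd c)) <= 3 + k.+1 * M.
    have un : u * n <= K * n by rewrite leq_mul2r (leq_trans uk (ltnW kK)) orbT.
    have E : size (enc_path (ctx_side n u sd c).2) = 2 * size (nat_bits (u * n)) + 3 + size (enc_path c.2).
      by rewrite -[enc_path _]/([:: true; sd] ++ dl (nat_bits (u * n)) ++ enc_path c.2) !size_cat size_dl -[size [:: _; _]]/2; lia.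
    have := size_nat_bits (u * n); move: cB; rewrite !size_enc_ctx E.
    by rewrite [k.+1 * M]mulSn; move: (k * M) => y; rewrite /M -[(ctx_side _ _ _ _).1]/c.1; lia.
  have bind : size (enc_ctx (ctx_bind u (pfst (drop 3 v)) c)) <= 3 + k.+1 * M.
    have := size_pfst (drop 3 v); move: cB; rewrite !size_enc_ctx -[(ctx_bind _ _ _).2]/c.2.
    rewrite -[(ctx_bind _ _ _).1.2]/((pfst (drop 3 v), u) :: c.1.2) !map_cons [(_, u).1]/= [(_, u).2]/= !lw_cons /pr !size_cat !size_dl size_un.
    by rewrite [k.+1 * M]mulSn; move: (k * M) => y; rewrite /M; lia.
  case: is_atom => /=; first by split=> //; [lia|apply: leq_trans (size_psnd _) pL|lia].
  case: is_not => /=; first by split=> //; try lia; apply/andP; split=> //; exact: le.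
  case: is_bin => /=; split=> //; try lia.
    by apply/andP; split; [exact: side|apply/andP; split=> //; exact: side].
  by apply/andP; split=> //; exact: bind.
have -> : size (enc_fstate s) = 2 * n + 2 * s.1.2 + 2 * size s.2.1 + 3 + size (lw (map enc_ctx s.2.2)).
  by rewrite /enc_fstate /pr !size_cat !size_dl !size_un sn; lia.
have : size (lw (map enc_ctx s.2.2)) <= size s.2.2 * (2 * (3 + k * M) + 1).
  by rewrite -[size s.2.2](size_map enc_ctx); apply: size_lw; rewrite all_map.
have : size s.2.2 * (2 * (3 + k * M) + 1) <= K.+1 * (2 * (3 + K * M) + 1).
  apply: leq_mul; first by lia.
  by rewrite leq_add2r leq_mul2l /= leq_add2l leq_mul2r kK orbT.
lia.
Qed.
End Bound.

(** After the marker of [enc_seq], a vertex consists of four integers, two for each rational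
    coordinate, each a sign bit followed by a delimited number. *)
Definition skip_vertex (w : word) : word :=
  if head false w then iter 4 (fun v => psnd (behead v)) (behead w) else w.

Definition enc_vertex : rat * rat -> word := enc_pair enc_rat enc_rat.

Lemma emits_skip (W : polygon) u :
  emits skip_vertex (fun w => if head false w then [:: true] else [::]) (enc_seq enc_vertex W ++ u)
    (size W) (un (size W)) (false :: u).
Proof.
have int z v : psnd (behead (enc_int z ++ v)) = v by case: z => m; rewrite /= psnd_dl.
have skip1 v x : skip_vertex (true :: enc_vertex v ++ x) = x.
  rewrite /enc_vertex /enc_pair /enc_rat -!catA.
  by rewrite -[LHS]/(psnd (behead (psnd (behead (psnd (behead (psnd (behead (_ ++ _))))))))) !int.
elim: W => [//|v W IH]; rewrite -[size (v :: W)]/(1 + size W) -[un _]/([:: true] ++ un (size W)).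
apply: emits_cat IH; apply: emits1 => //.
by rewrite -[enc_seq _ _ ++ u]/(true :: (enc_vertex v ++ enc_seq enc_vertex W) ++ u) -catA skip1.
Qed.

Lemma ptime_skip_vertex : ptime (fun _ => True) id skip_vertex.
Proof.
apply: ptime_if; [exact/ptime_head/ptime_id| |exact: ptime_id].
by do 4! (apply/ptime_psnd/ptime_behead); apply/ptime_behead/ptime_id.
Qed.

Lemma size_skip_vertex w : size (skip_vertex w) <= size w + 0.
Proof.
rewrite addn0 /skip_vertex; case: ifP => // _.
have H v : size (psnd (behead v)) <= size v by apply: leq_trans (size_psnd _) _; rewrite size_behead; lia.
by do 4! apply: leq_trans (H _) _; rewrite size_behead; lia.
Qed.

Lemma nth_flatten_rows (T U : Type) (F : T -> seq U) x y (s : seq T) n v w : (forall i, size (F i) = n) ->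
  v < size s -> w < n -> nth y (flatten (map F s)) (v * n + w) = nth y (F (nth x s v)) w.
Proof.
move=> sF + wn; elim: s v => [//|i s IH] [|v] vs; rewrite /= nth_cat sF; first by rewrite wn.
by rewrite mulSn -addnA ltnNge leq_addr /= addKn IH.
Qed.

Lemma nth_adjacency (R : realType) (W : polygon) (i j : 'I_(size W)) :
  nth false (adjacency_bits R W) (i * size W + j) = visibility_graph R i j.
Proof.
rewrite (nth_flatten_rows i) ?size_enum_ord // => [|k]; last by rewrite size_map size_enum_ord.
by rewrite (nth_map j) ?size_enum_ord // !nth_ord_enum.
Qed.

Lemma ptime_ite A (D : A -> Prop) f g h b : ptime D f (fun a => [:: b a]) -> ptime D f g -> ptime D f h ->
  ptime D f (fun a => if b a then g a else h a).
Proof. by move=> pb pg ph; apply: ptime_if => //; [apply: ptime_weak pg|apply: ptime_weak ph] => a []. Qed.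

(** * Assembling the reduction to QBFSAT *)

Section Membership.
Variables (R : realType) (C : polygon -> Prop).
Let A := (polygon * fo)%type.
Let D := @vis_valid R C.
Let f (a : A) := pr (un (vis_param a)) (vis_code R a).
Let n (a : A) := size a.1.
Let bits (a : A) := adjacency_bits R a.1.
Let adj (a : A) v w := nth false (bits a) (v * n a + w).

Let pcode : ptime D f (vis_code R).
Proof. exact/ptime_skip/ptime_id. Qed.

(** [skip_vertex] is idle on the end mark of the vertex list, so the length of the code can serve as
    number of turns to reach the adjacency bits. *)
Lemma iter_skip (a : A) k : size a.1 <= k -> iter k skip_vertex (vis_code R a) = false :: dl (bits a) ++ enc_fo a.2.
Proof.
move=> ak; have [_ E] := emits_skip a.1 (dl (bits a) ++ enc_fo a.2).
rewrite -(subnK ak) iterD [X in iter _ _ X]E.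
by elim: (k - _) => // j IH; rewrite iterS IH.
Qed.

Lemma size_polygon_code (a : A) : size a.1 <= size (vis_code R a).
Proof.
rewrite /vis_code size_cat; apply: leq_trans (leq_addr _ _).
by elim: a.1 => //= v W; rewrite size_cat; lia.
Qed.

Lemma ptime_bits_fo : ptime D f (fun a => dl (bits a) ++ enc_fo a.2).
Proof.
have pc := pcode; have H := ptime_iterate_add ptime_skip_vertex size_skip_vertex pcode (ptime_size_un pc).
apply: eq_ptimer (ptime_behead H) => a _.
by rewrite iter_skip //; exact: size_polygon_code.
Qed.

Lemma ptime_bits : ptime D f bits.
Proof. exact: ptime_fst ptime_bits_fo. Qed.

Lemma ptime_formula : ptime D f (fun a => enc_fo a.2).
Proof. exact: ptime_snd ptime_bits_fo. Qed.

Lemma ptime_n : pun D f n.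
Proof.
have pc := pcode.
have H := @ptime_scan word id skip_vertex A D f (vis_code R) (vis_code R) (fun _ w => if head false w then [:: true] else [::]) pc.
apply: (eq_ptimer _ (H _ _)).
- move=> a _; apply: (emits_idle (emits_skip a.1 (dl (bits a) ++ enc_fo a.2)) (size_polygon_code a)).
  move=> k; suff -> : iter k skip_vertex (false :: dl (bits a) ++ enc_fo a.2) = false :: dl (bits a) ++ enc_fo a.2 by [].
  by elim: k => // k IH; rewrite iterS IH.
- apply: (ptime_iterate_add ptime_skip_vertex (init := fun ak => vis_code R ak.1) size_skip_vertex); last exact: ptime_k.
  exact: ptime_up.
- by apply: ptime_if; [exact/ptime_head/ptime_arg|exact: ptime_cst|exact: ptime_cst].
Qed.

Let init (a : A) : fstate := ((n a, 0), (enc_fo a.2, [:: ctx0])).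

Lemma ptime_fo_states : ptime (below D (fun a => enc_fo a.2)) (withk f) (fun ak => enc_fstate (iter ak.2 fstep (init ak.1))).
Proof.
pose t N := 2 * N + 2 * N + 2 * N + 3 + (N + 1) * (2 * (3 + N * (4 * N + 4 * N + 2 * (N * N) + 7)) + 1).
apply: (@ptime_iterate _ enc_fstate fstep ptime_fstep _ _ _ (fun ak => init ak.1) snd t); first by rewrite /t; polyb_tac.
- move=> [a j] k [/= _ ja] kj; have jN : j <= size (withk f (a, j)).
    by rewrite /withk /pr size_cat size_dl size_un /=; lia.
  have fN : size (vis_code R a) <= size (withk f (a, j)).
    by rewrite /withk /f /pr /= !size_cat; lia.
  have nN := leq_trans (size_polygon_code a) fN.
  have LN : size (enc_fo a.2) <= size (withk f (a, j)).
    by apply: leq_trans fN; rewrite /vis_code !size_cat; lia.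
  move: (size (withk f (a, j))) jN nN LN => N jN nN LN.
  apply: leq_trans (@fstep_bound (n a) N N _ k LN (leq_trans kj jN)) _.
  have NnN : 4 * N + 4 * N + 2 * (N * n a) + 7 <= 4 * N + 4 * N + 2 * (N * N) + 7.
    by rewrite leq_add2r leq_add2l leq_mul2l leq_mul2l nN !orbT.
  rewrite /t [N + 1]addn1; apply: leq_add; first by move: nN; rewrite /n /=; lia.
  by rewrite leq_mul2l leq_add2r leq_mul2l leq_add2l leq_mul2l NnN !orbT.
- apply: ptime_pair; first exact: (ptime_up _ ptime_n).
  apply: ptime_pair; first exact: ptime_cst.
  by apply: ptime_pair; [exact: (ptime_up _ ptime_formula)|exact: ptime_cst].
- exact: ptime_k.
Qed.

Section Output.
Variables (fmove : A -> nat -> bool -> word) (fatom : A -> bool -> ctx -> word -> word -> word).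
Let E (ax : A * fstate) := D ax.1.
Let h (ax : A * fstate) := pr (enc_fstate ax.2) (f ax.1).
Let E' ax := E ax /\ lw (map enc_ctx ax.2.2.2) != [::].

(** The emitters are only called on states with a nonempty stack, where [top] is an actual
    context. *)
Lemma ptime_output :
  (forall b, ptime E' h (fun ax => [:: b ax]) -> ptime E' h (fun ax => fmove ax.1 ax.2.1.2 (b ax))) ->
  (forall b wi wj, ptime E' h (fun ax => [:: b ax]) -> ptime E' h wi -> ptime E' h wj ->
     ptime E' h (fun ax => fatom ax.1 (b ax) (top ax.2) (wi ax) (wj ax))) ->
  ptime D f (fun a => fout (fmove a) (fatom a) (n a) a.2 0 ctx0).
Proof.
move=> pm pa.
have H := @ptime_scan _ enc_fstate fstep A D f init (fun a => enc_fo a.2) (fun a => femit (fmove a) (fatom a)) ptime_formula ptime_fo_states.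
apply: (eq_ptimer _ (H _)) => [a _|]; first by apply: femit_scan; exact: fo_nodes_size.
apply: (@eq_ptimer _ _ _ (fun ax => if lw (map enc_ctx ax.2.2.2) != [::] then
    fmove ax.1 ax.2.1.2 (mover ax.2.2.1 (top ax.2).1.1) ++
    (if is_atom ax.2.2.1 then fatom ax.1 (tagbit 2 ax.2.2.1) (top ax.2) (pfst (drop 3 ax.2.2.1)) (pfst (psnd (drop 3 ax.2.2.1)))
     else [::]) else [::])) => [[a [[n' u] [w [|c st]]]]//|].
have ps : ptime E h (fun ax => enc_fstate ax.2) by exact: ptime_arg.
apply: ptime_if; [by apply: ptime_nonempty; exact: (ptime_stack ps)| |exact: ptime_cst].
have ps' : ptime E' h (fun ax => enc_fstate ax.2) by exact: ptime_arg.
have ne ax : E' ax -> ax.2.2.2 <> [::] by case=> _; case: (ax.2.2.2).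
have pc := ptime_top ps' ne; have pv := ptime_body ps'.
apply: ptime_cat; first exact/pm/(ptime_mover ps')/(ptime_pol pc).
apply: ptime_if; [exact: ptime_is_atom ps'| |exact: ptime_cst].
apply: (@ptime_weak _ _ E') => [ax []//|].
by apply: pa; [exact: ptime_tag ps' 2|exact: ptime_pfst|exact/ptime_pfst/ptime_psnd].
Qed.

Lemma ptime_in g : ptime D f g -> ptime E' h (fun ax => g ax.1).
Proof.
move=> pg; apply: (@ptime_comp _ _ _ (fun ax => f ax.1)); first exact/ptime_skip/ptime_id.
by apply: (@ptime_sub _ _ E' D fst _ _ _ pg) => ax [].
Qed.
End Output.

Lemma ptime_fo_param : ptime D f (fun a => un (3 * fo_nodes a.2)).
Proof.
apply: eq_ptimer (@ptime_output (fun _ _ _ => [:: true; true; true]) (fun _ _ _ _ _ => [::]) _ _).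
- by move=> a _; rewrite fout_param.
- by move=> *; exact: ptime_cst.
- by move=> *; exact: ptime_cst.
Qed.

Lemma ptime_block_vars B (E : B -> Prop) h m u : pun E h m -> pun E h u ->
  ptime E h (fun a => enc_seq enc_nat (block_vars (m a) (u a))).
Proof.
move=> pm pu; apply: (@eq_ptimer _ _ _ (fun a =>
    flatten [seq true :: enc_nat (u a * m a + v) | v <- iota 0 (size (un (m a)))] ++ [:: false])) => [a _|].
  by rewrite enc_seqE /block_vars -map_comp size_un.
apply: ptime_cat; last exact: ptime_cst.
apply: (@ptime_bigcat _ _ _ _ (fun a v => true :: enc_nat (u a * m a + v)) pm).
pose c a := un (m a).
apply/ptime_cons/ptime_enc_nat/pun_add; last exact: ptime_k.
by apply: pun_mul; [exact: (ptime_up c pu)|exact: (ptime_up c pm)].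
Qed.

Lemma ptime_fo_blocks : ptime D f (fun a => enc_seq enc_block (game_blocks (n a) 0 (moves a.2 true))).
Proof.
apply: (@eq_ptimer _ _ _ (fun a => fout (fblocks (n a)) (fun _ _ _ _ => [::]) (n a) a.2 0 ctx0 ++ [:: false])) => [a _|].
  by rewrite fout_blocks enc_seqE.
apply: ptime_cat; last exact: ptime_cst.
apply: (@ptime_output (fun a => fblocks (n a)) (fun _ _ _ _ _ => [::])) => [b pb|*]; last exact: ptime_cst.
have pS := ptime_block_vars (ptime_in ptime_n) (ptime_node (ptime_arg _ _ _)).
apply: (@eq_ptimer _ _ _ (fun ax => if b ax then
   true :: (enc_seq enc_nat (block_vars (n ax.1) ax.2.1.2) ++ enc_nat 1) ++ [:: true; false] ++ enc_nat 0
   else [:: true; false] ++ enc_nat 0 ++ true :: enc_seq enc_nat (block_vars (n ax.1) ax.2.1.2) ++ enc_nat 1)) => [ax _|].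
  by rewrite /fblocks; case: (b ax); rewrite /= /enc_block /enc_pair /= ?cats0.
apply: ptime_ite => //.
  by apply/ptime_cons/ptime_cat; [apply: ptime_cat => //; exact: ptime_cst|exact: ptime_cst].
apply: ptime_cat; first exact: ptime_cst.
apply: ptime_cat; first exact: ptime_cst.
by apply: ptime_cons; apply: ptime_cat => //; exact: ptime_cst.
Qed.

Lemma ptime_lit B (E : B -> Prop) h q m v : pun E h q -> pun E h m -> pun E h v ->
  ptime E h (fun a => true :: enc_lit (false, q a * m a + v a)).
Proof. by move=> pq pm pv; do 2! apply: ptime_cons; apply/ptime_enc_nat/pun_add => //; exact: pun_mul. Qed.

Lemma ptime_fo_clauses : ptime D f (fun a => enc_seq (enc_tnorm (t := 1)) (clauses (n a) (adj a) a.2 0 ctx0)).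
Proof.
apply: (@eq_ptimer _ _ _ (fun a => fout (fun _ _ => [::]) (fclauses (n a) (adj a)) (n a) a.2 0 ctx0 ++ [:: false])) => [a _|].
  by rewrite fout_clauses enc_seqE.
apply: ptime_cat; last exact: ptime_cst.
apply: (@ptime_output (fun _ _ _ => [::]) (fun a => fclauses (n a) (adj a))) => [*|b wi wj pb pi pj]; first exact: ptime_cst.
set E' := fun ax => _ /\ _ in pb pi pj *; set h := fun ax => _ in pb pi pj *.
have ps : ptime E' h (fun ax => enc_fstate ax.2) by exact: ptime_arg.
have ne ax : E' ax -> ax.2.2.2 <> [::] by case=> _; case: (ax.2.2.2).
have pc := ptime_top ps ne; have pn : pun E' h (fun ax => n ax.1) := ptime_in ptime_n.
have pp := ptime_path pc; have pl := ptime_pol pc; have qi := ptime_binder pc pi; have qj := ptime_binder pc pj.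
have pbits : ptime E' h (fun ax => bits ax.1) := ptime_in ptime_bits.
pose c (ax : A * fstate) := un (n ax.1).
pose g (x : A * fstate) v w : word := if (if b x then adj x.1 v w else v == w) != (top x.2).1.1 then
  true :: enc_path (top x.2).2 ++ (true :: enc_lit (false, binder (top x.2).1.2 (wi x) * n x.1 + v)) ++
   (true :: enc_lit (false, binder (top x.2).1.2 (wj x) * n x.1 + w)) ++ [:: false] else [::].
apply: (@eq_ptimer _ _ _ (fun x => flatten [seq flatten [seq g x v w | w <- iota 0 (size (c x))] | v <- iota 0 (size (c x))])) => [x _|].
  by rewrite fclausesE size_un.
apply: (@ptime_bigcat _ _ _ _ (fun x v => flatten [seq g x v w | w <- iota 0 (size (c x))]) pn).
apply: (@ptime_bigcat _ _ _ _ (fun xv w => g xv.1 xv.2 w) (ptime_up c pn)).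
pose c2 (xv : A * fstate * nat) : word := c xv.1.
have up2 r : ptime E' h r -> ptime (below (below E' c) c2) (withk (withk h)) (fun y => r y.1.1).
  by move=> pr; exact: (ptime_up c2 (ptime_up c pr)).
have pv : pun (below (below E' c) c2) (withk (withk h)) (fun y => y.1.2) := ptime_up c2 (@ptime_k _ E' h c).
have pw : pun (below (below E' c) c2) (withk (withk h)) (fun y => y.2) := @ptime_k _ _ _ c2.
rewrite /g; apply: ptime_ite; last exact: ptime_cst.
  apply/ptime_negb/ptime_eqb; last exact: (up2 _ pl).
  apply: (@eq_ptimer _ _ _ (fun y => if b y.1.1 then [:: adj y.1.1.1 y.1.2 y.2] else [:: y.1.2 == y.2])) => [y _|].
    by case: (b _).
  apply: ptime_ite; [exact: (up2 _ pb)| |].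
    apply: ptime_nth; first exact: (up2 _ pbits).
    by apply: pun_add => //; apply: pun_mul => //; exact: (up2 _ pn).
  exact: ptime_eqn.
apply/ptime_cons/ptime_cat; first exact: (up2 _ pp).
apply: ptime_cat; first exact: (ptime_lit (up2 _ qi) (up2 _ pn) pv).
by apply: ptime_cat; [exact: (ptime_lit (up2 _ qj) (up2 _ pn) pw)|exact: ptime_cst].
Qed.

Let y (a : A) : qbf_inst 2 := (game_blocks (n a) 0 (moves a.2 true), clauses (n a) (adj a) a.2 0 ctx0).

Lemma polygon_to_qbf : poly_reduces (visibility_FOMC R C) (QBFSAT 2).
Proof.
(* A simple polygon has at least three vertices, which leaves room for two different moves. *)
have n1 a : D a -> 1 < n a by case=> -[n3 _ _] _ _; exact: ltnW.
exists y, (fun k => 3 * k); split.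
- by move=> a /n1 na; exact: game_valid.
- apply: ptime_pair; last by apply: ptime_cat; [exact: ptime_fo_blocks|exact: ptime_fo_clauses].
  by apply: eq_ptimer ptime_fo_param => a Da; rewrite -(game_param (adj a) (n1 a Da)).
- by exists 3, 1 => k; lia.
- by move=> a Da; rewrite -[X in X <= _]/(qbf_param (y a)) (game_param (adj a) (n1 a Da)) leq_mul2l; exact: fo_nodes_size.
- move=> a Da; have [_ _ sen] := Da.
  apply: iff_sym; apply: (game_models (n1 a Da) _ sen) => i j.
  by rewrite /adj nth_adjacency.
Qed.
End Membership.

(** Membership holds for every class of polygons and hardness for every class containing the
    terrains that are convex fans, so both claims of the theorem are instances. *)
Lemma visibility_FOMC_complete (R : realType) (C : polygon -> Prop) :
  (forall W, terrain R W -> convex_fan R W -> C W) -> AWstar_complete (visibility_FOMC R C).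
Proof.
move=> incl; split; first by exists 2 => //; exact: fpt_poly (fpt_refl _) (polygon_to_qbf R C).
by move=> P [t t0 Pt]; exact: fpt_poly Pt (qbf_to_polygon t0 incl).
Qed.

Theorem theorem19 (R : realType) :
  AWstar_complete (visibility_FOMC R (fun W : polygon => True)) /\
  AWstar_complete
    (visibility_FOMC R (fun W : polygon => terrain R W /\ convex_fan R W)).
Proof. by split; apply: visibility_FOMC_complete => //; split. Qed.
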